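(* Let $\mathbb{F}_3 = \langle a,b,c\rangle$ be the free group of rank $3$ with basis $\{a,b,c\}$, and let $w \in \langle b,c\rangle$ be a cyclically reduced element that is filling in $\langle b,c\rangle$ and is not a power of another element. For $N>0$ let $c_N$ be the combinatorial loop of length $4$ in the complex $\mathcal{F}_3'$ with successive vertices $$[\langle a,b\rangle],\quad [\langle a\rangle],\quad [\langle a, w^N b w^{-N}\rangle],\quad [\langle b\rangle].$$ Then at least $N/6$ triangles are needed to cap off $c_N$ in $\mathcal{F}_3'$. In particular, $\mathcal{F}_3'$ does not satisfy a combinatorial isoperimetric inequality.
   Context: The free factor complex $\mathcal{F}_3$ of $\mathbb{F}_3$ is the simplicial complex (here a graph) whose vertices are conjugacy classes $[A]$ of proper non-trivial free factors of $\mathbb{F}_3$, two vertices being joined by an edge if one is contained in the other up to conjugation. The complex $\mathcal{F}_3'$ is obtained from $\mathcal{F}_3$ by first adding an edge between two vertices $[\langle a',x\rangle]$ and $[\langle a',y\rangle]$ whenever $\{a',x,y\}$ is a basis of $\mathbb{F}_3$, and then adding a $2$-simplex whenever the $1$-skeleton of a $2$-simplex is present. An element $w$ of a free group $B$ is filling in $B$ if it is not contained in any proper free factor of $B$. A simplicial map sends each simplex to a simplex by a linear map taking vertices to vertices. A combinatorial loop $c$ in a simplicial complex $K$ is a sequence of vertices $(v_1,\dots,v_k)$ with cyclically consecutive vertices adjacent or equal; its combinatorial length is $l_C(c)=k$, and it is also regarded as a simplicial map to $K$ from a triangulation of $S^1$ with $k$ edges. The loop $c$ can be capped off with at most $m$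 triangles if there is a triangulation $P$ of the closed disc $D^2$ into at most $m$ $2$-simplices and a simplicial map $c'\colon P\to K$ with $c'|_{S^1}=c$. ''At least $r$ triangles are needed to cap off $c$'' means that every such triangulation $P$ has at least $r$ $2$-simplices. A function $f\colon\mathbb{N}\to\mathbb{N}$ is a combinatorial isoperimetric bound for $K$ if every combinatorial loop $c$ in $K$ can be capped off with at most $f(l_C(c))$ triangles; $K$ does not satisfy a combinatorial isoperimetric inequality if no such bound exists. *)

(* Defs.v *)
From HB Require Import structures.
From mathcomp Require Import all_boot all_order all_algebra perm.
From mathcomp Require Import boolp classical_sets functions cardinality.
From mathcomp Require Import reals topology normedtype trigo.
Import numFieldNormedType.Exports.

Set Implicit Arguments.
Unset Strict Implicit.
Unset Printing Implicit Defensive.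

Import Order.TTheory GRing.Theory Num.Theory.
Local Open Scope classical_set_scope.
Local Open Scope card_scope.

(** * Free groups *)

(* The free group on T consists of the reduced words over T * bool; the letter
   (t, false) stands for the generator t and (t, true) for its inverse. *)
Section FreeGroup.
Variable T : choiceType.
Implicit Types (l m : T * bool) (s u v : seq (T * bool)).

Definition linv l : T * bool := (l.1, ~~ l.2).

Definition no_cancel : rel (T * bool) := fun l m => m != linv l.

Definition reduced s := sorted no_cancel s.

Definition push l s :=
  if s is m :: s' then (if m == linv l then s' else l :: s) else [:: l].

Definition word_mul u v := foldr push v u.

Definition word_inv s := rev (map linv s).

Lemma linvK : involutive linv.
Proof. by case=> t b; rewrite /linv /= negbK. Qed.

Lemma reduced_push l s : reduced s -> reduced (push l s).
Proof.
case: s => //= m s; case: eqVneq => [_ | ml] /=; last by rewrite /no_cancel ml.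
by case: s => //= k s /andP[].
Qed.

Lemma reduced_mul u v : reduced v -> reduced (word_mul u v).
Proof. by move=> rv; elim: u => //= l u; apply: reduced_push. Qed.

Lemma reduced_inv s : reduced s -> reduced (word_inv s).
Proof.
rewrite /reduced /word_inv rev_sorted sorted_map.
apply: sub_sorted => l m; rewrite /no_cancel /= linvK.
by apply: contra_neq => ->.
Qed.

Lemma pushVK l s : reduced s -> push l (push (linv l) s) = s.
Proof.
case: s => [|m s] /=; first by rewrite eqxx.
rewrite linvK; case: eqVneq => [-> | ml] /=; last by rewrite eqxx.
by case: s => //= k s /andP[/negbTE ->].
Qed.

Lemma pushKV l s : reduced s -> push (linv l) (push l s) = s.
Proof. by move=> rs; rewrite -[l in push l s]linvK pushVK. Qed.

Lemma word_mulA u s v : reduced v ->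
  word_mul u (word_mul s v) = word_mul (word_mul u s) v.
Proof.
move=> rv; elim: u => //= l u ->.
case: (word_mul u s) => //= m t; case: eqVneq => //= ->.
by rewrite pushVK // reduced_mul.
Qed.

Lemma word_mul1 s : reduced s -> word_mul s [::] = s.
Proof.
elim: s => //= l s IHs rs; rewrite IHs; last exact: path_sorted rs.
by case: s rs {IHs} => //= m s /andP[/negbTE ->].
Qed.

Lemma word_mulV s : reduced s -> word_mul (word_inv s) s = [::].
Proof.
have H v : reduced v -> word_mul (word_inv s) (word_mul s v) = v.
  move=> rv; elim: s => //= l s IHs; rewrite /word_inv /= rev_cons /word_mul.
  by rewrite foldr_rcons -/(word_mul s v) pushKV ?reduced_mul.
by move=> rs; rewrite -[in RHS](H [::]) // word_mul1.
Qed.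

Lemma word_invK : involutive word_inv.
Proof.
by move=> s; rewrite /word_inv map_rev revK -map_comp (eq_map linvK) map_id.
Qed.

Record freeGroup := FreeGroup { fg_word :> seq (T * bool); _ : reduced fg_word }.

HB.instance Definition _ := [isSub for fg_word].
HB.instance Definition _ := [Choice of freeGroup by <:].

Lemma fg_wordP (x : freeGroup) : reduced x. Proof. exact: valP. Qed.

Definition fg_one := @FreeGroup [::] isT.
Definition fg_inv (x : freeGroup) := FreeGroup (reduced_inv (fg_wordP x)).
Definition fg_mul (x y : freeGroup) := FreeGroup (reduced_mul x (fg_wordP y)).

Fact fg_mulA : associative fg_mul.
Proof. by move=> x y z; apply: val_inj; apply/word_mulA/fg_wordP. Qed.

Fact fg_mul1g : left_id fg_one fg_mul.
Proof. by move=> x; apply: val_inj. Qed.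

Fact fg_mulg1 : right_id fg_one fg_mul.
Proof. by move=> x; apply: val_inj; apply/word_mul1/fg_wordP. Qed.

Fact fg_mulVg : left_inverse fg_one fg_inv fg_mul.
Proof. by move=> x; apply: val_inj; apply/word_mulV/fg_wordP. Qed.

Fact fg_mulgV : right_inverse fg_one fg_inv fg_mul.
Proof.
move=> x; have := fg_mulVg (fg_inv x); congr (fg_mul _ _ = _).
by apply: val_inj; apply: word_invK.
Qed.

HB.instance Definition _ :=
  isGroup.Build freeGroup fg_mulA fg_mul1g fg_mulg1 fg_mulVg fg_mulgV.

Definition fg_gen (t : T) := @FreeGroup [:: (t, false)] isT.

Definition cyclically_reduced (x : freeGroup) :=
  if fg_word x is l :: s then last l s != linv l else true.

(* The homomorphism from the free group on T to G that extends f. *)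
Definition fg_lift (G : groupType) (f : T -> G) (x : freeGroup) : G :=
  (\prod_(l <- fg_word x) (if l.2 then (f l.1)^-1 else f l.1))%g.

Lemma fg_liftM (G : groupType) (f : T -> G) :
  {morph fg_lift f : x y / (x * y)%g >-> (x * y)%g}.
Proof.
pose F (l : T * bool) := (if l.2 then (f l.1)^-1 else f l.1)%g.
have FV l : F (linv l) = (F l)^-1%g by case: l => t [] //=; rewrite invgK.
have Fpush l s : (\prod_(k <- push l s) F k = F l * \prod_(k <- s) F k)%g.
  case: s => [|m s] /=; first by rewrite big_seq1 big_nil mulg1.
  case: eqVneq => [-> | _]; last by rewrite big_cons.
  by rewrite big_cons FV mulgA mulgV mul1g.
case=> u ru [v rv]; change (\prod_(k <- word_mul u v) F k =
  (\prod_(k <- u) F k) * \prod_(k <- v) F k)%g.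
elim: u {ru} => [|l u IHu] /=; first by rewrite big_nil mul1g.
by rewrite Fpush IHu big_cons mulgA.
Qed.

Lemma fg_lift_gen (G : groupType) (f : T -> G) t : fg_lift f (fg_gen t) = f t.
Proof. by rewrite /fg_lift big_seq1. Qed.

End FreeGroup.

(** * Subgroups, free factors and filling elements *)

Section Subgroups.
Variable G : groupType.
Implicit Types (A B C S : set G) (g x y : G).

Definition subgroup A :=
  [/\ A 1%g, forall x y, A x -> A y -> A (x * y)%g & forall x, A x -> A x^-1%g].

Definition gen S : set G := smallest subgroup S.

(* B is the internal free product A * C: it is generated by A and C, and a
   nonempty product of nontrivial factors taken alternately from A (flag true)
   and C (flag false) is nontrivial. *)
Definition is_free_product B A C :=
  [/\ subgroup A, subgroup C, B = gen (A `|` C) &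
      forall s : seq (bool * G),
        s <> [::] -> sorted (fun p q => p.1 != q.1) s ->
        (forall p, p \in s -> p.2 <> 1%g /\ (if p.1 then A else C) p.2) ->
        (\prod_(p <- s) p.2)%g <> 1%g].

Definition free_factor B A := exists C, is_free_product B A C.

Definition proper_free_factor B A := free_factor B A /\ A <> B.

Definition filling B x := B x /\ forall A, proper_free_factor B A -> ~ A x.

Definition conj_class A : set (set G) :=
  [set B | exists g, B = [set (g^-1 * x * g)%g | x in A]].

(* {x 0, ..., x (n - 1)} is a basis, the x i being pairwise distinct. *)
Definition is_basis (n : nat) (x : 'I_n -> G) := bijective (fg_lift x).

End Subgroups.

(** * Simplicial complexes *)

Record complex (V : Type) := Complex {
  simplices : set (set V);
  simplex_finite : forall s, simplices s -> finite_set s;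
  simplex_neq0 : forall s, simplices s -> s !=set0;
  simplex_face : forall s t,
    simplices s -> t `<=` s -> t !=set0 -> simplices t
}.

Section CliqueComplex.
Variables (V : Type) (d : nat) (vertex : set V) (edge : V -> V -> Prop).

Definition clique_simplices : set (set V) :=
  [set s | [/\ s !=set0, s `<=` vertex, s #<= `I_d.+1 &
               forall u v, s u -> s v -> u <> v -> edge u v]].

Fact clique_finite s : clique_simplices s -> finite_set s.
Proof. by case=> _ _ sd _; apply: card_le_finite sd (finite_II _). Qed.

Fact clique_neq0 s : clique_simplices s -> s !=set0.
Proof. by case. Qed.

Fact clique_face s t :
  clique_simplices s -> t `<=` s -> t !=set0 -> clique_simplices t.
Proof.
move=> [_ sV sd sE] ts t0; split=> //; first exact: subset_trans sV.
  exact: card_le_trans (subset_card_le ts) sd.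
by move=> u v /ts su /ts sv; apply: sE.
Qed.

(* The complex of dimension at most d with the given 1-skeleton in which every
   simplex of dimension at most d whose 1-skeleton is present is filled in.
   Only the values of edge at distinct vertices matter. *)
Definition clique_complex := Complex clique_finite clique_neq0 clique_face.

End CliqueComplex.

(** * The complex F'_3 *)

Definition F3 := freeGroup 'I_3.

Definition ga : F3 := fg_gen ord0.
Definition gb : F3 := fg_gen (inord 1).
Definition gc : F3 := fg_gen ord_max.

Definition ff_class (S : set F3) : set (set F3) := conj_class (gen S).

Definition ff_vertex : set (set (set F3)) :=
  [set u | exists A : set F3, [/\ u = conj_class A,
             proper_free_factor setT A & A <> [set 1%g]]].

(* For u = [A] and v = [B]: one of A, B is contained in the other up to
   conjugation. *)
Definition ff_edge (u v : set (set F3)) :=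
  exists A B, [/\ u A, v B & A `<=` B \/ B `<=` A].

Definition ff_extra_edge (u v : set (set F3)) :=
  exists a' x y : F3, [/\ is_basis (tnth [tuple a'; x; y]),
    u = ff_class [set a'; x] & v = ff_class [set a'; y]].

Definition F3' : complex (set (set F3)) :=
  clique_complex 2 ff_vertex (fun u v => ff_edge u v \/ ff_extra_edge u v).

(** * Combinatorial loops *)

Section Loops.
Variables (V : Type) (K : complex V).

Definition adjacent (u v : V) := u <> v /\ simplices K [set u; v].

Definition comb_loop k (c : k.-tuple V) :=
  [/\ (0 < k)%N, forall i, simplices K [set tnth c i] &
      forall i, adjacent (tnth c i) (tnth c (ordS i)) \/
                tnth c i = tnth c (ordS i)].

End Loops.

(** * Triangulations *)

Section Triangulations.
Variable R : realType.
Local Open Scope ring_scope.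

Definition std_simplex n : set 'rV[R]_n.+1 :=
  [set x | (forall i, 0 <= x 0 i) /\ \sum_i x 0 i = 1].

Definition open_simplex n : set 'rV[R]_n.+1 :=
  [set x | (forall i, 0 < x 0 i) /\ \sum_i x 0 i = 1].

(* The affine map of standard simplices sending vertex i to vertex f i. *)
Definition affine_face m n (f : 'I_m.+1 -> 'I_n.+1) (x : 'rV[R]_m.+1) :
    'rV[R]_n.+1 :=
  \row_j \sum_(i | f i == j) x 0 i.

(* A triangulation of X with finitely many closed simplices, of dimension at
   most 2, each given by a characteristic map.  Every point of X lies in exactly
   one open simplex, with unique barycentric coordinates, and every face of a
   simplex is again a simplex, up to a permutation of the vertices.  As for
   Delta-complexes, a simplex may have coinciding vertices and is not required
   to be determined by its vertices: otherwise the circle would not have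
   triangulations with one or two edges. *)
Record triangulation (E : topologicalType) (X : set E) := Triangulation {
  cell : nat -> finType;
  char_map : forall n, cell n -> 'rV[R]_n.+1 -> E;
  cell_dim : forall n, (2 < n)%N -> #|cell n| = 0%N;
  char_continuous : forall n (s : cell n),
    {within @std_simplex n, continuous (char_map s)};
  char_in : forall n (s : cell n) x, std_simplex x -> X (char_map s x);
  char_partition : forall p, X p ->
    exists! u : {n : nat & (cell n * 'rV[R]_n.+1)%type},
      open_simplex (tagged u).2 /\ char_map (tagged u).1 (tagged u).2 = p;
  char_face : forall n (s : cell n) m (f : 'I_m.+1 -> 'I_n.+1), injective f ->
    exists (t : cell m) (g : {perm 'I_m.+1}), forall x, std_simplex x ->
      char_map s (affine_face f x) = char_map t (affine_face g x)
}.

Section SimplicialMaps.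
Variables (E : topologicalType) (X : set E) (P : triangulation X).

Definition vertex_point (v : cell P 0) : E := char_map v (const_mx 1).

Definition cell_vertices n (s : cell P n) : set (cell P 0) :=
  [set v | exists i, vertex_point v = char_map s (delta_mx 0 i)].

(* A simplicial map is determined by its values on vertices. *)
Definition simplicial_map V (K : complex V) (h : cell P 0 -> V) :=
  forall n (s : cell P n), simplices K (h @` cell_vertices s).

End SimplicialMaps.

Definition disc : set (R * R) := [set p | p.1 ^+ 2 + p.2 ^+ 2 <= 1].

(* The point of the unit circle at t turns. *)
Definition circle_pt (t : R) : R * R := (cos (2 * pi * t), sin (2 * pi * t)).

(* The loop c = (v_0, ..., v_(k-1)) is a map from the circle with its k equal
   arcs as edges, v_i being the value at i/k turns; the restriction of h to the
   circle is c.  Requiring the boundary edges of P to have their standard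
   parametrisation only fixes an identification of the boundary of P with this
   model circle, which always extends to the disc. *)
Definition caps_off V (K : complex V) k (c : k.-tuple V)
    (P : triangulation disc) (h : cell P 0 -> V) :=
  simplicial_map K h /\
  forall i : 'I_k,
    (exists v : cell P 0,
       vertex_point v = circle_pt (i%:R / k%:R) /\ h v = tnth c i) /\
    (exists e : cell P 1, forall x, std_simplex x ->
       char_map e x = circle_pt ((i%:R + x 0 ord_max) / k%:R)).

Definition can_cap_off V (K : complex V) k (c : k.-tuple V) (m : nat) :=
  exists (P : triangulation disc) (h : cell P 0 -> V),
    caps_off K c h /\ (#|cell P 2| <= m)%N.

Definition triangles_needed V (K : complex V) k (c : k.-tuple V) (r : R) :=
  forall (P : triangulation disc) (h : cell P 0 -> V),
    caps_off K c h -> r <= #|cell P 2|%:R.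

Definition isoperimetric_bound V (K : complex V) (f : nat -> nat) :=
  forall k (c : k.-tuple V), comb_loop K c -> can_cap_off K c (f k).

Definition isoperimetric V (K : complex V) := exists f, isoperimetric_bound K f.

End Triangulations.

(* Main.v *)
Require Import Defs.
From HB Require Import structures.
From mathcomp Require Import all_boot all_order all_algebra all_fingroup.
From mathcomp Require Import pgroup commutator maximal abelian.
From mathcomp Require Import zify ring lra.
From mathcomp Require Import boolp classical_sets cardinality.
From mathcomp Require Import reals topology normedtype trigo.
Import numFieldNormedType.Exports.

Set Implicit Arguments.
Unset Strict Implicit.
Unset Printing Implicit Defensive.

Import Order.TTheory GRing.Theory Num.Theory.

(** The edges of the complex that join two vertices different from [<a>] of a triangle
at [<a>] are the pairs [<a, x>], [<a, y>] with {a, x, y} a basis: [<a>] has rank one, so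
its neighbours have rank two (neighbour_va), and two classes of rank two are joined only
by the added edges (link_of_va).  Killing a turns such an edge into a basis {x, y} of the
free group F2 on b and c, and [<a, b>] and [<a, w^N b w^-N>] into b and w^N b w^-N.  Two
facts then give at least N triangles.

_The distance_ (F2_distance).  If w is no power of a primitive element of F2, a path of
primitive elements of F2, with consecutive ones forming bases, from b to w^N b w^-N has
at least N edges.  Every basis of F2 is, up to signs and a common conjugation, a pair of
positive words in whose powers one of the two letters is isolated (good_nielsen,
pos_pair_isolated).  After an automorphism w is a word W of minimal length in its
orbit.  The conjugators between successive bases of the path are then subwords of
periodic words with an isolated letter (conj_prefix), and such a word shares with the
periodic word of W no subword longer than one period: a transvection would shorten W
(minimal_isolated).  The product of the conjugators is a conjugate of W^N, so one step
of the path covers at most one period.  An element filling <b, c> is no power of a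
primitive element, as a primitive element spans a proper free factor
(filling_root_free).

_The topology_ (crossing_triangle).  In a disc capping off the loop v0, v1, v2, v3, let
v1 = [<a>] be joined to v0 and v2 but not to v3 = [<b>], and let some property of vertices
hold for v0 and fail for v2.  Some triangle then has the vertex v1 and two others, one
with and one without the property.  Otherwise four barycentric weights would define a
map from the disc to the punctured plane that winds once around the origin along the
boundary; even_crossings excludes this by a count modulo two on a fine grid.

For t < N apply the second fact to the property of being at distance at most t from
[<a, b>] in the link of [<a>]; by the first fact it fails for [<a, w^N b w^-N>].  The
triangle found joins distance t to distance t + 1, so different t give different
triangles (triangle_count).  With w = [b, c], which fills <b, c>
(filling_commutator), the loops c_N have length four but need arbitrarily many
triangles.

Everything about ranks and free factors of F3 rests on retractions: a free factor is a
retract (free_product_retraction), and nested retracts with the same rational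
abelianization are equal (retract_eq), since free groups are residually finite p-groups
(residually_p) and subgroups that span a finite p-group modulo commutators are the
whole group. *)

(** * Words and homomorphisms *)

Section Homs.
Local Open Scope group_scope.
Variables (G H : groupType) (f : G -> H).
Hypothesis fM : {morph f : x y / x * y}.

Lemma hom1 : f 1 = 1.
Proof. by apply: (@mulgI _ (f 1)); rewrite -fM !mulg1. Qed.

Lemma homV : {morph f : x / x^-1}.
Proof. by move=> x; apply: (@mulgI _ (f x)); rewrite -fM !mulgV hom1. Qed.

Lemma homX n : {morph f : x / x ^+ n}.
Proof. by move=> x; elim: n => [|n IHn]; rewrite ?hom1 // !expgS fM IHn. Qed.

Lemma homJ : {morph f : x y / x ^ y}.
Proof. by move=> x y; rewrite /conjg !fM homV. Qed.

Lemma hom_prod (I : Type) (s : seq I) (E : I -> G) :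
  f (\prod_(i <- s) E i) = \prod_(i <- s) f (E i).
Proof. by elim: s => [|i s IHs]; rewrite ?big_nil ?hom1 // !big_cons fM IHs. Qed.
End Homs.

Section Words.
Local Open Scope group_scope.
Variable T : choiceType.
Implicit Types (l m : T * bool) (s u v : seq (T * bool)) (x y g : freeGroup T).

Definition letter l : freeGroup T := @FreeGroup T [:: l] isT.

Definition wordg s : freeGroup T := \prod_(l <- s) letter l.

Lemma letterE l :
  letter l = if l.2 then (fg_gen l.1)^-1 else fg_gen l.1.
Proof. by case: l => t []; apply: val_inj. Qed.

Lemma letterV l : letter (linv l) = (letter l)^-1.
Proof. by case: l => t []; apply: val_inj. Qed.

Lemma wordg_cat u v : wordg (u ++ v) = wordg u * wordg v.
Proof. exact: big_cat. Qed.

Lemma wordg_cons l u : wordg (l :: u) = letter l * wordg u.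
Proof. exact: big_cons. Qed.

Lemma wordg1 l : wordg [:: l] = letter l.
Proof. exact: big_seq1. Qed.

Lemma wordg_nil : wordg [::] = 1.
Proof. exact: big_nil. Qed.

Lemma val_wordg s : reduced s -> fg_word (wordg s) = s.
Proof.
elim: s => [|l s IHs] rs; first by rewrite wordg_nil.
rewrite wordg_cons; change (push l (fg_word (wordg s)) = l :: s).
rewrite IHs; last exact: path_sorted rs.
by case: s rs {IHs} => //= m s /andP[/negbTE ->].
Qed.

Lemma wordgK x : wordg (fg_word x) = x.
Proof. by apply: val_inj; rewrite /= val_wordg // fg_wordP. Qed.

Lemma wordgV s : wordg (word_inv s) = (wordg s)^-1.
Proof.
elim: s => [|l s IHs]; first by rewrite !wordg_nil invg1.
by rewrite /word_inv /= rev_cons -cats1 wordg_cat IHs wordg1 letterV wordg_cons invgM.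
Qed.

Lemma size_push l s : (size (push l s) <= (size s).+1)%N.
Proof. by case: s => //= m s; case: ifP => _ //=; apply: ltnW. Qed.

Lemma size_wordg s : (size (fg_word (wordg s)) <= size s)%N.
Proof.
elim: s => [|l s IHs]; first by rewrite wordg_nil.
rewrite wordg_cons; apply: leq_trans (size_push _ _) _; exact: IHs.
Qed.

Lemma linv_inj : injective (@linv T).
Proof. exact: can_inj (@linvK T). Qed.

Lemma reduced_cat u v : reduced (u ++ v) =
  [&& reduced u, reduced v &
    if u is l :: u' then (if v is m :: _ then m != linv (last l u') else true)
    else true].
Proof.
case: u => [|l u] /=; first by rewrite andbT.
rewrite /reduced /= cat_path; case: v => [|m v] /=; first by rewrite !andbT.
by rewrite {2}/no_cancel; congr (_ && _); rewrite andbC.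
Qed.

Lemma reduced_infix u v s : reduced (u ++ v ++ s) -> reduced v.
Proof. by rewrite !reduced_cat => /and3P[_ /and3P[]]. Qed.

Lemma fg_lift_letter (G : groupType) (f : T -> G) l :
  fg_lift f (letter l) = if l.2 then (f l.1)^-1 else f l.1.
Proof. by rewrite /fg_lift big_seq1. Qed.

Lemma hom_ext (G : groupType) (f h : freeGroup T -> G) :
    {morph f : x y / x * y} -> {morph h : x y / x * y} ->
  (forall t, f (fg_gen t) = h (fg_gen t)) -> f =1 h.
Proof.
move=> fM hM fh x; rewrite -(wordgK x) !hom_prod //; apply: eq_bigr => l _.
by rewrite letterE; case: ifP => _; rewrite ?(homV fM) ?(homV hM) fh.
Qed.

End Words.

(** * Subgroups and alternating products *)

Section Gen.
Local Open Scope group_scope.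
Local Open Scope classical_set_scope.
Variable G : groupType.
Implicit Types (S A C : set G) (x y g : G).

Lemma subgroup_gen S : subgroup (gen S).
Proof.
split.
- by move=> A [[A1 _ _] _]; exact: A1.
- by move=> x y Sx Sy A SA; case: (SA) => -[_ AM _] _; exact: AM (Sx _ SA) (Sy _ SA).
- by move=> x Sx A SA; case: (SA) => -[_ _ AV] _; exact: AV (Sx _ SA).
Qed.

Lemma sub_gen S : S `<=` gen S.
Proof. by move=> x Sx A [_]; apply. Qed.

Lemma gen_sub S A : subgroup A -> S `<=` A -> gen S `<=` A.
Proof. by move=> gA SA x; apply; split. Qed.

Lemma subgroupX A x n : subgroup A -> A x -> A (x ^+ n).
Proof.
by case=> A1 AM _ Ax; elim: n => [|n IHn]; rewrite ?expg0 // expgS; apply: AM.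
Qed.

Definition powers x : set G :=
  [set y | exists (n : nat), y = x ^+ n \/ y = x ^- n].

Lemma powers_id x : powers x x.
Proof. by exists 1%N; left. Qed.

Lemma powersV x y : powers x y -> powers x y^-1.
Proof. by case=> n [] ->; exists n; [right|left; rewrite invgK]. Qed.

Lemma subgroup_powers x : subgroup (powers x).
Proof.
split; first by exists 0%N; left.
- move=> y z [m Hy] [n Hz].
  have E i j : powers x (x ^+ i * x ^- j).
    have [ji|/ltnW ij] := leqP j i.
      by exists (i - j)%N; left; rewrite expgnFr.
    exists (j - i)%N; right; rewrite expgnFr // invgM invgK; congr (_ * _).
  have E' i j : powers x (x ^- j * x ^+ i).
    have cij : commute (x ^+ i) (x ^- j).
      exact: commuteV (commuteX2 i j (commute_refl x)).
    by rewrite -cij; apply: E.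
  case: Hy Hz => -> [] -> //.
    by exists (m + n)%N; left; rewrite expgnDr.
  by exists (n + m)%N; right; rewrite expgnDr invgM.
- exact: powersV.
Qed.

Lemma gen1E x : gen [set x] = powers x.
Proof.
apply/seteqP; split; first by apply: (gen_sub (subgroup_powers x)) => y ->; exact: powers_id.
have gx := subgroup_gen [set x].
have xx : gen [set x] x by apply: sub_gen.
move=> y [n [] ->]; first exact: (subgroupX n gx xx).
by case: (gx) => _ _; apply; exact: (subgroupX n gx xx).
Qed.

Definition alternating := sorted (fun p q : bool * G => p.1 != q.1).

Definition factors A C (s : seq (bool * G)) :=
  forall p, p \in s -> (if p.1 then A else C) p.2.

(** Dropping trivial entries and merging neighbours with equal flags brings any product
    of elements of A and C to alternating form.  Q is arbitrary because two different
    things are followed along this reduction: the existence of an alternating form, and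
    the product of the entries from A alone. *)
Lemma alternate_ind A C (Q : seq (bool * G) -> Prop) :
    subgroup A -> subgroup C ->
    (forall s1 p s2, p.2 = 1 -> Q (s1 ++ s2) -> Q (s1 ++ p :: s2)) ->
    (forall s1 b x y s2, Q (s1 ++ (b, x * y) :: s2) ->
       Q (s1 ++ (b, x) :: (b, y) :: s2)) ->
    (forall s, alternating s -> factors A C s ->
       (forall p, p \in s -> p.2 <> 1) -> Q s) ->
  forall s, factors A C s -> Q s.
Proof.
move=> gA gC Q1 QM Qalt s; move: {2}(size s) (leqnn (size s)) => n.
elim: n s => [|n IHn] s sn sF; first by apply: Qalt => //; case: s sn {sF}.
case: (pselect (exists2 p, p \in s & p.2 = 1)) => [[p ps p1]|H].
  case/splitPr: ps sn sF => s1 s2; rewrite size_cat /= addnS ltnS => sn sF.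
  apply: Q1 => //; apply: IHn; first by rewrite size_cat.
  by move=> q; rewrite mem_cat => qs; apply: sF; rewrite mem_cat inE; case/orP: qs => ->; rewrite ?orbT.
have [alt|nalt] := boolP (alternating s).
  by apply: Qalt => // p ps p1; apply: H; exists p.
have [s1 [b [x [y [s2 E]]]]] :
    exists s1 b x y s2, s = s1 ++ (b, x) :: (b, y) :: s2.
  elim: s nalt {sn sF H} => // -[b x] [|[b' y] s] IHs //=.
  rewrite negb_and negbK => /orP[/eqP /= <-|/IHs[s1 [c [x' [y' [s2 ->]]]]]].
    by exists [::], b, x, y, s.
  by exists ((b, x) :: s1), c, x', y', s2.
rewrite E; apply: QM; apply: IHn.
  by move: sn; rewrite E !size_cat /= !addnS.
have inS q : q \in s1 ++ [:: (b, x), (b, y) & s2] -> (if q.1 then A else C) q.2.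
  by rewrite -E; apply: sF.
move=> q; rewrite mem_cat inE orbCA => /orP[/eqP ->|qs] /=.
  have /= := inS (b, x); have /= := inS (b, y).
  rewrite !mem_cat !inE !eqxx !orbT => /(_ isT) Ay /(_ isT) Ax.
  by case: (b) Ax Ay; [case: gA|case: gC] => _ + _; apply.
by apply: inS; rewrite mem_cat !inE; case/orP: qs => ->; rewrite ?orbT.
Qed.

Definition prodl (s : seq (bool * G)) := \prod_(p <- s) p.2.

Lemma prodl_cat s1 s2 : prodl (s1 ++ s2) = prodl s1 * prodl s2.
Proof. exact: big_cat. Qed.

Lemma gen_factors A C x : subgroup A -> subgroup C -> gen (A `|` C) x ->
  exists2 s, factors A C s & x = prodl s.
Proof.
move=> gA gC; suff H : gen (A `|` C) `<=` [set x | exists2 s, factors A C s & x = prodl s].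
  exact: H.
apply: gen_sub => {x} [|x].
  split.
  - by exists [::]; rewrite // /prodl big_nil.
  - move=> x y [s sF ->] [u uF ->]; exists (s ++ u); rewrite ?prodl_cat // => p.
    by rewrite mem_cat => /orP[/sF|/uF].
  - move=> x [s sF ->]; exists (rev [seq (p.1, p.2^-1) | p <- s]).
      move=> p; rewrite mem_rev => /mapP[q /sF + ->] /=.
      by case: (q.1); [case: gA|case: gC] => _ _; apply.
    by rewrite /prodl -map_rev big_map prodgV revK.
case=> [Ax|Cx]; [exists [:: (true, x)]|exists [:: (false, x)]];
  by rewrite /prodl ?big_seq1 // => p; rewrite inE => /eqP ->.
Qed.

Lemma gen_alternating A C x : subgroup A -> subgroup C -> gen (A `|` C) x ->
  exists s, [/\ alternating s, factors A C s, forall p, p \in s -> p.2 <> 1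
    & x = prodl s].
Proof.
move=> gA gC /(gen_factors gA gC)[s sF ->].
apply: (alternate_ind (Q := fun s => exists s', [/\ alternating s', factors A C s',
  forall p, p \in s' -> p.2 <> 1 & prodl s = prodl s'])) sF => //.
- move=> s1 p s2 p1; suff -> : prodl (s1 ++ p :: s2) = prodl (s1 ++ s2) by apply.
  by rewrite !prodl_cat /prodl big_cons p1 mul1g.
- move=> s1 b u v s2; suff -> : prodl (s1 ++ [:: (b, u), (b, v) & s2])
    = prodl (s1 ++ (b, u * v) :: s2) by apply.
  by rewrite !prodl_cat /prodl !big_cons /= (mulgA u).
- by move=> u ua uF u1; exists u; split.
Qed.

End Gen.

(** * Reduced words and their powers *)

Section FreeWords.
Local Open Scope group_scope.
Local Open Scope classical_set_scope.
Variable T : choiceType.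
Implicit Types (l m : T * bool) (s u v t : seq (T * bool)) (x y g : freeGroup T).

Definition ends_in (P : pred T) (b : bool) x :=
  if fg_word x is l :: s then (P l.1 == b) && (P (last l s).1 == b) else false.

(** At a junction one of the two letters lies over P and the other one does not, so
    nothing cancels. *)
Lemma alternating_word (P : pred T) (s : seq (bool * freeGroup T)) :
    alternating s -> (forall p, p \in s -> ends_in P p.1 p.2) ->
  fg_word (prodl s) = flatten [seq fg_word p.2 | p <- s].
Proof.
move=> alt ends.
have -> : prodl s = wordg (flatten [seq fg_word p.2 | p <- s]).
  elim: s {alt ends} => [|p s IHs]; first by rewrite /prodl big_nil wordg_nil.
  by rewrite /= wordg_cat -IHs wordgK /prodl big_cons.
rewrite val_wordg //.
elim: s alt ends => // p [_ _ _|q s IHs /= /andP[pq alt] ends] /=.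
  by rewrite cats0; exact: (fg_wordP p.2).
have {}IHs := IHs alt (fun r rs => ends r (@mem_behead _ (p :: q :: s) r rs)).
rewrite reduced_cat fg_wordP IHs /=.
have := ends p (mem_head _ _); have := ends q (@mem_behead _ (p :: q :: s) q (mem_head _ _)).
rewrite /ends_in /=.
case: (fg_word p.2) => // l u; case: (fg_word q.2) => //= m v.
move=> /andP[/eqP mP _] /andP[_ /eqP lP]; apply: contraNneq pq => ml.
by rewrite -mP -lP ml.
Qed.

Lemma word_inv_cat u v : word_inv (u ++ v) = word_inv v ++ word_inv u.
Proof. by rewrite /word_inv map_cat rev_cat. Qed.

Lemma size_word_inv u : size (word_inv u) = size u.
Proof. by rewrite size_rev size_map. Qed.

(** Periodic words; they are words of powers only when s is cyclically reduced. *)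
Definition powerw n s : seq (T * bool) := flatten (nseq n s).

Definition creduced s :=
  reduced s && (if s is l :: s' then last l s' != linv l else true).

Lemma powerwS n s : powerw n.+1 s = s ++ powerw n s.
Proof. by []. Qed.

Lemma powerwSr n s : powerw n.+1 s = powerw n s ++ s.
Proof.
elim: n => [|n IHn]; first by rewrite /powerw /= cats0.
by rewrite [LHS]powerwS {1}IHn [in RHS]powerwS catA.
Qed.

Lemma size_powerw n s : size (powerw n s) = (n * size s)%N.
Proof. by elim: n => [|n IHn] //; rewrite powerwS size_cat IHn mulSn. Qed.

Lemma wordg_powerw n s : wordg (powerw n s) = wordg s ^+ n.
Proof. by elim: n => [|n IHn]; rewrite ?wordg_nil // powerwS wordg_cat IHn expgS. Qed.

Lemma word_inv_powerw n s : word_inv (powerw n s) = powerw n (word_inv s).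
Proof. by elim: n => [|n IHn] //; rewrite powerwS word_inv_cat IHn -powerwSr. Qed.

Lemma neq_linv_sym l m : (l != linv m) = (m != linv l).
Proof. by rewrite -(inj_eq (@linv_inj T)) linvK eq_sym. Qed.

Lemma reduced_powerw n s : creduced s -> reduced (powerw n s).
Proof.
case/andP=> rs cs; elim: n => // n IHn; rewrite powerwS reduced_cat rs IHn /=.
case: s cs {rs IHn} => // l s; case: n => //= n.
by rewrite neq_linv_sym.
Qed.

(** Strip inverse letters from both ends until the core C is cyclically reduced; powers
    only repeat the core. *)
Lemma cyclic_core x : x <> 1 ->
  exists t C, [/\ C <> [::], creduced C, fg_word x = t ++ C ++ word_inv t &
    forall n, (0 < n)%N -> fg_word (x ^+ n) = t ++ powerw n C ++ word_inv t].
Proof.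
move=> x1; have: fg_word x <> [::] by move=> E; apply: x1; apply: val_inj.
suff core : forall s, reduced s -> s <> [::] -> exists t C,
    [/\ C <> [::], creduced C & s = t ++ C ++ word_inv t].
  case/(core _ (fg_wordP x)) => t [C [C0 cC E]]; exists t, C; split=> // n n0.
  have -> : x ^+ n = wordg (t ++ powerw n C ++ word_inv t).
    rewrite -(wordgK x) E !wordg_cat wordgV wordg_powerw.
    have cj k : (wordg t * (wordg C * (wordg t)^-1)) ^+ k = wordg t * (wordg C ^+ k * (wordg t)^-1).
      have -> z : wordg t * (z * (wordg t)^-1) = z ^ (wordg t)^-1 by rewrite conjgE invgK.
      by rewrite -conjXg conjgE invgK.
    exact: cj.
  rewrite val_wordg //.
  have := fg_wordP x; rewrite E !reduced_cat => /and3P[-> /and3P[_ -> H1] H2].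
  rewrite reduced_powerw //; case: n n0 => // n _.
  case: C C0 cC E H1 H2 => // l C _ _ _ H1 H2.
  have [D ED lastD] : exists2 D, powerw n.+1 (l :: C) = l :: D & last l D = last l C.
    exists (C ++ powerw n (l :: C)) => //.
    have := powerwSr n (l :: C); rewrite powerwS => /(congr1 (last l)).
    by rewrite !last_cat.
  rewrite ED /= lastD H2 andbT; exact: H1.
move=> s; move: {2}(size s) (leqnn (size s)) => n.
elim: n s => [|n IHn] s sn rs s0; first by case: s sn s0 {rs}.
have [cs|] := boolP (creduced s); first by exists [::], s; rewrite /= cats0.
rewrite /creduced rs /=; case: s sn rs s0 => // l s.
case/lastP: s => [|s m] sn rs _; first by rewrite /= negbK => /eqP/(congr1 snd)/=; case: (l.2).
rewrite last_rcons negbK => /eqP ml.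
have rs' : reduced s.
  by apply: (@reduced_infix _ [:: l] s [:: m]); rewrite cats1.
have [] := IHn s _ rs' _.
- by move: sn; rewrite /= size_rcons => /ltnW.
- by move=> s0; move: rs; rewrite s0 /reduced /= /no_cancel ml eqxx.
move=> t [C [C0 cC E]]; exists (l :: t), C; split=> //.
by rewrite E ml -cats1 /word_inv /= rev_cons -cats1 !catA.
Qed.

Lemma expg_eq1 x n : (0 < n)%N -> x ^+ n = 1 -> x = 1.
Proof.
move=> n0 xn; apply: contrapT => /cyclic_core[t [C [C0 _ _ /(_ n n0)]]].
rewrite xn; case: t => //=; case: n n0 {xn} => // n _; by case: (C) C0.
Qed.

End FreeWords.

(** * Free factors *)

Section Retraction.
Local Open Scope group_scope.
Local Open Scope classical_set_scope.
Variables (G : groupType) (B A C : set G).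
Hypothesis BAC : is_free_product B A C.

Definition prodA (s : seq (bool * G)) := \prod_(p <- s | p.1) p.2.

Let gA : subgroup A. Proof. by case: BAC. Qed.
Let gC : subgroup C. Proof. by case: BAC. Qed.

Lemma prodA_cat s1 s2 : prodA (s1 ++ s2) = prodA s1 * prodA s2.
Proof. exact: big_cat. Qed.

Lemma prodA1 s : factors A C s -> prodl s = 1 -> prodA s = 1.
Proof.
move=> sF; apply: (alternate_ind (A := A) (C := C)
  (Q := fun s => prodl s = 1 -> prodA s = 1)) sF => //.
- move=> s1 p s2 p1.
  have -> : prodl (s1 ++ p :: s2) = prodl (s1 ++ s2).
    by rewrite !prodl_cat /prodl big_cons p1 mul1g.
  suff -> : prodA (s1 ++ p :: s2) = prodA (s1 ++ s2) by [].
  by rewrite !prodA_cat /prodA big_cons p1 mul1g; case: ifP.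
- move=> s1 b u v s2.
  have -> : prodl (s1 ++ [:: (b, u), (b, v) & s2]) = prodl (s1 ++ (b, u * v) :: s2).
    by rewrite !prodl_cat /prodl !big_cons /= (mulgA u).
  suff -> : prodA (s1 ++ [:: (b, u), (b, v) & s2]) = prodA (s1 ++ (b, u * v) :: s2) by [].
  by rewrite !prodA_cat /prodA !big_cons /=; case: b; rewrite // (mulgA u).
- move=> u ua uF u1 pu; have [-> |u0] := pselect (u = [::]); first exact: big_nil.
  case: BAC => _ _ _ /(_ u u0 ua) []//.
  by move=> p pu'; split; [apply: u1|apply: uF].
Qed.

(** Erasing the entries from C is well defined on elements: a relation between products
    reduces to the empty product, alternating nontrivial products being nontrivial. *)
Lemma prodA_eq s u : factors A C s -> factors A C u -> prodl s = prodl u ->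
  prodA s = prodA u.
Proof.
move=> sF uF su.
pose v := rev [seq (p.1, p.2^-1) | p <- u].
have vF : factors A C v.
  move=> p; rewrite mem_rev => /mapP[q /uF + ->] /=.
  by case: (q.1); [case: gA|case: gC] => _ _; apply.
have vu : prodl v = (prodl u)^-1.
  by rewrite /prodl /v -map_rev big_map prodgV revK.
have vuA : prodA v = (prodA u)^-1.
  by rewrite /prodA /v -map_rev big_map prodgV revK.
apply: divg1_eq; rewrite -vuA -prodA_cat; apply: prodA1.
  by move=> p; rewrite mem_cat => /orP[/sF|/vF].
by rewrite prodl_cat vu su mulgV.
Qed.

(** The retraction writes an element as a product of elements of A and C and erases the
    latter. *)
Lemma free_product_retraction : exists r : G -> G,
  [/\ forall x y, B x -> B y -> r (x * y) = r x * r y,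
      forall x, B x -> A (r x), forall x, A x -> r x = x
    & forall x, C x -> r x = 1].
Proof.
have /choice [g gP] : forall x, exists s, B x -> factors A C s /\ x = prodl s.
  move=> x; have [Bx|] := pselect (B x); last by exists [::].
  case: BAC => _ _ BE _; move: (Bx); rewrite {1}BE.
  by case/(gen_factors gA gC) => s sF xs; exists s.
have BE : B = gen (A `|` C) by case: BAC.
have AB x : A x -> B x by move=> Ax; rewrite BE; apply: sub_gen; left.
have CB x : C x -> B x by move=> Cx; rewrite BE; apply: sub_gen; right.
have gB : subgroup B by rewrite BE; apply: subgroup_gen.
have gE s : B (prodl s) -> factors A C s -> prodA (g (prodl s)) = prodA s.
  by move=> /gP[gF pE] sF; apply: prodA_eq.
exists (fun x => prodA (g x)); split.
- move=> x y Bx By; have [xF xE] := gP x Bx; have [yF yE] := gP y By.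
  have Bxy : B (x * y) by case: gB => _ + _; apply.
  rewrite -prodA_cat -(gE (g x ++ g y)); first by rewrite prodl_cat -xE -yE.
    by rewrite prodl_cat -xE -yE.
  by move=> p; rewrite mem_cat => /orP[/xF|/yF].
- move=> x Bx; have [xF _] := gP x Bx; rewrite /prodA.
  elim: (g x) xF => [|p s IHs] sF; first by rewrite big_nil; case: gA.
  have As : A (prodA s) by apply: IHs => q qs; apply: sF; rewrite inE qs orbT.
  rewrite big_cons; case: ifP => // pA; case: gA => _ AM _; apply: AM => //.
  by have := sF p (mem_head _ _); rewrite pA.
- move=> x Ax; have := gE [:: (true, x)]; rewrite /prodl /prodA !big_cons !big_nil.
  rewrite /= !mulg1; apply; first exact: AB.
  by move=> p; rewrite inE => /eqP ->.
- move=> x Cx; have := gE [:: (false, x)]; rewrite /prodl /prodA !big_cons !big_nil.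
  rewrite /= !mulg1; apply; first exact: CB.
  by move=> p; rewrite inE => /eqP ->.
Qed.

Lemma free_product_sub : A `<=` B.
Proof. by case: BAC => _ _ -> _ x Ax; apply: sub_gen; left. Qed.

End Retraction.

Section SubBasis.
Local Open Scope group_scope.
Local Open Scope classical_set_scope.
Variables (T : choiceType).
Implicit Types (P : pred T) (x y : freeGroup T).

Definition word_over P x := all (fun l => P l.1) (fg_word x).

Lemma subgroup_word_over P : subgroup [set x | word_over P x].
Proof.
split=> //= [x y|x]; rewrite /word_over /=.
  move=> Px Py; elim: (fg_word x) Px => //= l s IHs /andP[Pl /IHs].
  case: (word_mul s (fg_word y)) => [|m u] /=; first by rewrite Pl.
  by case: ifP => _ /andP[Pm Pu] /=; rewrite ?Pl ?Pm Pu.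
by rewrite all_rev all_map.
Qed.

Lemma gen_word_over P : gen [set fg_gen t | t in P] = [set x | word_over P x].
Proof.
apply/seteqP; split.
  apply: gen_sub; first exact: subgroup_word_over.
  by move=> x [t Pt <-] /=; rewrite /word_over /= andbT.
move=> x Px; rewrite -(wordgK x).
have gP := subgroup_gen [set (@fg_gen T t) | t in P].
move: Px; rewrite /= /word_over; elim: (fg_word x) => [|l s IHs] /=; first by rewrite wordg_nil; case: gP.
move=> /andP[Pl /IHs Ps]; rewrite wordg_cons; case: (gP) => _ GM _; apply: GM => //.
have Gl : gen [set (@fg_gen T t) | t in P] (fg_gen l.1) by apply: sub_gen; exists l.1.
by rewrite letterE; case: ifP => // _; case: gP => _ _; apply; exact: Gl.
Qed.

Lemma word_over_ends P b x : x <> 1 -> word_over (fun t => P t == b) x -> ends_in P b x.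
Proof.
move=> x1; rewrite /word_over /ends_in.
case E: (fg_word x) => [|l s]; first by case: x1; apply: val_inj.
move=> /allP Ps; rewrite (Ps l) ?mem_head //=.
by rewrite (Ps (last l s)) // mem_last.
Qed.

End SubBasis.

Section FreeProductImage.
Local Open Scope group_scope.
Local Open Scope classical_set_scope.
Variables (T : choiceType) (G : groupType) (f : freeGroup T -> G).
Hypotheses (fM : {morph f : x y / x * y}) (fI : injective f).

Lemma subgroup_image (A : set (freeGroup T)) : subgroup A -> subgroup (f @` A).
Proof.
case=> A1 AM AV; split.
- by exists 1 => //; rewrite (hom1 fM).
- move=> _ _ [x Ax <-] [y Ay <-]; exists (x * y); rewrite ?fM //.
  exact: AM.
- by move=> _ [x Ax <-]; exists x^-1; rewrite ?(homV fM) //; apply: AV.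
Qed.

(** The letters over P and the other ones span complementary factors: an alternating
    product is a concatenation of reduced words whose
    junctions do not cancel. *)
Lemma free_product_subset (P : pred T) :
  is_free_product (range f) (f @` [set x | word_over P x])
    (f @` [set x | word_over (predC P) x]).
Proof.
split.
- exact/subgroup_image/subgroup_word_over.
- exact/subgroup_image/subgroup_word_over.
- apply/seteqP; split; last first.
    apply: gen_sub => [|_ [] [x _ <-]]; [|by exists x..].
    split; first by exists 1; rewrite ?(hom1 fM).
      by move=> _ _ [x _ <-] [y _ <-]; exists (x * y).
    by move=> _ [x _ <-]; exists x^-1; rewrite ?(homV fM).
  move=> _ [x _ <-]; rewrite -(wordgK x).
  set S := _ `|` _; have gS := subgroup_gen S.
  elim: (fg_word x) => [|l s IHs]; first by rewrite wordg_nil (hom1 fM); case: gS.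
  rewrite wordg_cons fM; case: (gS) => _ GM _; apply: GM => //.
  apply: sub_gen; have [Pl|Pl] := boolP (P l.1); [left|right];
    by exists (letter l); rewrite //= /word_over /= Pl.
- move=> s s0 alt sF.
  have /choice [g gP] : forall p, exists y, p \in s ->
      f y = p.2 /\ word_over (fun t => P t == p.1) y.
    move=> p; have [ps|] := pselect (p \in s); last by exists 1.
    have [_] := sF p ps; case: ifP => pb [y Py <-]; exists y => _; split=> //.
      by apply: sub_all Py => l ->.
    by apply: sub_all Py => l /= /negbTE ->.
  have -> : \prod_(p <- s) p.2 = f (prodl [seq (p.1, g p) | p <- s]).
    rewrite /prodl (hom_prod fM) big_map /= !big_seq.
    by apply: eq_bigr => p /gP[].
  rewrite -(hom1 fM) => /fI E.
  have gp1 p : p \in s -> g p <> 1.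
    by move=> ps gp; have [+ _] := sF p ps; case: (gP p ps) => <- _; rewrite gp (hom1 fM).
  have: fg_word (prodl [seq (p.1, g p) | p <- s]) = [::] by rewrite E.
  rewrite (@alternating_word _ P).
  + case: s s0 gp1 {alt sF gP E} => // p s _ /(_ p (mem_head _ _)).
    rewrite /=; case E: (fg_word (g p)) => // + _; apply.
    by apply: val_inj.
  + by rewrite /alternating sorted_map.
  + move=> _ /mapP[p ps ->] /=; apply: word_over_ends; first exact: gp1.
    by case: (gP p ps).
Qed.

End FreeProductImage.

(** * Bases of the free group of rank two *)

Section F2.
Local Open Scope group_scope.
Local Open Scope classical_set_scope.

Definition F2 := freeGroup bool.
Implicit Types (x y z g p q : F2) (e d : bool) (t : bool).

Definition b2 : F2 := fg_gen false.
Definition c2 : F2 := fg_gen true.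

Definition sub2 x y : F2 -> F2 := fg_lift (fun t : bool => if t then y else x).

Definition basis2 x y := bijective (sub2 x y).

Lemma sub2M x y : {morph sub2 x y : u v / u * v}.
Proof. exact: fg_liftM. Qed.

Lemma sub2b x y : sub2 x y b2 = x.
Proof. exact: fg_lift_gen. Qed.

Lemma sub2c x y : sub2 x y c2 = y.
Proof. exact: fg_lift_gen. Qed.

Lemma hom2_ext (G : groupType) (f h : F2 -> G) :
    {morph f : x y / x * y} -> {morph h : x y / x * y} ->
  f b2 = h b2 -> f c2 = h c2 -> f =1 h.
Proof. by move=> fM hM fb fc; apply: hom_ext => // -[]. Qed.

Lemma sub2_comp (f : F2 -> F2) x y : {morph f : u v / u * v} ->
  f \o sub2 x y =1 sub2 (f x) (f y).
Proof.
move=> fM; apply: hom2_ext; rewrite /= ?sub2b ?sub2c //.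
  by move=> u v /=; rewrite sub2M fM.
exact: sub2M.
Qed.

(** Common conjugation is a composite of the other moves; as a constructor it lets
    properties that hold up to conjugation be proved by induction. *)
Inductive nielsen : F2 -> F2 -> Prop :=
| Nielsen_std : nielsen b2 c2
| Nielsen_swap x y : nielsen x y -> nielsen y x
| Nielsen_inv x y : nielsen x y -> nielsen x^-1 y
| Nielsen_mul x y : nielsen x y -> nielsen x (x * y)
| Nielsen_conj x y g : nielsen x y -> nielsen (x ^ g) (y ^ g).

(** The sign convention of the letters: true stands for the inverse. *)
Definition sgg (G : groupType) (e : bool) (x : G) := if e then x^-1 else x.

Lemma sggK (G : groupType) e : involutive (@sgg G e).
Proof. by case: e => x //=; rewrite /sgg invgK. Qed.

Lemma sggJ (G : groupType) e (x g : G) : sgg e (x ^ g) = sgg e x ^ g.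
Proof. by case: e; rewrite //= conjVg. Qed.

Lemma hom_sgg (G H : groupType) (f : G -> H) : {morph f : x y / x * y} ->
  forall e, {morph f : x / sgg e x}.
Proof. by move=> fM [] x //=; rewrite (homV fM). Qed.

Lemma nielsen_sgg e d x y : nielsen x y -> nielsen (sgg e x) (sgg d y).
Proof.
have I a u v : nielsen u v -> nielsen (sgg a u) v.
  by case: a => //=; apply: Nielsen_inv.
by move=> N; apply/I/Nielsen_swap/I/Nielsen_swap.
Qed.

Lemma nielsen_mulr x y u : powers x u -> nielsen x y -> nielsen x (u * y).
Proof.
have H n : nielsen x y -> nielsen x (x ^+ n * y).
  elim: n => [|n IHn] N; first by rewrite expg0 mul1g.
  by rewrite expgS -mulgA; apply/Nielsen_mul/IHn.
have H' n : nielsen x y -> nielsen x (x ^- n * y).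
  elim: n => [|n IHn] N; first by rewrite expg0 invg1 mul1g.
  rewrite expgSr invgM -mulgA -[x in nielsen x _]invgK.
  by apply/Nielsen_inv/Nielsen_mul/Nielsen_inv/IHn.
by case=> n [] ->; [apply: H|apply: H'].
Qed.

Lemma nielsen_mull x y u : powers x u -> nielsen x y -> nielsen x (y * u).
Proof.
move=> xu N; rewrite -[y * u]invgK invgM -[y^-1]/(sgg true y).
apply: (@nielsen_sgg false true); apply: nielsen_mulr; first exact: powersV.
exact: (@nielsen_sgg false true).
Qed.

(** The endomorphisms whose values at b and c form such a pair are closed under
    composition. *)
Lemma nielsen_hom (f : F2 -> F2) x y : {morph f : u v / u * v} ->
  nielsen (f b2) (f c2) -> nielsen x y -> nielsen (f x) (f y).
Proof.
move=> fM Nf; elim=> {x y} // x y.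
- by move=> _; apply: Nielsen_swap.
- by move=> _; rewrite (homV fM); apply: Nielsen_inv.
- by move=> _; rewrite fM; apply: Nielsen_mul.
- by move=> g _; rewrite /conjg !fM !(homV fM); apply: Nielsen_conj.
Qed.

Lemma nielsen_basis x y : nielsen x y -> basis2 x y.
Proof.
have inv_bij (f h : F2 -> F2) : {morph f : u v / u * v} -> {morph h : u v / u * v} ->
    f (h b2) = b2 -> f (h c2) = c2 -> h (f b2) = b2 -> h (f c2) = c2 -> bijective f.
  move=> fM hM fb fc hb hc; exists h.
    by apply: (hom2_ext (f := h \o f) (h := id)) => // u v /=; rewrite fM hM.
  by apply: (hom2_ext (f := f \o h) (h := id)) => // u v /=; rewrite hM fM.
have step x0 y0 (u v u' v' : F2) : basis2 x0 y0 ->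
    sub2 u v u' = b2 -> sub2 u v v' = c2 -> sub2 u' v' u = b2 -> sub2 u' v' v = c2 ->
    basis2 (sub2 x0 y0 u) (sub2 x0 y0 v).
  move=> B H1 H2 H3 H4; apply: (eq_bij (f := sub2 x0 y0 \o sub2 u v)).
    apply: bij_comp => //; apply: (inv_bij _ (sub2 u' v')) => //; rewrite ?sub2b ?sub2c //; exact: sub2M.
  exact/sub2_comp/sub2M.
elim=> {x y} [|x y _ B|x y _ B|x y _ B|x y g _ B].
- by apply: (inv_bij _ (sub2 b2 c2)); rewrite ?sub2b ?sub2c //; exact: sub2M.
- by have := step x y c2 b2 c2 b2 B; rewrite !sub2b !sub2c; apply.
- have := step x y b2^-1 c2 b2^-1 c2 B.
  by rewrite !(homV (sub2M _ _)) !sub2b !sub2c invgK; apply.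
- have := step x y b2 (b2 * c2) b2 (b2^-1 * c2) B.
  rewrite !(sub2M _ _ _ _) !(homV (sub2M _ _)) !sub2b !sub2c.
  by rewrite mulKg mulVKg; apply.
- apply: (eq_bij (f := (fun z => z ^ g) \o sub2 x y)).
    apply: bij_comp => //; exists (fun z => z ^ g^-1); [exact: conjgK|exact: conjgKV].
  by apply: sub2_comp => u v; exact: conjMg.
Qed.

(** ** Positive words *)

(** The pairs obtained from the letters by a list of moves, each of which swaps the
    pair (P, Q) or replaces it by (P, PQ). *)
Fixpoint pos_pair (l : seq bool) : seq bool * seq bool :=
  if l is r :: l' then
    let p := pos_pair l' in if r then (p.2, p.1) else (p.1, p.1 ++ p.2)
  else ([:: false], [:: true]).

(** The moves as substitutions: false replaces c by bc, true exchanges the letters. *)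
Definition subst (r : bool) (s : seq bool) : seq bool :=
  if r then map negb s else flatten [seq (if t then [:: false; true] else [:: t]) | t <- s].

Arguments subst : simpl never.

Lemma subst_cat r s s' : subst r (s ++ s') = subst r s ++ subst r s'.
Proof. by case: r; rewrite /subst ?map_cat ?flatten_cat. Qed.

(** The innermost move acts on words, the outer ones on pairs. *)
Lemma pos_pair_rcons l r :
  pos_pair (rcons l r) = (subst r (pos_pair l).1, subst r (pos_pair l).2).
Proof.
elim: l => [|[] l IHl] /=; rewrite ?IHl //=; first by case: r.
by rewrite subst_cat.
Qed.

(** The letter t does not occur twice in a row in the periodic word of s. *)
Definition isolated t (s : seq bool) :=
  forall n, ~~ infix [:: t; t] (flatten (nseq n s)).

Lemma subst_powers r n s : flatten (nseq n (subst r s)) = subst r (flatten (nseq n s)).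
Proof.
elim: n => [|n IHn]; first by case: r.
by rewrite /= IHn subst_cat.
Qed.

(** If the innermost move replaces c by bc then every c is preceded by a b, so c is
    isolated; an exchange of letters reduces to a shorter list of moves. *)
Lemma pos_pair_isolated l : (exists t, isolated t (pos_pair l).1) /\
  (exists t, isolated t (pos_pair l).2).
Proof.
elim/last_ind: l => [|l r [[t1 I1] [t2 I2]]].
  have H t n : ~~ infix [:: ~~ t; ~~ t] (flatten (nseq n [:: t])).
    apply/negP => /mem_infix /(_ (~~ t)); rewrite mem_head => /(_ isT).
    by case/flattenP=> s; rewrite mem_nseq => /andP[_ /eqP ->]; rewrite inE; case: t.
  by split; [exists true; apply: (H false)|exists false; apply: (H true)].
have noc s : ~~ infix [:: true; true] (subst false s).
  elim: s => // t s /negbTE IHs.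
  have hd : prefix [:: true] (subst false s) = false by case: s {IHs} => // -[].
  have -> : subst false (t :: s) = (if t then [:: false; true] else [:: t]) ++ subst false s by [].
  by case: t; rewrite /= IHs ?hd.
rewrite pos_pair_rcons; case: r => /=; last first.
  by split; exists true => n; rewrite subst_powers; apply: noc.
have neg s t : isolated t s -> isolated (~~ t) (subst true s).
  move=> I n; rewrite subst_powers /subst; apply: contra (I n) => /infixP[u [v E]].
  have := congr1 (map negb) E; rewrite -map_comp (eq_map (g := id)) ?map_id; last exact: negbK.
  by move=> ->; rewrite !map_cat /= negbK; apply/infixP; exists (map negb u), (map negb v).
by split; [exists (~~ t1)|exists (~~ t2)]; apply: neg.
Qed.

(** Positive words in the letters b^+-1 and c^+-1, the signs being prescribed by sg. *)
Definition emb (sg : bool -> bool) (s : seq bool) : seq (bool * bool) :=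
  [seq (t, sg t) | t <- s].

Lemma reduced_emb sg s : reduced (emb sg s).
Proof.
rewrite /reduced /emb sorted_map; case: s => // t s; elim: s t => //= u s IHs t.
rewrite IHs andbT /no_cancel; apply/eqP => -[-> /=]; by case: (sg t).
Qed.

Lemma creduced_emb sg s : creduced (emb sg s).
Proof.
rewrite /creduced reduced_emb; case: s => //= t s.
rewrite last_map /linv /=; apply/eqP => -[-> /=]; by case: (sg t).
Qed.

Definition posg sg (s : seq bool) : F2 := wordg (emb sg s).

Lemma posg_cat sg s s' : posg sg (s ++ s') = posg sg s * posg sg s'.
Proof. by rewrite /posg /emb map_cat wordg_cat. Qed.

(** Up to inversion of its members, inversion of letters and a common conjugation,
    (x, y) is a pair of positive words. *)
Definition good x y := exists (l : seq bool) sg e d g,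
  x = sgg e (posg sg (pos_pair l).1) ^ g /\ y = sgg d (posg sg (pos_pair l).2) ^ g.

Lemma good_conj x y h : good x y -> good (x ^ h) (y ^ h).
Proof.
by case=> l [sg [e [d [g [-> ->]]]]]; exists l, sg, e, d, (g * h); rewrite !conjgM.
Qed.

Lemma good_conjV x y h : good (x ^ h) (y ^ h) -> good x y.
Proof. by move/(good_conj h^-1); rewrite !conjgK. Qed.

Lemma good_sgg x y e d : good x y -> good (sgg e x) (sgg d y).
Proof.
case=> l [sg [e' [d' [g [-> ->]]]]]; exists l, sg, (e (+) e'), (d (+) d'), g.
by rewrite !sggJ; split; congr (_ ^ _); [case: e e'|case: d d'] => [] [];
   rewrite /sgg //= invgK.
Qed.

Lemma good_swap x y : good x y -> good y x.
Proof.
by case=> l [sg [e [d [g [-> ->]]]]]; exists (true :: l), sg, d, e, g.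
Qed.

Lemma good_pos sg l : good (posg sg (pos_pair l).1) (posg sg (pos_pair l).2).
Proof. by exists l, sg, false, false, 1; rewrite !conjg1. Qed.

Lemma good_pos_mul sg l (P := posg sg (pos_pair l).1) (Q := posg sg (pos_pair l).2) :
  good P (P * Q) /\ good Q (P * Q).
Proof.
split; first by have := good_pos sg (false :: l); rewrite /= posg_cat.
have := good_conj Q (good_pos sg (false :: true :: l)); rewrite /= posg_cat -/P -/Q.
by rewrite /conjg -mulgA !mulKg.
Qed.

End F2.

Section WordEnds.
Local Open Scope group_scope.
Local Open Scope classical_set_scope.

Lemma ends_inV (T : choiceType) (P : pred T) b (x : freeGroup T) :
  ends_in P b x -> ends_in P b x^-1.
Proof.
rewrite /ends_in /=; case: (fg_word x) => // l s.
rewrite /word_inv; case/lastP: s => [|s m]; first by [].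
rewrite last_rcons /= map_rcons rev_cons rev_rcons /= last_rcons /=.
by rewrite andbC.
Qed.

Lemma ends_inX (T : choiceType) (P : pred T) b (x : freeGroup T) n :
    ends_in P b x -> (1 < size (fg_word x))%N -> (0 < n)%N ->
  ends_in P b (x ^+ n) && (1 < size (fg_word (x ^+ n)))%N.
Proof.
move=> xP x2 n0; have x1 : x <> 1 by move=> x1; rewrite x1 in x2.
have [t [C [C0 _ xE /(_ n n0)]]] := cyclic_core x1.
move: xP x2; rewrite /ends_in xE => + + ->; case: n n0 => // n _.
case: t {xE} => [|l t] /=.
  rewrite /word_inv /= !cats0; case: C C0 => // l C _ /= /andP[lP CP] C2.
  have -> : last l (C ++ powerw n (l :: C)) = last l C.
    have := powerwSr n (l :: C); rewrite powerwS => /(congr1 (last l)).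
    by rewrite !last_cat.
  by rewrite lP CP /= ltnS size_cat addn_gt0; move: C2; rewrite ltnS => ->.
move=> + _; rewrite /word_inv /= rev_cons -cats1 !last_cat /= => ->.
by rewrite !size_cat /= !addnS.
Qed.

Lemma hom_in (T : choiceType) (G : groupType) (f : freeGroup T -> G) (H : set G) :
    {morph f : x y / x * y} -> subgroup H -> (forall i, H (f (fg_gen i))) ->
  forall x, H (f x).
Proof.
move=> fM [H1 HM HV] Hg x; rewrite -(wordgK x) (hom_prod fM).
elim: (fg_word x) => [|l s IHs]; first by rewrite big_nil.
by rewrite big_cons; apply: HM => //; rewrite letterE; case: ifP => _ //; rewrite (homV fM); apply: HV.
Qed.

End WordEnds.

Section Closure.
Local Open Scope group_scope.
Local Open Scope classical_set_scope.
Implicit Types (x y z g : F2) (e d : bool) (t : bool).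

Lemma good_pos_rmul sg l (P := posg sg (pos_pair l).1) (Q := posg sg (pos_pair l).2) :
  good P (Q * P) /\ good Q (Q * P).
Proof. by have [] := good_pos_mul sg (true :: l). Qed.

(** Undo the outermost move that produced (P, Q); if there is none, invert one of the
    letters. *)
Lemma good_pos_div sg l (P := posg sg (pos_pair l).1) (Q := posg sg (pos_pair l).2) :
  good P (Q * P^-1) /\ good Q (P * Q^-1).
Proof.
rewrite {}/P {}/Q; elim: l => [|[] l [IH1 IH2]] //=.
- have flip u : exists2 sg', posg sg' [:: u] = (posg sg [:: u])^-1 &
      posg sg' [:: ~~ u] = posg sg [:: ~~ u].
    exists (fun t => sg t (+) (t == u)); rewrite /posg !wordg1 -?letterV /linv /= ?eqxx ?addbT //.
    by case: u; rewrite /= addbF.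
  split.
    have [sg' Pb Qb] := flip false.
    have [+ _] := good_pos_rmul sg' [::]; rewrite /= Pb Qb => /(good_sgg true false).
    by rewrite /sgg invgK.
  have [sg' Qb Pb] := flip true.
  have [_ +] := good_pos_mul sg [::].
  have [_ +] := good_pos_mul sg' [::]; rewrite /= Pb Qb => /(good_sgg true false) + _.
  by rewrite /sgg invgK.
- split; rewrite posg_cat.
    apply: (@good_conjV _ _ (posg sg (pos_pair l).1)).
    by rewrite /conjg mulKg !mulgA mulVg mul1g mulgVK; apply: good_pos.
  apply: (@good_conjV _ _ (posg sg (pos_pair l).1)).
  have [_ /good_swap/(good_sgg false true)] := good_pos_rmul sg l.
  by rewrite /sgg /conjg invgM !mulgA !mulVg !mul1g mulgVK.
Qed.

Lemma good_mul x y : good x y -> good x (x * y).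
Proof.
case=> l [sg [e [d [g [-> ->]]]]]; rewrite -conjMg; apply: good_conj.
have [pm _] := good_pos_mul sg l; have [pr _] := good_pos_rmul sg l.
have [pd _] := good_pos_div sg l.
case: e d => [] []; rewrite /sgg //.
- by have := good_sgg true true pr; rewrite /sgg invgM.
- apply: (@good_conjV _ _ (posg sg (pos_pair l).1)^-1).
  have := good_sgg true false pd; rewrite /sgg.
  by rewrite /conjg invgK !mulgA !mulgV !mul1g.
- by have := good_sgg false true pd; rewrite /sgg invgM invgK.
Qed.

Lemma good_nielsen x y : nielsen x y -> good x y.
Proof.
elim=> {x y} [|x y _|x y _|x y _|x y g _].
- by have := good_pos (fun=> false) [::]; rewrite /posg /= !wordg1 !letterE.
- exact: good_swap.
- exact: (@good_sgg _ _ true false).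
- exact: good_mul.
- exact: good_conj.
Qed.

(** If {b, z} is a basis then z = u c^+-1 v for powers u, v of b.  Strip from z all
    leading and trailing powers of b: were more than one letter left, products of
    powers of b and of the stripped z would have no cancellation at the junctions
    and could not equal c. *)
Lemma basis_fix_b z : basis2 b2 z ->
  exists u v e, [/\ powers b2 u, powers b2 v & z = u * sgg e c2 * v].
Proof.
move=> zB; have [zi zK ziK] := zB.
pose S n := exists u v z', [/\ powers b2 u, powers b2 v, z = u * z' * v &
  size (fg_word z') = n].
have [gb1 gbM gbV] := subgroup_powers b2.
have exS : exists n, `[< S n >].
  by exists (size (fg_word z)); apply/asboolP; exists 1, 1, z; rewrite mul1g mulg1.
case: (ex_minnP exS) => n /asboolP[u [v [z' [bu bv zE sz']]]] nmin.
have bl l : l.1 = false -> powers b2 (letter l).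
  by case: l => t [] /= ->; rewrite letterE /=; [apply: powersV|]; apply: powers_id.
have mins z'' u' v' : powers b2 u' -> powers b2 v' -> z = u' * z'' * v' ->
    (n <= size (fg_word z''))%N.
  by move=> bu' bv' E; apply: nmin; apply/asboolP; exists u', v', z''.
have z'0 : fg_word z' <> [::].
  move=> z'1; have zb : powers b2 z.
    by rewrite zE (_ : z' = 1) ?mulg1; [apply: gbM|apply: val_inj].
  have cz : commute b2 z.
    by case: zb => k [] ->; [|apply: commuteV]; apply/commuteX/commute_refl.
  have : b2 * c2 = c2 * b2.
    by apply: (can_inj zK); rewrite !sub2M !sub2b !sub2c.
  by move/(congr1 (@fg_word bool)).
have endz : ends_in id true z'.
  rewrite /ends_in; case E: (fg_word z') (fg_wordP z') => [|l s] // rs.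
  apply/andP; split.
    case: eqP => // /eqP; rewrite eqb_id => /negbTE l0.
    have := mins (wordg s) (u * letter l) v (gbM _ _ bu (bl _ l0)) bv.
    rewrite zE -{1}(wordgK z') E wordg_cons !mulgA => /(_ erefl).
    by rewrite val_wordg -?sz' ?E ?ltnn //; apply: path_sorted rs.
  case: eqP => // /eqP; rewrite eqb_id => /negbTE l0.
  have E' := lastI l s; rewrite E' in E rs.
  have rs' : reduced (belast l s).
    by apply: (@reduced_infix _ [::] (belast l s) [:: last l s]); rewrite cats1.
  have := mins (wordg (belast l s)) u (letter (last l s) * v) bu (gbM _ _ (bl _ l0) bv).
  rewrite zE -{1}(wordgK z') E -cats1 wordg_cat wordg1 !mulgA => /(_ erefl).
  by rewrite val_wordg // -sz' E size_rcons ltnn.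
have [n1|n2] := leqP (size (fg_word z')) 1.
  move: n1 endz; rewrite /ends_in; case E: (fg_word z') => [|l []] // _ /andP[/eqP l1 _].
  exists u, v, l.2; split=> //; rewrite zE -(wordgK z') E wordg1 letterE.
  by case: l l1 {E} => t [] /= ->.
have gz := subgroup_powers z'; have gb := subgroup_powers b2.
set AC := powers z' `|` powers b2.
have gAC := subgroup_gen AC.
have cAC : gen AC c2.
  rewrite -(ziK c2); apply: (hom_in (sub2M _ _) gAC) => -[]; last first.
    by rewrite sub2b; apply: sub_gen; right; apply: powers_id.
  rewrite sub2c zE; case: (gAC) => _ GM _.
  have bAC x : powers b2 x -> gen AC x by move=> bx; apply: sub_gen; right.
  by apply: (GM _ _ (GM _ _ _ _)); [apply: bAC|apply: sub_gen; left; apply: powers_id|apply: bAC].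
have [s [alt sF s1 cE]] := gen_alternating gz gb cAC.
have sE p : p \in s -> ends_in id p.1 p.2 /\ (p.1 -> (1 < size (fg_word p.2))%N).
  move=> ps; have := sF p ps; have := s1 p ps; case: p {ps} => [[] x] /= x1 Hx; last first.
    split=> //; apply: word_over_ends => //.
    suff : powers b2 `<=` [set x : F2 | word_over (T := bool) (pred1 false) x].
      by move=> /(_ _ Hx); apply: sub_all => l /=; case: (l.1).
    rewrite -gen1E -gen_word_over; apply: gen_sub; first exact: subgroup_gen.
    by move=> _ ->; apply: sub_gen; exists false.
  case: Hx x1 => k [] -> x1.
    have k0 : (0 < k)%N by case: k x1 => //; rewrite expg0.
    by have /andP[? ?] := ends_inX endz n2 k0.
  have k0 : (0 < k)%N by case: k x1 => //; rewrite expg0 invg1.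
  have /andP[? ?] := ends_inX endz n2 k0.
  by split=> [|_]; [apply: ends_inV|rewrite /= size_word_inv].
have := alternating_word alt (fun p ps => proj1 (sE p ps)); rewrite -cE.
case: s {alt sF s1 cE} sE => // -[e x] s /(_ _ (mem_head _ _)) /= [].
rewrite /ends_in; case: (fg_word x) => // l w /andP[/eqP le _] sz [lE].
move/(congr1 size); rewrite size_cat => /=; case: e le sz => [_ /(_ isT)|].
  by case: w.
by rewrite -lE.
Qed.

(** By transport along the automorphism that carries {b, c} to {x, y}, this is the case
    x = b settled by basis_fix_b. *)
Lemma nielsen_next x y z : nielsen x y -> basis2 x z -> nielsen x z.
Proof.
move=> N zB; have [psi K Ki] := nielsen_basis N.
have psiM : {morph psi : u v / u * v}.
  by move=> u v; apply: (can_inj K); rewrite sub2M !Ki.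
have psix : psi x = b2 by apply: (can_inj K); rewrite Ki sub2b.
have zB' : basis2 b2 (psi z).
  apply: (eq_bij (f := psi \o sub2 x z)); first by apply: bij_comp => //; exists (sub2 x y).
  by rewrite -psix; apply: sub2_comp.
have [u [v [e [bu bv zE]]]] := basis_fix_b zB'.
have -> : z = sub2 x y u * (sgg e y * sub2 x y v).
  by rewrite mulgA -[z]Ki zE !sub2M (hom_sgg (sub2M x y)) sub2c.
have xp w : powers b2 w -> powers x (sub2 x y w).
  by case=> k [] ->; rewrite ?(homV (sub2M x y)) (homX (sub2M x y)) sub2b; exists k; [left|right].
apply/nielsen_mulr/nielsen_mull; try exact: xp.
exact: (@nielsen_sgg false e).
Qed.

End Closure.

(** * Cancellation in products *)

Section Infixes.
Local Open Scope group_scope.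
Variable T : choiceType.
Implicit Types (l m a : T * bool) (s u v q p z W : seq (T * bool)).

Lemma creduced_inv s : creduced s -> creduced (word_inv s).
Proof.
case/andP=> rs; rewrite /creduced reduced_inv //=.
case: s rs => // l s _; rewrite /word_inv; case/lastP: s => [|s m].
  by move=> /= H; rewrite (inj_eq (@linv_inj T)).
rewrite last_rcons /= map_rcons rev_cons rev_rcons /= last_rcons.
by rewrite (inj_eq (@linv_inj T)) -neq_linv_sym.
Qed.

Lemma creduced_rot l q : creduced (l :: q) -> creduced (rcons q l).
Proof.
rewrite /creduced -cats1 => /andP[rq cq].
have rq' : reduced q by apply: path_sorted rq.
rewrite reduced_cat rq'; case: q rq cq rq' => [|m q] //= rq cq _.
rewrite -neq_linv_sym cq /= last_cat /= -neq_linv_sym.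
by case/andP: rq.
Qed.

(** If u conjugates one cyclically reduced word into another then u runs along the
    axis of the first: otherwise u^-1 q u would be reduced as written. *)
Lemma conj_prefix u q p : creduced q -> q <> [::] -> creduced p -> reduced u ->
    wordg q * wordg u = wordg u * wordg p ->
  exists k, prefix u (powerw k q) || prefix u (powerw k (word_inv q)).
Proof.
move: {2}(size u) (leqnn (size u)) => n.
elim: n u q p => [|n IHn] u q p; first by case: u => // *; exists 0%N.
case: u => [|l u]; first by move=> *; exists 0%N.
rewrite ltnS => un cq q0 cp rlu E.
have ru : reduced u by apply: path_sorted rlu.
have main q1 p1 : creduced (l :: q1) -> creduced p1 ->
    wordg (l :: q1) * wordg (l :: u) = wordg (l :: u) * wordg p1 ->
    exists k, prefix (l :: u) (powerw k (l :: q1)).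
  move=> cq1 cp1 E1.
  have E2 : wordg (rcons q1 l) * wordg u = wordg u * wordg p1.
    apply: (@mulgI _ (letter l)); rewrite mulgA -cats1 wordg_cat wordg1 mulgA.
    by rewrite -wordg_cons -mulgA -wordg_cons E1 wordg_cons mulgA.
  have q10 : rcons q1 l <> [::] by case: (q1).
  have [k /orP[pk|pk]] := IHn u _ p1 un (creduced_rot cq1) q10 cp1 ru E2.
    exists k.+1; have -> : powerw k.+1 (l :: q1) = l :: powerw k (rcons q1 l) ++ q1.
      elim: (k) => [|j IHj]; first by rewrite /powerw /= cats0.
      by rewrite powerwSr IHj powerwSr /= -cats1 -!catA.
    by rewrite /= eqxx; apply: prefix_catl.
  exists 1%N; rewrite /= eqxx /powerw /= cats0.
  case: u rlu pk {un ru E E1 E2} => [|m u]; first by rewrite !prefix0s.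
  rewrite {1}/reduced /=. move=> /andP[ml _].
  case: k => //= k; rewrite powerwS /word_inv map_rcons rev_rcons /= => /andP[/eqP mE _].
  by move: ml; rewrite /no_cancel mE eqxx.
have [[q' qE]|H1] := pselect (exists q', q = l :: q').
  rewrite qE in cq E *; have [k Hk] := main q' p cq cp E.
  by exists k; rewrite Hk.
have [[q' qE]|H2] := pselect (exists q', word_inv q = l :: q').
  have EV : wordg (word_inv q) * wordg (l :: u) = wordg (l :: u) * wordg (word_inv p).
    apply: (@mulgI _ (wordg q)); rewrite !wordgV mulVKg mulgA E.
    by rewrite -mulgA mulgV mulg1.
  have cqV := creduced_inv cq; rewrite qE in cqV EV *.
  have [k Hk] := main q' _ cqV (creduced_inv cp) EV.
  by exists k; rewrite Hk orbT.
exfalso.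
have /andP[rq _] := cq; have /andP[rp pend] := cp.
have rV : reduced (word_inv (l :: u)) by apply: reduced_inv.
have pE : p = word_inv (l :: u) ++ q ++ l :: u.
  rewrite -(val_wordg rp) -(@val_wordg _ (_ ++ _)).
    congr fg_word; rewrite !wordg_cat wordgV E mulKg; by [].
  have endV : exists m v, word_inv (l :: u) = m :: v /\ last m v = linv l.
    rewrite /word_inv /= rev_cons; case: (rev _) => [|m v].
      by exists (linv l), [::].
    by exists m, (rcons v (linv l)); rewrite last_rcons.
  have [m [v [vE lv]]] := endV; rewrite vE in rV *.
  rewrite reduced_cat rV reduced_cat rq rlu /=.
  have qend : exists a q', q = a :: q' by case: (q) q0 => // a q' _; exists a, q'.
  have [a [q' qE]] := qend; rewrite qE /= lv linvK.
  apply/andP; split; last by apply: contra_not_neq H1 => <-; exists q'.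
  apply: contra_not_neq H2 => lE; rewrite qE lE; case/lastP: (q') => [|q2 b].
    by exists [::]; rewrite /word_inv.
  by rewrite last_rcons /word_inv /= map_rcons rev_cons rev_rcons /=; exists (rcons (rev [seq linv i | i <- q2]) (linv a)).
move: pend; rewrite pE; have -> : l :: u = rcons (belast l u) (last l u) by rewrite -lastI.
rewrite {1}/word_inv map_rcons rev_rcons /= !last_cat last_rcons.
by rewrite linvK eqxx.
Qed.
End Infixes.

Section Products.
Local Open Scope group_scope.
Variable T : choiceType.
Implicit Types (l m a : T * bool) (s u v q p z W : seq (T * bool)).

Lemma word_mul_cat u v : reduced u -> reduced v ->
  exists i j, word_mul u v = take i u ++ drop j v.
Proof.
move=> ru rv; elim: u ru => [|l u IHu] rlu; first by exists 0%N, 0%N; rewrite drop0.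
have [i [j /= ->]] := IHu (path_sorted rlu).
case E: (take i u) => [|m w] /=.
  case D: (drop j v) => [|k d] /=; first by exists 1%N, (size v); rewrite /= take0 drop_size.
  case: ifP => _; last by exists 1%N, j; rewrite /= take0 D.
  by exists 0%N, j.+1; rewrite take0 -addn1 addnC -drop_drop D /= drop0.
exists i.+1, j; rewrite /= E.
case: u E rlu {IHu} => [|k u]; first by [].
by case: i => //= i [-> _] /andP[/negbTE ->].
Qed.

Lemma drop_infixes j (zs us : seq (seq (T * bool))) :
    all2 (fun z u => infix z u) zs us ->
  exists2 zs', flatten zs' = drop j (flatten zs) & all2 (fun z u => infix z u) zs' us.
Proof.
elim: zs us j => [|z zs IHzs] [|u us] j //=; first by exists [::].
case/andP=> zu /(IHzs _ (j - size z)%N)[zs' E H].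
exists (drop j z :: zs') => /=; last first.
  rewrite H andbT; apply: infix_trans zu; rewrite -{2}(cat_take_drop j z).
  exact: suffix_infix.
rewrite E drop_cat; case: ltnP => jz.
  by rewrite (_ : j - size z = 0)%N ?drop0 //; apply/eqP; rewrite subn_eq0 ltnW.
by rewrite drop_oversize.
Qed.

(** Cancellation only removes letters at the ends of the factors, so that what survives
    of each factor is one of its subwords. *)
Lemma prod_infixes (us : seq (seq (T * bool))) : all (@reduced T) us ->
  exists2 zs, fg_word (wordg (flatten us)) = flatten zs &
    all2 (fun z u => infix z u) zs us.
Proof.
elim: us => [|u us IHus] /=; first by exists [::] => //; rewrite wordg_nil.
case/andP=> ru /IHus[zs E H].
have [i [j mE]] := word_mul_cat ru (fg_wordP (wordg (flatten us))).
have [zs' E' H'] := drop_infixes j H.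
exists (take i u :: zs') => /=; last first.
  by rewrite H' andbT -{2}(cat_take_drop i u); apply: prefix_infix.
rewrite wordg_cat -[LHS]/(word_mul (fg_word (wordg u)) _) val_wordg // mE.
by rewrite E' E.
Qed.

(** The factors singled out by S are those of which at most L letters can survive. *)
Lemma size_infixes (S : pred (seq (T * bool))) L (zs us : seq (seq (T * bool))) :
    all2 (fun z u => infix z u) zs us ->
    (forall z u, z \in zs -> S u -> infix z u -> size z <= L)%N ->
  (size (flatten zs) <= sumn [seq if S u then minn L (size u) else size u | u <- us])%N.
Proof.
elim: zs us => [|z zs IHzs] [|u us] //= /andP[zu /IHzs IH] H.
rewrite size_cat; apply: leq_add.
  case: ifP => Su; last exact: size_infix.
  by rewrite leq_min size_infix // andbT; apply: (H z u); rewrite ?mem_head.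
by apply: IH => z' u' z'zs; apply: H; rewrite inE z'zs orbT.
Qed.

(** A subword one letter longer than the period is a rotation of W followed by its own
    first letter. *)
Lemma infix_powerw_rot W z (k : nat) : infix z (powerw k W) -> size z = (size W).+1 ->
  exists2 j, (j < size W)%N & z = drop j W ++ take j.+1 W.
Proof.
case/infixP=> s1 [s2 E] sz.
have {E} zE : z = take (size z) (drop (size s1) (powerw k W)).
  by rewrite E drop_size_cat // take_size_cat.
move: (size s1) zE => j; elim: k j => [|k IHk] j.
  by move=> zE; move: sz; rewrite zE.
rewrite powerwS drop_cat; case: ltnP => [jW|_]; last exact: IHk.
rewrite sz take_cat size_drop ifF; last by apply/negbTE; rewrite -leqNgt leq_subLR; lia.
have -> : ((size W).+1 - (size W - j) = j.+1)%N by lia.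
case: k {IHk} => [|k].
  move=> zE; move: sz; rewrite zE size_cat size_drop /= addn0; lia.
by rewrite powerwS takel_cat // => ->; exists j.
Qed.

End Products.

(** * Words of minimal length *)

Section Minimal.
Local Open Scope group_scope.
Implicit Types (x y g : F2) (sg : bool -> bool) (s v : seq bool) (t : bool).
Implicit Types (W z : seq (bool * bool)).

Lemma emb_fst sg s : map fst (emb sg s) = s.
Proof. by elim: s => //= a s ->. Qed.

(** Minimal length in the orbit under the automorphisms generated by Nielsen moves. *)
Definition minimal W := forall f : F2 -> F2, {morph f : x y / x * y} ->
  nielsen (f b2) (f c2) -> (size W <= size (fg_word (f (wordg W))))%N.

Definition sep t : rel bool := fun a b => ~~ ((a == t) && (b == t)).

Lemma sep_infix t s : ~~ infix [:: t; t] s -> sorted (sep t) s.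
Proof.
elim: s => // a s IHs; rewrite infix_consl negb_or => /andP[ps /IHs].
case: s ps {IHs} => // b s; rewrite !prefix_cons prefix0s andbT /= => ps ->.
by rewrite andbT /sep; apply: contra ps => /andP[/eqP -> /eqP ->]; rewrite eqxx.
Qed.

Definition dup t s := flatten [seq (if a == t then [:: ~~ t; t] else [:: a]) | a <- s].

(** Each t is preceded by the other letter, so that t can be exchanged for the pair
    (other letter, t); this shortens s by the number of its letters t. *)
Lemma undup t s : sorted (sep t) s -> (if s is a :: _ then a == ~~ t else true) ->
  exists2 s0, s = dup t s0 & size s = (size s0 + count_mem t s)%N.
Proof.
have nt : (~~ t == t) = false by case: (t).
move: {2}(size s) (leqnn (size s)) => n.
elim: n s => [|n IHn] [|a s] //; try by move=> *; exists [::].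
rewrite ltnS => sn; case: s sn => [|b s] sn ss /eqP aE; rewrite aE in ss *.
  by exists [:: ~~ t]; rewrite /dup /= nt.
have [bt|bt] := eqVneq b t; last first.
  have bE : b = ~~ t by case: (b) (t) bt => [] [].
  rewrite {b bt}bE in ss sn *.
  have [||s0 E sE] := IHn (~~ t :: s) sn => //.
    by move: ss => /= /andP[].
  exists (~~ t :: s0); last by move: sE => /= ->; rewrite nt /= addSn.
  by rewrite -[dup t _]/((if ~~ t == t then _ else _) ++ dup t s0) nt -E.
rewrite bt in ss sn *.
have [|||s0 E sE] := IHn s.
- by apply: leq_trans sn => /=.
- by move: ss => /= /andP[_]; apply: path_sorted.
- case: s {sn} ss => // d s; rewrite /= /sep eqxx /= => /and3P[_ dt _].
  by case: (d) (t) dt => [] [].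
exists (t :: s0); first by rewrite /dup /= eqxx /= -/(dup t s0) -E.
by rewrite /= nt eqxx sE /=; lia.
Qed.

(** If z were longer than a period of W then a rotation of W would be positive with t
    isolated even cyclically, every t being preceded by the other letter.  As W is not
    conjugate to a power of a letter, t does occur, and the transvection that sends the
    product of the other letter and t to t would shorten W. *)
Lemma minimal_isolated W z sg s t k m : minimal W ->
    (forall g l j, wordg W ^ g <> letter l ^+ j) ->
    isolated t s -> infix z (powerw k (emb sg s)) -> infix z (powerw m W) ->
  (size z <= size W)%N.
Proof.
move=> Wmin Wpow tis zs zW; rewrite leqNgt; apply/negP => zL.
pose z1 := take (size W).+1 z.
have sz1 : size z1 = (size W).+1 by rewrite size_takel.
have z1z : infix z1 z by rewrite -[X in infix _ X](cat_take_drop (size W).+1 z); apply: prefix_infix.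
have [j jW z1E] := infix_powerw_rot (infix_trans z1z zW) sz1.
have z1emb : exists2 v, z1 = emb sg v & ~~ infix [:: t; t] v.
  have pE : powerw k (emb sg s) = emb sg (flatten (nseq k s)).
    by elim: (k) => [|i IHi] //; rewrite powerwS IHi /emb /= map_cat.
  have := infix_trans z1z zs; rewrite pE => /infixP[u1 [u2 uE]].
  exists (map fst z1).
    have := congr1 (map fst) uE; rewrite emb_fst => fE.
    move: uE; rewrite fE /emb !map_cat => /eqP; rewrite !eqseq_cat ?size_map //.
    by case/and3P=> _ /eqP {1}<- _.
  apply: contra (tis k) => H; apply: infix_trans H _.
  by rewrite -(emb_fst sg (flatten _)) uE !map_cat; apply: infix_infix.
have [v1 v1E nv1] := z1emb.
set wj := nth (false, false) W j in z1E *.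
pose D := drop j.+1 W; pose E := take j W.
have WE : W = E ++ wj :: D by rewrite -drop_nth // cat_take_drop.
have {}z1E : z1 = (wj :: D ++ E) ++ [:: wj].
  by rewrite z1E (drop_nth (false, false)) // (take_nth (false, false)) // -cats1 catA.
have conjW : wordg W ^ wordg E = wordg (wj :: D ++ E).
  have -> : wordg W = wordg E * wordg (wj :: D) by rewrite -wordg_cat -WE.
  by rewrite /conjg -mulgA mulKg -wordg_cat.
pose va1 := map fst (wj :: D ++ E).
have rotE : wj :: D ++ E = emb sg va1.
  move: v1E; rewrite z1E; case/lastP: v1 {nv1} => [|v2 b].
    by move/(congr1 size); rewrite size_cat size_map /= addnC.
  rewrite /emb map_rcons cats1 => /rcons_inj[H _].
  by rewrite /va1 H -/(emb sg v2) emb_fst.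
have v1a : v1 = rcons va1 wj.1.
  have := congr1 (map fst) v1E; rewrite emb_fst => <-.
  by rewrite z1E map_cat cats1.
have ss := sep_infix nv1; rewrite v1a in ss.
have nt : (~~ t == t) = false by case: (t).
have hasn : ~~ t \in va1.
  apply/negPn/negP => H; have allt : all (pred1 t) (rcons va1 wj.1).
    have ta : all (pred1 t) va1.
      apply/allP => b bv; rewrite /=; apply: contraNT H => bt.
      by have -> : ~~ t = b by case: (t) (b) bt => [] [].
    by rewrite all_rcons ta andbT; move: ta => /= /andP[].
  move: ss allt; rewrite /va1 /=; case: (map fst (D ++ E)) => [|b w] /=;
    by rewrite /sep => /andP[+ _] /and3P[/eqP h1 /eqP h2 _]; rewrite ?h1 ?h2 eqxx.
have hast : t \in va1.
  apply/negPn/negP => H.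
  have va1E : va1 = nseq (size va1) (~~ t).
    apply/all_pred1P/allP => b bv; rewrite /=; apply: contraNT H => bt.
    by have -> : t = b by case: (t) (b) bt => [] [].
  apply: (Wpow (wordg E) (~~ t, sg (~~ t)) (size va1)).
  rewrite conjW rotE va1E /emb map_nseq size_nseq.
  by elim: (size va1) => [|i IHi]; rewrite ?wordg_nil // wordg_cons IHi expgS.
case/splitPr: {1}va1 / hasn (erefl va1) => va vb /esym vaE.
pose v' := (~~ t :: vb) ++ va.
have sv' : sorted (sep t) v'.
  move: ss; rewrite vaE rcons_cat rcons_cons.
  have : wj.1 = head t va1 by [].
  rewrite vaE /v'; case: (va) => [|a va'] /=.
    by move=> _; rewrite cats0 rcons_path => /andP[].
  move=> ->; rewrite cat_path /= rcons_path cat_path /=.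
  by case/and3P=> -> _ /andP[-> ->].
have [|s0 s0E s0s] := undup sv'; first exact: eqxx.
have sizeW : size v' = size W.
  have := congr1 size rotE; rewrite size_map vaE /v' WE /= !size_cat /=; lia.
have count0 : (0 < count_mem t v')%N.
  by rewrite -has_count has_pred1 /v' mem_cat orbC -mem_cat -vaE.
(* The transvection multiplies t on the left by the inverse of the other letter. *)
pose o := (~~ t, sg (~~ t)); pose lt := (t, sg t).
pose ft := sgg (sg t) ((letter o)^-1 * letter lt).
pose f0 : F2 -> F2 := fg_lift (fun a : bool => if a == t then ft else fg_gen a).
have f0M : {morph f0 : x y / x * y} by apply: fg_liftM.
have f0o : f0 (letter o) = letter o.
  by rewrite letterE /=; case: (sg _); rewrite ?(homV f0M) [f0 _]fg_lift_gen nt.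
have f0t : f0 (letter lt) = (letter o)^-1 * letter lt.
  rewrite [in LHS]letterE /=; case E1 : (sg t);
    by rewrite ?(homV f0M) [f0 _]fg_lift_gen eqxx /ft E1 /sgg ?invgK.
have f0v r : f0 (posg sg (dup t r)) = posg sg r.
  elim: r => [|a r IHr]; first by rewrite /posg /= wordg_nil (hom1 f0M).
  rewrite -[dup t _]/((if a == t then [:: ~~ t; t] else [:: a]) ++ dup t r).
  rewrite posg_cat f0M IHr -[a :: r]/([:: a] ++ r) posg_cat; congr (_ * _).
  case: eqVneq => [->|at_]; rewrite /posg /emb /= ?wordg_cons ?wordg_nil ?mulg1.
    by rewrite f0M f0o f0t mulVKg.
  have -> : a = ~~ t by case: (a) (t) at_ => [] [].
  exact: f0o.
have Nf0 : nielsen (f0 b2) (f0 c2).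
  have N0 : nielsen (fg_gen (~~ t)) (fg_gen t).
    by case: (t); [|apply: Nielsen_swap]; exact: Nielsen_std.
  have Nt : nielsen (fg_gen (~~ t)) ft.
    apply: (@nielsen_sgg false); apply: nielsen_mulr.
      by rewrite [letter o]letterE /=; case: (sg _); apply: powersV; [apply: powersV|]; apply: powers_id.
    have -> : letter lt = sgg (sg t) (fg_gen t) by rewrite letterE.
    exact: (@nielsen_sgg false).
  have f0g a : f0 (fg_gen a) = if a == t then ft else fg_gen a by apply: fg_lift_gen.
  rewrite /b2 /c2 !f0g; case: (t) Nt => //= Nt; exact: Nielsen_swap.
pose h := wordg E * posg sg va.
have fW : f0 (wordg W ^ h) = posg sg s0.
  rewrite /h conjgM conjW rotE -(f0v s0) -s0E vaE -/(posg _ _) !posg_cat.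
  by rewrite /conjg -mulgA mulKg.
have : (size W <= size (fg_word (f0 (wordg W ^ h)%g)))%N.
  apply: (Wmin (fun x => f0 (x ^ h))) => [x y|]; first by rewrite conjMg f0M.
  by rewrite /= !(homJ f0M); apply: Nielsen_conj.
rewrite fW => szW; have := leq_trans szW (size_wordg _).
by rewrite size_map -sizeW s0s -{2}[size s0]addn0 leq_add2l leqNgt count0.
Qed.

End Minimal.

(** * Paths of bases of the free group of rank two *)

Section Distance.
Local Open Scope group_scope.
Implicit Types (x y g : F2) (sg : bool -> bool) (s : seq bool) (t : bool).
Implicit Types (W z q : seq (bool * bool)).

Definition root_free (w : F2) := forall (p q : F2) (k : nat), basis2 p q -> w <> p ^+ k.

(** What is used of the members of a good pair: signs of letters are prescribed and one
    letter is isolated, up to inversion. *)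
Definition simple_word q := exists sg s t (e : bool),
  [/\ s <> [::], isolated t s & q = if e then word_inv (emb sg s) else emb sg s].

Lemma simple_creduced q : simple_word q -> creduced q /\ q <> [::].
Proof.
case=> sg [s [t [e [s0 _ ->]]]]; case: e; split; try exact: creduced_emb.
- exact/creduced_inv/creduced_emb.
- by move/(congr1 size); rewrite size_word_inv size_map; case: (s) s0.
- by case: (s) s0.
Qed.

Lemma pos_pair_neq0 l : (pos_pair l).1 <> [::] /\ (pos_pair l).2 <> [::].
Proof. by elim: l => [|[] l [H1 H2]] //=; split=> //; case: (_.1) H1. Qed.

Lemma good_simple x y : good x y -> exists g p q,
  [/\ simple_word p, simple_word q, x = wordg p ^ g & y = wordg q ^ g].
Proof.
case=> l [sg [e [d [g [-> ->]]]]].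
have [n1 n2] := pos_pair_neq0 l; have [[t1 I1] [t2 I2]] := pos_pair_isolated l.
exists g, (if e then word_inv (emb sg (pos_pair l).1) else emb sg (pos_pair l).1).
exists (if d then word_inv (emb sg (pos_pair l).2) else emb sg (pos_pair l).2).
split; [by exists sg, (pos_pair l).1, t1, e|by exists sg, (pos_pair l).2, t2, d| |];
  by case: ifP; rewrite ?wordgV.
Qed.

(** The words that run along the axis of q, in either direction. *)
Definition along q z := exists k, prefix z (powerw k q) || prefix z (powerw k (word_inv q)).

Lemma infix_word_inv (T : choiceType) (u v : seq (T * bool)) :
  infix u v -> infix (word_inv u) (word_inv v).
Proof.
case/infixP=> a [b ->]; rewrite !word_inv_cat -catA; exact: infix_infix.
Qed.

Lemma minimal_along W q u z m : minimal W ->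
    (forall g l j, wordg W ^ g <> letter l ^+ j) ->
    simple_word q -> along q u -> infix z u -> infix z (powerw m W) ->
  (size z <= size W)%N.
Proof.
move=> Wmin Wpow [sg [s [t [e [s0 tis qE]]]]] [k Hk] zu zW.
have: infix z (powerw k (emb sg s)) \/ infix z (powerw k (word_inv (emb sg s))).
  by move: Hk => /orP[] /prefixW /(infix_trans zu); rewrite qE; case: e {qE};
    rewrite ?word_invK => H; first [by left | by right].
case=> [zs|/infix_word_inv]; first exact: minimal_isolated zs zW.
rewrite word_inv_powerw word_invK => zs.
have := infix_word_inv zW; rewrite word_inv_powerw => zW'.
rewrite -(size_word_inv W) -(size_word_inv z).
apply: minimal_isolated tis zs zW'.
  move=> f fM Nf; rewrite size_word_inv wordgV (homV fM) /= size_word_inv.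
  exact: Wmin.
move=> g l j; rewrite wordgV conjVg => E; apply: (Wpow g (linv l) j).
by rewrite letterV expVgn -E invgK.
Qed.

Lemma minimal_exists (w : F2) : exists x y, nielsen x y /\ minimal (fg_word (sub2 x y w)).
Proof.
pose S n := exists x y, nielsen x y /\ size (fg_word (sub2 x y w)) = n.
have exS : exists n, `[< S n >].
  exists (size (fg_word (sub2 b2 c2 w))); apply/asboolP; exists b2, c2; split=> //.
  exact: Nielsen_std.
case: (ex_minnP exS) => n /asboolP[x [y [N sE]]] nmin.
exists x, y; split=> // f fM Nf; rewrite wordgK sE; apply: nmin; apply/asboolP.
exists (f x), (f y); split; first exact: nielsen_hom.
by rewrite -(sub2_comp _ _ fM).
Qed.

(** Otherwise a conjugate of W would be shorter. *)
Lemma minimal_creduced W : reduced W -> minimal W -> creduced W.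
Proof.
move=> rW Wmin; have [W1|W1] := pselect (wordg W = 1).
  by rewrite -(val_wordg rW) W1.
have [t [C [_ cC E _]]] := cyclic_core W1.
have fM : {morph (fun x => x ^ wordg t) : x y / x * y} by move=> x y; apply: conjMg.
have := Wmin _ fM (Nielsen_conj _ Nielsen_std).
have -> : wordg W ^ wordg t = wordg C.
  by rewrite -(wordgK (wordg W)) E !wordg_cat wordgV /conjg -!mulgA mulVg mulg1 mulKg.
rewrite -{1}(val_wordg rW) E => H; have {}H := leq_trans H (size_wordg C).
move: H; rewrite !size_cat size_word_inv => H.
have {}H : (size t + (size C + size t) <= size C)%N by exact: H.
have t0 : t = [::] by apply/size0nil; lia.
by rewrite -(val_wordg rW) E t0 /word_inv /= cats0.
Qed.

Lemma letter_basis (l : bool * bool) : exists y, basis2 (letter l) y.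
Proof.
have N t : nielsen (fg_gen t) (fg_gen (~~ t)).
  by case: t; [apply: Nielsen_swap|]; exact: Nielsen_std.
exists (fg_gen (~~ l.1)); apply: nielsen_basis; rewrite letterE.
by case: ifP => _; [apply: Nielsen_inv|]; apply: N.
Qed.

(** After an automorphism th that makes the word W of w minimal, the i-th pair of the path
    is conjugate by some h_i to a pair of simple words.  Both h_i and h_(i+1) carry the
    element x_(i+1) to a cyclically reduced word, so u_i = h_i h_(i+1)^-1 runs along the
    axis of a simple word; the last factor closes up the path by means of W^N.  The
    product of the u_i is conjugate to W^N, so W^(NK), which is reduced, is made of
    subwords of h_0^-1, of K copies of u_0, ..., u_(n-1), and of h_0.  At most |W| letters
    of each u_i survive, whence N K |W| <= K n |W| + 2 |h_0|, and N <= n once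
    K > 2 |h_0|. *)
Lemma F2_distance_pos (w : F2) (N n : nat) (x : nat -> F2) (e : bool) : root_free w ->
    x 0%N = b2 -> (forall i, (i < n)%N -> basis2 (x i) (x i.+1)) -> (0 < n)%N ->
    x n = sgg e b2 ^ (w ^- N) ->
  (N <= n)%N.
Proof.
move=> wroot x0 xB n0 xn.
have xN i : (i < n)%N -> nielsen (x i) (x i.+1).
  elim: i => [|i IHi] lin.
    by rewrite x0; apply: (nielsen_next Nielsen_std); rewrite -x0; apply: xB.
  apply: (@nielsen_next _ (x i)); last exact: xB.
  by apply/Nielsen_swap/IHi/ltnW.
have [p0 [q0 [Npq Wmin]]] := minimal_exists w.
set th := sub2 p0 q0 in Wmin; have thM : {morph th : u v / u * v} by apply: sub2M.
set W := fg_word (th w) in Wmin; have WE : wordg W = th w by apply: wordgK.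
have rW : reduced W by apply: fg_wordP.
have [thi thK thiK] : bijective th := nielsen_basis Npq.
have thiM : {morph thi : u v / u * v}.
  by move=> u v; apply: (can_inj thK); rewrite thM !thiK.
have Wpow g l j : wordg W ^ g <> letter l ^+ j.
  have [y yB] := letter_basis l.
  move=> H; apply: (wroot (thi (letter l) ^ (thi g)^-1) (thi y ^ (thi g)^-1) j).
    apply: (eq_bij (f := (fun u => u ^ (thi g)^-1) \o (thi \o sub2 (letter l) y))).
      apply: bij_comp; last by apply: bij_comp => //; exists th.
      by exists (fun u => u ^ thi g) => u; [apply: conjgKV|apply: conjgK].
    move=> u; have /= -> := sub2_comp (letter l) y thiM u.
    by apply: (sub2_comp (f := fun u => u ^ (thi g)^-1)) => a b; apply: conjMg.
  apply: (can_inj thK); rewrite -WE -conjXg -[LHS](conjgK g) H -(homX thiM).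
  by rewrite (homJ thM) (homV thM) !thiK.
have cW := minimal_creduced rW Wmin.
have W0 : (0 < size W)%N.
  case E : W => //; exfalso; apply: (Wpow 1 (true, false) 0%N).
  by rewrite E wordg_nil conjg1.
have yG i : (i < n)%N -> exists g p q,
    [/\ simple_word p, simple_word q, th (x i) = wordg p ^ g & th (x i.+1) = wordg q ^ g].
  move=> lin; apply/good_simple/good_nielsen/nielsen_hom => //.
    by rewrite /th sub2b sub2c.
  exact: xN.
have /choice[G GP] : forall i, exists gpq : F2 * (seq (bool * bool) * seq (bool * bool)),
    (i < n)%N -> [/\ simple_word gpq.2.1, simple_word gpq.2.2,
      th (x i) = wordg gpq.2.1 ^ gpq.1 & th (x i.+1) = wordg gpq.2.2 ^ gpq.1].
  move=> i; have [lin|] := boolP (i < n)%N; last by exists (1, ([::], [::])).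
  by have [g [p [q H]]] := yG i lin; exists (g, (p, q)).
pose h i := (G i).1.
(* The last factor returns from h (n - 1) to h 0 through W^N. *)
pose u i := if (i.+1 < n)%N then h i * (h i.+1)^-1 else h i * wordg W ^+ N * (h 0%N)^-1.
have uA i : (i < n)%N -> along (G i).2.2 (fg_word (u i)).
  move=> lin; have [_ sq _ xE] := GP i lin.
  have [cq q_0] := simple_creduced sq.
  suff [p cp E] : exists2 p, creduced p & wordg (G i).2.2 * u i = u i * wordg p.
    by apply: (conj_prefix cq q_0 cp (fg_wordP _)); rewrite wordgK.
  rewrite /u; case: ifP => lin'.
    have [sp _ xE' _] := GP _ lin'; have [cp _] := simple_creduced sp.
    exists (G i.+1).2.1 => //; move: xE; rewrite xE' -/(h i) -/(h i.+1).
    move=> /esym/(canRL (conjgK _)) ->; rewrite -conjgM /conjg !invgM !invgK.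
    by rewrite !mulgA mulgVK mulgK.
  have iE : i.+1 = n by apply/eqP; rewrite eqn_leq lin leqNgt lin'.
  have [sp _ x0E _] := GP _ n0; have [cp _] := simple_creduced sp.
  exists (if e then word_inv (G 0%N).2.1 else (G 0%N).2.1); first by case: (e) => //; apply: creduced_inv.
  have -> : wordg (if e then word_inv (G 0%N).2.1 else (G 0%N).2.1) = sgg e (wordg (G 0%N).2.1).
    by case: (e); rewrite ?wordgV.
  move: xE; rewrite iE xn -x0 (homJ thM) (homV thM) (homX thM) -WE (hom_sgg thM) x0E sggJ.
  rewrite -/(h i) -/(h 0%N) -conjgM => /esym/(canRL (conjgK _)) ->.
  rewrite -conjgM /conjg !invgM !invgK.
  by rewrite !mulgA !mulgVK mulgK.
pose us := [seq fg_word (u i) | i <- iota 0 n].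
have usE : wordg (flatten us) = h 0%N * wordg W ^+ N * (h 0%N)^-1.
  have H j i : (i + j.+1 = n)%N -> wordg (flatten [seq fg_word (u k) | k <- iota i j.+1])
     = h i * wordg W ^+ N * (h 0%N)^-1.
    elim: j i => [|j IHj] i ijn; rewrite [flatten _]/= wordg_cat wordgK.
      by rewrite wordg_nil mulg1 /u ifF //; apply/negbTE; rewrite -leqNgt; lia.
    rewrite -/(flatten [seq fg_word (u k) | k <- iota i.+1 j.+1]) IHj; last by lia.
    by rewrite /u ifT; [rewrite !mulgA mulgVK|lia].
  by have := H n.-1 0%N; rewrite add0n prednK // => /(_ erefl).
have [K KE] : exists K, K = (2 * size (fg_word (h 0%N))).+1 by exists (2 * size (fg_word (h 0%N))).+1.
pose us' := fg_word (h 0%N)^-1 :: flatten (nseq K us) ++ [:: fg_word (h 0%N)].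
have us'E : fg_word (wordg (flatten us')) = powerw (N * K) W.
  rewrite -[RHS]val_wordg ?reduced_powerw //; congr fg_word.
  rewrite [flatten us']/= flatten_cat [flatten [:: _]]/= cats0 !wordg_cat !wordgK wordg_powerw.
  have -> : wordg (flatten (flatten (nseq K us))) = wordg (flatten us) ^+ K.
    elim: (K) => [|j IHj]; first by rewrite wordg_nil.
    by rewrite /= flatten_cat wordg_cat IHj expgS.
  have -> : wordg (flatten us) = (wordg W ^+ N) ^ (h 0%N)^-1.
    by rewrite usE /conjg invgK mulgA.
  by rewrite -conjXg -expgnA /conjg invgK !mulgA wordgV wordgK mulVg mul1g mulgVK.
have us'r : all (@reduced bool) us'.
  have usr : all (@reduced bool) us by apply/allP => _ /mapP[i _ ->]; apply: fg_wordP.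
  rewrite /= reduced_inv ?fg_wordP //= all_cat /= fg_wordP andbT.
  by elim: (K) => //= j IHj; rewrite all_cat usr.
have [zs zsE zu] := prod_infixes us'r.
pose S := fun z => `[< exists2 q, simple_word q & along q z >].
have szle : forall z v, z \in zs -> S v -> infix z v -> (size z <= size W)%N.
  move=> z v zzs /asboolP[q sq qv] zv; apply: (minimal_along (m := (N * K)%N) Wmin Wpow sq qv zv).
  rewrite -us'E zsE; case/splitPr: zzs => z1 z2.
  by rewrite flatten_cat /=; apply: infix_infix.
have := size_infixes zu szle; rewrite -zsE us'E size_powerw.
set bnd := fun v => if S v then _ else _.
have mid : (sumn [seq bnd v | v <- flatten (nseq K us)] <= K * (n * size W))%N.
  have one : (sumn [seq bnd v | v <- us] <= n * size W)%N.
    have Su i : (i < n)%N -> S (fg_word (u i)).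
      move=> lin; apply/asboolP; exists (G i).2.2; last exact: uA.
      by case: (GP i lin).
    rewrite -[n in X in (_ <= X)%N](size_iota 0 n) /us.
    have : all (fun i => i < n)%N (iota 0 n) by apply/allP => i; rewrite mem_iota.
    elim: (iota 0 n) => //= i r IHr /andP[lin /IHr]; rewrite mulSn; apply: leq_add.
    by rewrite /bnd Su // geq_minl.
  elim: (K) => //= j IHj; rewrite map_cat sumn_cat mulSn; exact: leq_add.
have bnds v : (bnd v <= size v)%N by rewrite /bnd; case: ifP => // _; apply: geq_minr.
have ends := leq_add (bnds (fg_word (h 0%N)^-1)) (bnds (fg_word (h 0%N))).
rewrite /us' /= map_cat sumn_cat /= addn0 => tot.
rewrite /= size_word_inv in ends.
rewrite leqNgt; apply/negP => nN.
have arith (r a m b k nk j : nat) : (r <= a + (m + b) -> m <= nk -> a + b <= j + j ->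
    nk + k <= r -> (2 * j).+1 <= k -> False)%N by lia.
apply: (arith _ _ _ _ (K * size W)%N _ _ tot mid ends); last by rewrite -KE leq_pmulr.
by rewrite mulnCA -mulSnr mulnA leq_mul2r leq_mul2r nN !orbT.
Qed.

Lemma F2_distance (w : F2) (N n : nat) (x : nat -> F2) (e : bool) : root_free w ->
    x 0%N = b2 -> (forall i, (i < n)%N -> basis2 (x i) (x i.+1)) ->
    x n = sgg e b2 ^ (w ^- N) ->
  (N <= n)%N.
Proof.
move=> wroot x0 xB xn; have [n0|] := posnP n; last first.
  by move=> n0; exact: (F2_distance_pos wroot x0 xB n0 xn).
(* If w^N fixes b up to inversion then w^(4N) fixes b, and the path b, c, b of length two
   gives 4N <= 2. *)
rewrite n0 x0 in xn *.
have H : sgg e b2 = b2 ^ (w ^- N) by rewrite {1}xn sggJ sggK.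
have wD k : w ^- (k + k) = w ^- k * w ^- k by rewrite expgnDr invgM.
have H2 : b2 = b2 ^ (w ^- (N + N)) by rewrite wD conjgM -H.
have H4 : b2 = b2 ^ (w ^- (N + N + (N + N))) by rewrite wD conjgM -!H2.
suff : (N + N + (N + N) <= 2)%N by case: (N) => // k; rewrite !addnS !addSn.
pose x' i := if i == 1%N then c2 else b2.
have B i : (i < 2)%N -> basis2 (x' i) (x' i.+1).
  by case: i => [|[|i]] //= _; apply: nielsen_basis; [|apply: Nielsen_swap];
     exact: Nielsen_std.
exact: (@F2_distance_pos w _ 2 x' false wroot erefl B).
Qed.

End Distance.

(** * Residual finiteness *)

Section Syllables.
Local Open Scope group_scope.
Variable T : choiceType.

(** Equal neighbouring letters are collected; a reduced word has no neighbouring inverse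
    letters, so the generators of successive syllables differ. *)
Lemma syllables (w : seq (T * bool)) : reduced w ->
  exists s : seq ((T * bool) * nat),
    [/\ wordg w = \prod_(p <- s) letter p.1 ^+ p.2,
        sorted (fun p q : (T * bool) * nat => p.1.1 != q.1.1) s,
        forall p, p \in s -> (0 < p.2 <= size w)%N
      & if w is l :: _ then exists n s', s = (l, n) :: s' else s = [::]].
Proof.
elim: w => [|l w IHw] rw.
  by exists [::]; split=> //; rewrite wordg_nil big_nil.
have [s [sE ss sb hs]] := IHw (path_sorted rw).
have sb' p : p \in s -> (0 < p.2 <= (size w).+1)%N.
  by move=> /sb /andP[-> H]; apply: leqW.
case: w rw IHw sE sb sb' hs => [|m w] rw _ sE sb sb' hs.
  exists [:: (l, 1%N)]; split=> //; last by exists 1%N, [::].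
    by rewrite big_seq1 wordg1.
  by move=> p; rewrite inE => /eqP ->.
have [n [s' s'E]] := hs; rewrite s'E in sE ss sb sb' *.
have [lm|lm] := eqVneq l.1 m.1.
  have mE : m = l.
    case/andP: rw => + _; rewrite /no_cancel /linv; case: (l) (m) lm => t b [t' b'] /= <-.
    by rewrite xpair_eqE eqxx /=; case: b b' => [] [].
  exists ((l, n.+1) :: s'); split.
  - by rewrite wordg_cons sE !big_cons mE /= expgS mulgA.
  - by move: ss; rewrite mE; case: (s').
  - move=> p; rewrite inE => /orP[/eqP ->|ps] /=; last by apply: sb'; rewrite inE ps orbT.
    by have := sb (m, n); rewrite mem_head => /(_ isT) /= /andP[_]; rewrite ltnS.
  - by exists n.+1, s'.
exists ((l, 1%N) :: (m, n) :: s'); split.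
- by rewrite wordg_cons sE [RHS]big_cons.
- by rewrite /= lm; exact: ss.
- by move=> p; rewrite inE => /orP[/eqP -> //|ps]; apply: sb'.
- by exists 1%N, ((m, n) :: s').
Qed.

End Syllables.

Section Unitriangular.
Local Open Scope ring_scope.
Variables (F : fieldType) (n : nat).
Implicit Types (M N : 'M[F]_n.+1).

(** Matrices that vanish below the k-th superdiagonal. *)
Definition upper k M := [forall i : 'I_n.+1, [forall j : 'I_n.+1, (j < i + k)%N ==> (M i j == 0)]].

Lemma upperP k M : reflect (forall i j : 'I_n.+1, (j < i + k)%N -> M i j = 0) (upper k M).
Proof.
apply: (iffP forallP) => [H i j ij|H i].
  by have /forallP/(_ j)/implyP/(_ ij)/eqP := H i.
by apply/forallP => j; apply/implyP => ij; rewrite H.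
Qed.

Lemma upperM k l M N : upper k M -> upper l N -> upper (k + l) (M * N).
Proof.
move=> /upperP HM /upperP HN; apply/upperP => i j ij; rewrite mxE big1 // => m _.
have [mi|im] := ltnP m (i + k); first by rewrite HM ?mul0r.
by rewrite HN ?mulr0 //; lia.
Qed.

Lemma upperD k M N : upper k M -> upper k N -> upper k (M + N).
Proof.
by move=> /upperP HM /upperP HN; apply/upperP => i j ij; rewrite mxE HM ?HN ?addr0.
Qed.

Lemma upperW k l M : (l <= k)%N -> upper k M -> upper l M.
Proof. by move=> lk /upperP HM; apply/upperP => i j ij; apply: HM; lia. Qed.

Lemma upperX k M : upper 1 M -> upper k (M ^+ k).
Proof.
move=> HM; elim: k => [|k IHk].
  by apply/upperP => i j; rewrite addn0 expr0 mxE => ij; rewrite eq_sym -val_eqE /= ltn_eqF.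
by rewrite exprS -add1n; apply: upperM.
Qed.

Lemma upper_eq0 M : upper n.+1 M -> M = 0.
Proof.
move=> /upperP HM; apply/matrixP => i j; rewrite mxE HM //.
by rewrite (leq_trans (ltn_ord j)) // leq_addl.
Qed.

End Unitriangular.

Section UnitriangularGroup.
Local Open Scope ring_scope.
Variables (p n : nat).
Hypothesis p_pr : prime p.
Local Notation gT := {unit 'M['F_p]_n.+1}.

Definition unitri : {set gT} := [set u : gT | upper 1 (val u - 1)].

Lemma unitri_group_set : group_set unitri.
Proof.
apply/group_setP; split; first by rewrite inE FinRing.val_unit1 subrr; apply/upperP => i j _; rewrite mxE.
move=> u v; rewrite !inE FinRing.val_unitM => Hu Hv.
have -> : val u * val v - 1 = (val u - 1) + (val v - 1) + (val u - 1) * (val v - 1).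
  by rewrite [RHS]addrC addrA mulrBr mulr1 subrK mulrBl mul1r addrA subrK.
apply: upperD; first exact: upperD.
by apply: (@upperW _ _ 2) => //; apply: (@upperM _ _ 1 1).
Qed.

Canonical unitri_group := Group unitri_group_set.

(** The Frobenius map gives u^(p^k) - 1 = (u - 1)^(p^k), which vanishes for large k. *)
Lemma unitri_pgroup : (p.-group unitri)%g.
Proof.
have pM : p \in [pchar 'M['F_p]_n.+1] by rewrite pchar_lalg pchar_Fp.
rewrite -pnat_exponent; apply: (@pnat_dvd _ (p ^ n.+1)%N); last by rewrite pnatX pnat_id.
apply/exponentP => u; rewrite inE => Hu; apply: val_inj.
rewrite FinRing.val_unitX FinRing.val_unit1.
have -> : val u = 1 + (val u - 1) by rewrite addrC subrK.
have E k : (1 + (val u - 1)) ^+ (p ^ k) = 1 + (val u - 1) ^+ (p ^ k).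
  elim: k => [|k IHk]; first by rewrite !expr1.
  rewrite expnSr exprM IHk exprM.
  have := pFrobenius_autD_comm pM (commr_sym (commr1 ((val u - 1) ^+ (p ^ k)))).
  by rewrite !pFrobenius_autE expr1n.
rewrite E; have -> : (val u - 1) ^+ (p ^ n.+1) = 0.
  by apply/upper_eq0/(upperW _ (upperX _ Hu)); rewrite ltnW // ltn_expl // prime_gt1.
exact: addr0.
Qed.

End UnitriangularGroup.

Section Residual.
Local Open Scope ring_scope.
Variable T : choiceType.

(** Magnus: for a reduced product t_1^e_1 ... t_k^e_k with t_i <> t_(i+1), send t to
    1 + N_t, where N_t has the entry 1 at (i, i + 1) whenever t = t_i.  As N_t
    squares to zero, the corner entry of the image is e_1 ... e_k up to sign; it is
    nonzero modulo a prime p larger than the length of the word. *)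
Lemma residually_p (y : freeGroup T) : y <> 1%g ->
  exists (p : nat) (gT : finGroupType) (U : {group gT}) (psi : freeGroup T -> gT),
  [/\ prime p, (p.-group U)%g, {morph psi : x y / (x * y)%g},
      forall x, psi x \in U & psi y <> 1%g].
Proof.
move=> y1; have [s [sE ss sb hs]] := syllables (fg_wordP y).
have s0 : s <> [::] by move=> s0; apply: y1; rewrite -(wordgK y) sE s0 big_nil.
have [d0 d0s] : exists d0, d0 \in s by case: (s) s0 => // a r _; exists a; apply: mem_head.
pose w := size (fg_word y); have [p wp p_pr] := prime_above w.
pose k := size s; pose tt i := (nth d0 s i).1.1.
have k0 : (0 < k)%N by rewrite /k; case: (s) s0.
pose N t : 'M['F_p]_k.+1 := \matrix_(i, j) ((j == i.+1 :> nat) && (tt i == t))%:R.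
have upN t : upper 1 (N t).
  by apply/upperP => i j ij; rewrite mxE; case: eqP => //= ji; rewrite ji addn1 ltnn in ij.
have NN t : N t * N t = 0.
  apply/matrixP => i j; rewrite !mxE big1 // => m _; rewrite !mxE.
  case: andP => [[/eqP mi /eqP it]|_]; last by rewrite mul0r.
  case: andP => [[/eqP jm /eqP mt]|_]; last by rewrite mulr0.
  have mk : (i.+1 < k)%N by rewrite -ltnS -mi -jm.
  by have /(_ i mk) := sortedP d0 ss; rewrite -/(tt i) -/(tt i.+1) -mi it mt eqxx.
have NV t : (1 + N t) * (1 - N t) = 1.
  by rewrite mulrBr mulr1 mulrDl mul1r NN addr0 addrK.
have Nu t : 1 + N t \is a GRing.unit.
  apply/unitrP; exists (1 - N t); split=> //.
  by rewrite mulrDr mulr1 mulrBl mul1r NN subr0 subrK.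
pose g t : {unit 'M['F_p]_k.+1} := Sub (1 + N t) (Nu t).
pose psi := fg_lift g; have psiM : {morph psi : x y / (x * y)%g} by apply: fg_liftM.
pose sgn (l : T * bool) : 'F_p := if l.2 then -1 else 1.
have psil l m : val (psi (letter l ^+ m)%g) = 1 + (sgn l *+ m) *: N l.1.
  elim: m => [|m IHm]; first by rewrite expg0 (hom1 psiM) mulr0n scale0r addr0.
  rewrite expgSr psiM FinRing.val_unitM IHm.
  have -> : val (psi (letter l)) = 1 + sgn l *: N l.1.
    rewrite /psi fg_lift_letter /sgn; case: l.2; last by rewrite scale1r.
    rewrite FinRing.val_unitV scaleN1r /=; apply: (mulrI (Nu l.1)).
    by rewrite mulrV // NV.
  rewrite mulrDr mulr1 mulrDl mul1r -scalerAl -scalerAr NN !scaler0 addr0.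
  by rewrite mulrSr scalerDl addrA.
exists p, {unit 'M['F_p]_k.+1}, (unitri_group p k), psi; split=> //.
- exact: unitri_pgroup.
- move=> x; rewrite /psi /fg_lift; apply: group_prod => l _.
  have gU t : g t \in unitri_group p k by rewrite inE /= addrC addKr.
  by case: ifP => _; rewrite ?groupV.
rewrite -(wordgK y) sE (hom_prod psiM).
pose P j := val (\prod_(q <- take j s) psi (letter q.1 ^+ q.2))%g.
suff H j : (j <= k)%N -> (forall l : 'I_k.+1, (j < l)%N -> P j 0 l = 0) /\
    P j 0 (inord j) != 0.
  have [_] := H k (leqnn k); rewrite /P take_size => + E; rewrite E FinRing.val_unit1.
  by rewrite mxE -[0 == inord k]val_eqE /= inordK // ltn_eqF ?eqxx.
elim: j => [|j IHj] jk.
  rewrite /P take0 big_nil FinRing.val_unit1; split=> [l l0|].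
    by rewrite mxE -[0 == l]val_eqE /= ltn_eqF.
  by rewrite mxE -[0 == inord 0]val_eqE /= inordK // eqxx oner_neq0.
have [P0 Pj] := IHj (ltnW jk).
pose l0 := (nth d0 s j).1; pose c := sgn l0 *+ (nth d0 s j).2.
have c0 : c != 0.
  have /sb/andP[n0 nw] : nth d0 s j \in s by apply: mem_nth.
  have : (nth d0 s j).2%:R != 0 :> 'F_p.
    rewrite -(dvdn_pcharf (pchar_Fp p_pr)) gtnNdvd //; exact: leq_ltn_trans nw wp.
  by rewrite /c /sgn; case: ifP => _; rewrite ?mulNrn ?oppr_eq0.
have PS l : P j.+1 0 l = P j 0 l + c * \sum_m P j 0 m * N l0.1 m l.
  rewrite /P (take_nth d0) // big_rcons FinRing.val_unitM psil mulrDr mulr1 mxE.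
  by rewrite -scalerAr mxE [in LHS]mxE.
have NS l : \sum_m P j 0 m * N l0.1 m l =
    if (l : nat) is l'.+1 then P j 0 (inord l') * (tt l' == l0.1)%:R else 0.
  case El: (l : nat) => [|l'].
    by rewrite big1 // => m _; rewrite mxE El mulr0.
  have l'k : (l' < k.+1)%N by rewrite ltnW // -El.
  rewrite (bigD1 (inord l')) //= mxE El inordK // eqxx big1 ?addr0 // => m ml.
  rewrite mxE El; case: eqP => [[E]|_]; last by rewrite mulr0.
  by rewrite E inord_val eqxx in ml.
split=> [l jl|]; rewrite PS NS.
  rewrite P0 ?(ltnW jl) // add0r; case El: (l : nat) jl => [|l'] // jl.
  have l'k : (l' < k.+1)%N by rewrite ltnW // -El.
  by rewrite P0 ?mul0r ?mulr0 // inordK.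
rewrite inordK // P0 ?inordK // add0r eqxx mulr1.
by rewrite mulf_neq0.
Qed.

End Residual.

(** * Ranks of free factors *)

Section AddLift.
Local Open Scope ring_scope.
Variables (T : choiceType) (V : zmodType) (f : T -> V).

Definition add_lift (x : freeGroup T) : V :=
  \sum_(l <- fg_word x) (if l.2 then - f l.1 else f l.1).

Lemma add_liftM x y : add_lift (x * y)%g = add_lift x + add_lift y.
Proof.
rewrite /add_lift /=; elim: (fg_word x) => [|l s IHs]; first by rewrite big_nil add0r.
rewrite [word_mul _ _]/(push l (word_mul s (fg_word y))) big_cons -addrA -IHs.
case: (word_mul _ _) => [|m u] /=; first by rewrite big_seq1 big_nil addr0.
case: eqVneq => [->|_]; last by rewrite big_cons.
by rewrite big_cons addrA /linv /=; case: l.2; rewrite ?addNr ?addrN add0r.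
Qed.

Lemma add_lift_gen t : add_lift (fg_gen t) = f t.
Proof. by rewrite /add_lift big_seq1. Qed.

Lemma add_lift1 : add_lift 1%g = 0.
Proof. exact: big_nil. Qed.

Lemma add_liftV x : add_lift x^-1%g = - add_lift x.
Proof.
by apply: (addrI (add_lift x)); rewrite -add_liftM mulgV add_lift1 addrN.
Qed.

Lemma add_liftJ x g : add_lift (x ^ g)%g = add_lift x.
Proof. by rewrite /conjg !add_liftM add_liftV addrCA addNr addr0. Qed.

Lemma add_lift_letter l : add_lift (letter l) = if l.2 then - f l.1 else f l.1.
Proof. by rewrite /add_lift big_seq1. Qed.

Lemma add_lift_wordg s :
  add_lift (wordg s) = \sum_(l <- s) (if l.2 then - f l.1 else f l.1).
Proof.
elim: s => [|l s IHs]; first by rewrite wordg_nil add_lift1 big_nil.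
by rewrite wordg_cons add_liftM IHs big_cons add_lift_letter.
Qed.

Lemma add_hom_ext (h : freeGroup T -> V) : (forall x y, h (x * y)%g = h x + h y) ->
  (forall t, h (fg_gen t) = f t) -> h =1 add_lift.
Proof.
move=> hM hg x.
have h1 : h 1%g = 0 by apply: (addrI (h 1%g)); rewrite -hM mulg1 addr0.
have hV y : h y^-1%g = - h y by apply: (addrI (h y)); rewrite -hM mulgV h1 addrN.
rewrite -(wordgK x); elim: (fg_word x) => [|l s IHs].
  by rewrite wordg_nil h1 add_lift1.
rewrite wordg_cons hM add_liftM IHs add_lift_letter letterE.
by case: ifP => _; rewrite ?hV hg.
Qed.

End AddLift.

Section Abelianization.
Local Open Scope ring_scope.

(** The vector of exponent sums; rational coefficients make ranks of matrices available. *)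
Definition ab (x : F3) : 'rV[rat]_3 := add_lift (fun i : 'I_3 => delta_mx 0 i) x.

Lemma abM (x y : F3) : ab (x * y)%g = ab x + ab y.
Proof. exact: add_liftM. Qed.

Lemma abV (x : F3) : ab x^-1%g = - ab x.
Proof. exact: add_liftV. Qed.

Lemma abJ (x g : F3) : ab (x ^ g)%g = ab x.
Proof. exact: add_liftJ. Qed.

Definition abmx (phi : F3 -> F3) : 'M[rat]_3 := \matrix_i ab (phi (fg_gen i)).

Lemma ab_hom (phi : F3 -> F3) x : {morph phi : x y / (x * y)%g} ->
  ab (phi x) = ab x *m abmx phi.
Proof.
move=> phiM; pose h y := ab y *m abmx phi.
have hM y z : h (y * z)%g = h y + h z by rewrite /h abM mulmxDl.
have hg (t : 'I_3) : h (fg_gen t) = ab (phi (fg_gen t)).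
  by rewrite /h /ab add_lift_gen -rowE rowK.
rewrite -/(h x) (add_hom_ext hM hg).
by apply: (add_hom_ext (h := fun y => ab (phi y))) => // y z; rewrite phiM abM.
Qed.

(** Each letter of a word with vanishing exponent sums can be cancelled, up to a
    commutator, against one of its inverses. *)
Lemma ab_eq0_der1 (gT : finGroupType) (G : {group gT}) (chi : F3 -> gT) (x : F3) :
    {morph chi : x y / (x * y)%g} -> (forall x, chi x \in G) -> ab x = 0 ->
  chi x \in (G^`(1))%g.
Proof.
move=> chiM chiG.
have signE (m l : 'I_3 * bool) : m != linv l ->
    (if m.2 then - delta_mx 0 m.1 else delta_mx 0 m.1 : 'rV_3) 0 l.1 =
     (if l.2 then -1 else 1) * (m == l)%:R :> rat.
  case: m l => [t b] [t' b'] /=; rewrite /linv !xpair_eqE /= [t == t']eq_sym.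
  by case: b b' => [] [] /=; rewrite ?mxE ?eqxx /= ?andbT ?andbF ?mulr0 ?mul1r ?mulN1r //;
    case: eqP; rewrite ?oppr0.
rewrite -(wordgK x); move: (fg_word x) => s.
move: {2}(size s) (leqnn (size s)) => n.
elim: n s => [|n IHn] [|l s] // sn; try by move=> *; rewrite wordg_nil (hom1 chiM) group1.
move=> ab0; have ls : linv l \in s.
  apply/negPn/negP => nl; have := congr1 (fun M : 'rV_3 => M 0 l.1) ab0.
  rewrite /ab add_lift_wordg summxE mxE.
  have E (m : 'I_3 * bool) : m \in l :: s -> (if m.2 then - delta_mx 0 m.1 else delta_mx 0 m.1 : 'rV_3) 0 l.1 =
     (if l.2 then -1 else 1) * (m == l)%:R :> rat.
    move=> ms; have nm : m != linv l.
      apply: contraNneq nl => ml; move: ms; rewrite ml inE => /orP[|//].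
      by rewrite /linv; case: (l) => t []; rewrite xpair_eqE andbF.
    exact: signE.
  rewrite (eq_big_seq _ E) -mulr_sumr => /eqP; rewrite mulf_eq0.
  have -> : (\sum_(i <- l :: s) (i == l)%:R = (count_mem l (l :: s))%:R :> rat).
    by elim: (l :: s) => [|m r IHr]; rewrite ?big_nil // big_cons IHr natrD.
  by rewrite pnatr_eq0 /= eqxx /=; case: l.2; rewrite ?oppr_eq0 oner_eq0.
case/splitPr: ls sn ab0 => s1 s2 sn ab0.
have E : wordg (l :: s1 ++ linv l :: s2) =
    ([~ (letter l)^-1, (wordg s1)^-1] * wordg (s1 ++ s2))%g.
  rewrite !(wordg_cons, wordg_cat) letterV /commg /conjg !invgK !mulgA.
  by rewrite mulgVK.
rewrite E chiM groupM //.
  rewrite (_ : chi _ = [~ (chi (letter l))^-1, (chi (wordg s1))^-1]%g).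
    by apply: mem_commg; rewrite groupV chiG.
  by rewrite /commg /conjg !(chiM, homV chiM).
apply: IHn; first by move: sn; rewrite /= !size_cat /= addnS; lia.
by move: ab0; rewrite E abM [ab (commg _ _)]abM [ab (conjg _ _)]abJ abV addNr add0r.
Qed.

Definition retract (phi : F3 -> F3) (A : set F3) :=
  [/\ {morph phi : x y / (x * y)%g}, forall x, A (phi x) & forall x, A x -> phi x = x].

Lemma retract_sub_rank phi A phi' A' : retract phi A -> retract phi' A' ->
  (A `<=` A')%classic -> (abmx phi <= abmx phi')%MS.
Proof.
move=> [phiM phiA _] [phiM' _ phiK'] AA'; apply/row_subP => i.
by rewrite rowK -(phiK' (phi (fg_gen i))) ?ab_hom ?submxMl //; apply/AA'/phiA.
Qed.

(** Suppose that some x in A' differs from phi x, and let psi be a map to a finite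
    p-group that separates them.  Every y in A' has the same exponent sums as phi y, so
    the image G of A' under (psi, psi o phi) is generated by the image H of A and by
    commutators.  These lie in the Frattini subgroup of the p-group G, so G = H; but H
    is diagonal, and (psi x, psi (phi x)) is not. *)
Lemma retract_eq phi A phi' A' : retract phi A -> retract phi' A' ->
  (A `<=` A')%classic -> (\rank (abmx phi') <= \rank (abmx phi))%N -> A = A'.
Proof.
move=> rA rA' AA' rk; have sub := retract_sub_rank rA rA' AA'.
have sub' : (abmx phi' <= abmx phi)%MS.
  by rewrite -(mxrank_leqif_sup sub) eqn_leq rk mxrankS.
case: rA rA' => [phiM phiA phiK] [phiM' phiA' phiK'].
have idem : abmx phi *m abmx phi = abmx phi.
  by apply/row_matrixP => i; rewrite row_mul !rowK -ab_hom // phiK.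
have abphi x : A' x -> ab (phi x) = ab x.
  move=> A'x; rewrite ab_hom //; have : (ab x <= abmx phi)%MS.
    by apply: submx_trans sub'; rewrite -(phiK' x) // ab_hom // submxMl.
  by case/submxP=> D ->; rewrite -mulmxA idem.
apply/seteqP; split=> // x A'x.
suff : ((phi x)^-1 * x)%g = 1%g by move/mulg1_eq; rewrite invgK => <-; apply: phiA.
apply: contrapT => y1; have [p [gT [U [psi [p_pr pU psiM psiU]]]]] := residually_p y1.
apply; rewrite psiM (homV psiM).
pose Psi y : gT * gT := (psi y, psi (phi y)).
have PsiM : {morph Psi : y z / (y * z)%g} by move=> y z; rewrite /Psi phiM !psiM.
have imM (B : set F3) (chi : F3 -> F3) : retract chi B ->
    group_set [set g | `[< exists2 y, B y & Psi y = g >]]%SET.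
  case=> chiM chiB chiK; apply/group_setP; split.
    rewrite finset.in_set; apply/asboolP; exists 1%g; last exact: (hom1 PsiM).
    by rewrite -(hom1 chiM).
  move=> g h; rewrite !finset.in_set => /asboolP[y By <-] /asboolP[z Bz <-]; apply/asboolP.
  exists (y * z)%g; last exact: PsiM.
  by rewrite -(chiK y By) -(chiK z Bz) -chiM.
have rA : retract phi A by [].
have rA' : retract phi' A' by [].
pose G := Group (imM _ _ rA'); pose H := Group (imM _ _ rA).
have GP y : A' y -> Psi y \in G by move=> A'y; rewrite finset.in_set; apply/asboolP; exists y.
have HP y : A y -> Psi y \in H by move=> Ay; rewrite finset.in_set; apply/asboolP; exists y.
have pG : (p.-group G)%g.
  apply: (@pgroupS _ _ [group of finset.setX U U]).
    apply/fintype.subsetP => g; rewrite finset.in_set => /asboolP[y _ <-].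
    by rewrite finset.in_setX !psiU.
  by rewrite /pgroup cardsX pnatM; apply/andP.
have HG : H \subset G.
  by apply/fintype.subsetP => g; rewrite finset.in_set => /asboolP[y Ay <-]; apply/GP/AA'.
have defG : ('Phi(G) <*> H = G)%g.
  apply/eqP; rewrite finset.eqEsubset join_subG HG Phi_sub /=.
  apply/fintype.subsetP => g; rewrite finset.in_set => /asboolP[y A'y <-].
  have -> : y = (phi y * ((phi y)^-1 * y))%g by rewrite mulVKg.
  rewrite PsiM groupM //; first by apply: (fintype.subsetP (joing_subr _ _)); apply/HP/phiA.
  apply: (fintype.subsetP (joing_subl _ _)).
  rewrite (Phi_joing pG); apply: (fintype.subsetP (joing_subl _ _)).
  have A'd : A' ((phi y)^-1 * y)%g.
    rewrite -{2}(phiK' y) // -(phiK' (phi y)) -?(homV phiM') -?phiM' //.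
    exact/AA'/phiA.
  rewrite -(phiK' _ A'd); apply: (ab_eq0_der1 (chi := Psi \o phi')).
  - by move=> u v; rewrite /= phiM' PsiM.
  - by move=> u; apply/GP/phiA'.
  - by rewrite abM abV abphi // addNr.
have : Psi x \in H.
  by have := Phi_nongen defG; rewrite genGid => ->; apply: GP.
rewrite finset.in_set => /asboolP[y Ay [E1 E2]].
by rewrite -E1 -E2 phiK // mulVg.
Qed.

End Abelianization.

Section Classes.
Local Open Scope group_scope.
Local Open Scope classical_set_scope.
Implicit Types (x y z g : F3) (A B : set F3) (u v : set (set F3)).

Lemma conj_class_refl A : conj_class A A.
Proof.
exists 1; apply/seteqP; split=> [x Ax|_ [x Ax <-]].
  by exists x; rewrite // invg1 mul1g mulg1.
by rewrite invg1 mul1g mulg1.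
Qed.

Lemma conj_classE A B : conj_class A B <-> exists g, B = [set x ^ g | x in A].
Proof.
have E g : [set g^-1 * x * g | x in A] = [set x ^ g | x in A].
  by congr image; apply: funext => x; rewrite /conjg mulgA.
by split=> -[g ->]; exists g; rewrite E.
Qed.

Lemma conj_image A g h : [set x ^ h | x in [set x ^ g | x in A]] = [set x ^ (g * h) | x in A].
Proof.
apply/seteqP; split=> [_ [_ [x Ax <-] <-]|_ [x Ax <-]].
  by exists x; rewrite // conjgM.
by exists (x ^ g); [exists x|rewrite conjgM].
Qed.

Lemma conj_class_eq A B : conj_class A B -> conj_class A = conj_class B.
Proof.
case/conj_classE=> g ->; apply/seteqP; split=> C /conj_classE[h ->]; apply/conj_classE.
  by exists (g^-1 * h); rewrite conj_image mulVKg.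
by exists (g * h); rewrite conj_image.
Qed.

Lemma retract_conj phi A g : retract phi A ->
  exists2 phi', retract phi' [set x ^ g | x in A] & abmx phi' = abmx phi.
Proof.
case=> phiM phiA phiK; exists (fun x => phi (x ^ g^-1) ^ g).
  split=> [x y|x|_ [x Ax <-]]; first by rewrite conjMg phiM conjMg.
    by exists (phi (x ^ g^-1)).
  by rewrite conjgK phiK.
by apply/matrixP => i j; rewrite !mxE abJ (homJ phiM) abJ.
Qed.

(** The rank is read off a retraction, as the rank of its abelianization. *)
Definition rank_of u (r : nat) := exists A phi,
  [/\ u = conj_class A, retract phi A & \rank (abmx phi) = r].

Lemma rank_of_member u r A : rank_of u r -> u A ->
  u = conj_class A /\ exists2 phi, retract phi A & \rank (abmx phi) = r.
Proof.
case=> B [phi [-> rB <-]] BA; split; first exact: conj_class_eq.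
have /conj_classE[g ->] := BA; have [phi' r' <-] := retract_conj g rB.
by exists phi'.
Qed.

Lemma retract_rank_le phi A phi' A' : retract phi A -> retract phi' A' -> A `<=` A' ->
  (\rank (abmx phi) <= \rank (abmx phi'))%N.
Proof. by move=> rA rA' /(retract_sub_rank rA rA')/mxrankS. Qed.

Lemma rank_of_uniq u r r' : rank_of u r -> rank_of u r' -> r = r'.
Proof.
move=> [A [phi [uA rA <-]]] /rank_of_member H.
have [|_ [phi' rA' <-]] := H A; first by rewrite uA; apply: conj_class_refl.
by apply/eqP; rewrite eqn_leq !(retract_rank_le (A := A) (A' := A)).
Qed.

(** Nested retracts of equal rank coincide. *)
Lemma ff_edge_rank u v r : ff_edge u v -> rank_of u r -> rank_of v r -> u = v.
Proof.
case=> A [B [uA vB AB]] /rank_of_member/(_ uA)[-> [phi rA rk]].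
move=> /rank_of_member/(_ vB)[-> [phi' rB rk']].
by case: AB => sub; congr conj_class; [|apply/esym];
  [apply: (retract_eq rA rB)|apply: (retract_eq rB rA)]; rewrite // rk rk'.
Qed.

Lemma free_factor_retract A : free_factor setT A -> exists phi, retract phi A.
Proof.
case=> C /free_product_retraction[phi [phiM phiA phiK _]]; exists phi.
by split=> // [x y|x]; [apply: phiM|apply: phiA].
Qed.

(** Rank 0 and rank 3 are those of the trivial and of the full retract. *)
Lemma vertex_rank u : ff_vertex u -> exists2 r, rank_of u r & (0 < r < 3)%N.
Proof.
case=> A [-> [fA AT] A1]; have [phi rA] := free_factor_retract fA.
exists (\rank (abmx phi)); first by exists A, phi.
apply/andP; split; rewrite ltnNge; apply/negP => rk.
  have r1 : retract (fun=> 1) [set 1] by split=> // x y; rewrite mulg1.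
  apply: A1; apply: esym; apply: (retract_eq r1 rA); last exact: leq_trans rk _.
  by move=> _ ->; case: rA => phiM phiA _; rewrite -(hom1 phiM).
have rT : retract id setT by [].
apply: AT; apply: (retract_eq rA rT) => //; apply: leq_trans rk.
exact: rank_leq_row.
Qed.

End Classes.

Section Bases.
Local Open Scope group_scope.
Local Open Scope classical_set_scope.
Implicit Types (x y z g : F3) (A B : set F3) (u v : set (set F3)).

Definition sub3 x y z : F3 -> F3 := fg_lift (tnth [tuple x; y; z]).
Definition basis3 x y z := is_basis (tnth [tuple x; y; z]).

Lemma I3P (i : 'I_3) : [\/ i = ord0, i = inord 1 | i = ord_max].
Proof.
case: i => -[|[|[|i]]] // Hi; [constructor 1|constructor 2|constructor 3];
  by apply: val_inj; rewrite /= ?inordK.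
Qed.

Lemma inord1_neq0 : (inord 1 == ord0 :> 'I_3) = false.
Proof. by rewrite -val_eqE /= inordK. Qed.

Lemma inord1_neqmax : (inord 1 == ord_max :> 'I_3) = false.
Proof. by rewrite -val_eqE /= inordK. Qed.

Lemma sub3M x y z : {morph sub3 x y z : s t / s * t}.
Proof. exact: fg_liftM. Qed.

Lemma sub3a x y z : sub3 x y z ga = x.
Proof. exact: fg_lift_gen. Qed.

Lemma sub3b x y z : sub3 x y z gb = y.
Proof. by rewrite [LHS]fg_lift_gen (tnth_nth x) /= inordK. Qed.

Lemma sub3c x y z : sub3 x y z gc = z.
Proof. exact: fg_lift_gen. Qed.

Definition sub3E := (sub3a, sub3b, sub3c).

Lemma hom3_ext (G : groupType) (f h : F3 -> G) :
    {morph f : x y / x * y} -> {morph h : x y / x * y} ->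
  f ga = h ga -> f gb = h gb -> f gc = h gc -> f =1 h.
Proof.
by move=> fM hM fa fb fc; apply: hom_ext => // t; case: (I3P t) => ->.
Qed.

Lemma basis3_inv x y z : basis3 x y z -> exists psi : F3 -> F3,
  [/\ {morph psi : s t / s * t}, cancel (sub3 x y z) psi, cancel psi (sub3 x y z)
    & [/\ psi x = ga, psi y = gb & psi z = gc]].
Proof.
case=> psi K Ki; exists psi; split=> //.
  by move=> s t; apply: (can_inj K); rewrite fg_liftM !Ki.
rewrite -/(sub3 x y z) in K Ki.
by split; [have := K ga|have := K gb|have := K gc]; rewrite ?sub3a ?sub3b ?sub3c.
Qed.

Lemma sub3_comp (f : F3 -> F3) x y z : {morph f : s t / s * t} ->
  f \o sub3 x y z =1 sub3 (f x) (f y) (f z).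
Proof.
move=> fM; apply: hom3_ext; rewrite /= ?sub3E //.
  by move=> s t /=; rewrite sub3M fM.
exact: sub3M.
Qed.

Definition sel (k : nat) : F3 -> F3 := fg_lift (fun i : 'I_3 => if (i < k)%N then fg_gen i else 1).

Lemma abmx_comp (f h : F3 -> F3) : {morph h : s t / s * t} ->
  abmx (h \o f) = (abmx f *m abmx h)%R.
Proof.
by move=> hM; apply/row_matrixP => i; rewrite row_mul !rowK /= ab_hom.
Qed.

Lemma abmx_id : abmx id = 1%:M%R.
Proof. by apply/row_matrixP => i; rewrite rowK row1 /ab add_lift_gen. Qed.

Lemma abmx_sel k : (k <= 3)%N -> abmx (sel k) = pid_mx k.
Proof.
move=> k3; apply/row_matrixP => i; rewrite rowK /sel fg_lift_gen; apply/rowP => j.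
rewrite !mxE; case: ifP => ik; rewrite ?andbT ?andbF.
  by rewrite /ab add_lift_gen mxE eqxx /= val_eqE eq_sym.
by rewrite /ab add_lift1 mxE.
Qed.

(** The projection sel k of the standard basis, conjugated by the automorphism that the
    basis {x, y, z} defines, retracts to the span of the first k basis elements. *)
Lemma basis_segment x y z (k : nat) (S : set F3) : basis3 x y z -> (k <= 3)%N ->
    S = [set sub3 x y z (fg_gen i) | i in [set i : 'I_3 | (i < k)%N]] ->
  [/\ free_factor setT (gen S), rank_of (ff_class S) k
    & exists2 rho, retract rho (gen S) & {in [pred i : 'I_3 | (k <= i)%N],
       forall i, rho (sub3 x y z (fg_gen i)) = 1}].
Proof.
move=> B k3 SE; have [psi [psiM K Ki _]] := basis3_inv B.
set f := sub3 x y z in SE K Ki *; have fM : {morph f : s t / s * t} by apply: sub3M.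
have selM : {morph sel k : s t / s * t} by apply: fg_liftM.
have gS := subgroup_gen S.
have r : retract (f \o (sel k \o psi)) (gen S).
  split=> [s t|s|]; first by rewrite /= psiM selM fM.
    rewrite /= -[psi s]wordgK (hom_prod selM) (hom_prod fM).
    elim: (fg_word _) => [|l w IHw]; first by rewrite big_nil; case: gS.
    rewrite big_cons; case: (gS) => _ GM GV; apply: GM => //.
    have Sl : gen S (f (sel k (fg_gen l.1))).
      rewrite /sel fg_lift_gen; case: ifP => lk; last by rewrite (hom1 fM); case: gS.
      by apply: sub_gen; rewrite SE; exists l.1.
    by rewrite letterE; case: ifP => _ //; rewrite (homV selM) (homV fM); apply: GV.
  suff : gen S `<=` [set s | f (sel k (psi s)) = s] by apply.
  apply: gen_sub.
    split=> /= [|s t sE tE|s sE]; first by rewrite (hom1 psiM) (hom1 selM) (hom1 fM).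
      by rewrite psiM selM fM sE tE.
    by rewrite (homV psiM) (homV selM) (homV fM) sE.
  by rewrite SE => _ [i ik <-] /=; rewrite K /sel fg_lift_gen ik.
have SI : gen S = f @` [set s | word_over (fun i : 'I_3 => (i < k)%N) s].
  rewrite -gen_word_over; apply/seteqP; split.
    apply: gen_sub; first exact/(subgroup_image fM)/subgroup_gen.
    by rewrite SE => _ [i ik <-]; exists (fg_gen i) => //; apply: sub_gen; exists i.
  move=> _ [s Hs <-]; move: s Hs.
  suff : gen [set (fg_gen i : F3) | i in [set i : 'I_3 | (i < k)%N]] `<=` [set s | gen S (f s)] by [].
  apply: gen_sub.
    by case: gS => g1 gM gV; split=> /= [|s t|s]; rewrite ?(hom1 fM) ?fM ?(homV fM) //; [apply: gM|apply: gV].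
  by move=> _ [i ik <-]; apply: sub_gen; rewrite SE; exists i.
split.
- exists (f @` [set s | word_over (predC (fun i : 'I_3 => (i < k)%N)) s]); rewrite SI.
  have -> : setT = range f by apply/seteqP; split=> // s _; exists (psi s).
  by apply: free_product_subset => //; apply: can_inj K.
- exists (gen S), (f \o (sel k \o psi)); split=> //.
  have abU : (abmx psi *m abmx f = 1%:M)%R.
    rewrite -abmx_comp // -abmx_id; congr abmx; apply: funext => s; exact: Ki.
  have [Up Uf] := mulmx1_unit abU.
  rewrite abmx_comp // abmx_comp // mxrankMfree; last by rewrite row_free_unit.
  by rewrite (eqmxMfull _ _) ?row_full_unit // abmx_sel // rank_pid_mx; lia.
- exists (f \o (sel k \o psi)) => // i; rewrite inE /= => ki.
  by rewrite K /sel fg_lift_gen ltnNge ki /= (hom1 fM).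
Qed.

End Bases.

(** * The link of the class of <a> *)

Section Link.
Local Open Scope group_scope.
Local Open Scope classical_set_scope.
Implicit Types (x y z g : F3) (A B : set F3) (u v : set (set F3)).

Lemma basis3_comp (f : F3 -> F3) x y z : {morph f : s t / s * t} -> bijective f ->
  basis3 x y z -> basis3 (f x) (f y) (f z).
Proof.
move=> fM fB B; apply: (eq_bij (f := f \o sub3 x y z)); first exact: bij_comp.
exact: sub3_comp.
Qed.

Lemma basis3_swap x y z : basis3 x y z -> basis3 y x z.
Proof.
move=> B; have := basis3_comp (sub3M x y z) B; rewrite -/(sub3 _ _ _).
move=> /(_ gb ga gc); rewrite !sub3E; apply.
have swK : cancel (sub3 gb ga gc) (sub3 gb ga gc).
  apply: (hom3_ext (f := sub3 gb ga gc \o sub3 gb ga gc) (h := id)) => //=; rewrite ?sub3E //.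
  by move=> s t; rewrite /= !sub3M.
by exists (sub3 gb ga gc).
Qed.

Lemma basis3_swap23 x y z : basis3 x y z -> basis3 x z y.
Proof.
move=> B; have := basis3_comp (sub3M x y z) _ (_ : basis3 ga gc gb).
rewrite !sub3E; apply => //.
have swK : cancel (sub3 ga gc gb) (sub3 ga gc gb).
  apply: (hom3_ext (f := sub3 ga gc gb \o sub3 ga gc gb) (h := id)) => // [s t| | |] /=.
  - by rewrite !sub3M.
  - by rewrite !sub3a.
  - by rewrite sub3b sub3c.
  - by rewrite sub3c sub3b.
by exists (sub3 ga gc gb).
Qed.

Lemma basis3_V x y z : basis3 x y z -> basis3 x^-1 y z.
Proof.
move=> B; have := basis3_comp (sub3M x y z) B.
move=> /(_ ga^-1 gb gc); rewrite (homV (sub3M _ _ _)) !sub3E; apply.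
have K : cancel (sub3 ga^-1 gb gc) (sub3 ga^-1 gb gc).
  apply: (hom3_ext (f := sub3 ga^-1 gb gc \o sub3 ga^-1 gb gc) (h := id)) => // [s t| | |] /=.
  - by rewrite !sub3M.
  - by rewrite sub3a (homV (sub3M _ _ _)) sub3a invgK.
  - by rewrite !sub3b.
  - by rewrite !sub3c.
by exists (sub3 ga^-1 gb gc).
Qed.

Lemma basis3_J x y z g : basis3 x y z -> basis3 (x ^ g) (y ^ g) (z ^ g).
Proof.
apply: (basis3_comp (f := fun s => s ^ g)) => [s t|]; first exact: conjMg.
by exists (fun s => s ^ g^-1) => s; [exact: conjgK|exact: conjgKV].
Qed.

Lemma basis3_std : basis3 ga gb gc.
Proof.
exists id => s; first exact: (hom3_ext (h := id) (sub3M _ _ _) _ (sub3a _ _ _) (sub3b _ _ _) (sub3c _ _ _)).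
exact: (hom3_ext (h := id) (sub3M _ _ _) _ (sub3a _ _ _) (sub3b _ _ _) (sub3c _ _ _)).
Qed.

Lemma segment1 x y z : [set x] = [set sub3 x y z (fg_gen i) | i in [set i : 'I_3 | (i < 1)%N]].
Proof.
apply/seteqP; split=> [_ ->|_ [i i0 <-]]; first by exists ord0 => //; exact: sub3a.
have -> : i = ord0 by apply: val_inj; move: i0 => /=; case: (nat_of_ord i).
exact: sub3a.
Qed.

Lemma segment2 x y z :
  [set x; y] = [set sub3 x y z (fg_gen i) | i in [set i : 'I_3 | (i < 2)%N]].
Proof.
apply/seteqP; split=> [_ [->|->]|_ [i i0 <-]].
- by exists ord0 => //; exact: sub3a.
- by exists (inord 1); rewrite /= ?inordK //; exact: sub3b.
case: (I3P i) i0 => -> //=; rewrite ?[sub3 _ _ _ _]sub3a ?[sub3 _ _ _ _]sub3b => _; [by left|by right].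
Qed.

Lemma rank1 x y z : basis3 x y z -> rank_of (ff_class [set x]) 1.
Proof. by move=> B; case: (basis_segment B _ (segment1 x y z)). Qed.

Lemma rank2 x y z : basis3 x y z -> rank_of (ff_class [set x; y]) 2.
Proof. by move=> B; case: (basis_segment B _ (segment2 x y z)). Qed.

Lemma retract2 x y z : basis3 x y z -> exists2 rho, retract rho (gen [set x; y]) & rho z = 1.
Proof.
move=> B; case: (basis_segment B _ (segment2 x y z)) => // _ _ [rho r H].
by exists rho => //; have := H ord_max; rewrite inE [sub3 _ _ _ _]sub3c; apply.
Qed.

Lemma rank_vertex x y z S k : basis3 x y z -> (0 < k < 3)%N ->
    S = [set sub3 x y z (fg_gen i) | i in [set i : 'I_3 | (i < k)%N]] ->
  ff_vertex (ff_class S).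
Proof.
move=> B /andP[k0 k3] SE; have [fS rS [rho r _]] := basis_segment B (ltnW k3) SE.
have rk phi A : ff_class S = conj_class A -> retract phi A -> \rank (abmx phi) = k.
  by move=> E rA; apply: (@rank_of_uniq (ff_class S)) => //; exists A, phi.
exists (gen S); split=> //.
  split=> // ST; have : retract id (gen S) by rewrite ST; split.
  move/(rk _ _ erefl); rewrite abmx_id mxrank1; lia.
move=> S1; have : retract (fun=> 1) (gen S).
  by rewrite S1; split=> // s t; rewrite mulg1.
move/(rk _ _ erefl); suff -> : abmx (fun=> 1) = 0%R by rewrite mxrank0; lia.
by apply/row_matrixP => i; rewrite rowK row0 /ab add_lift1.
Qed.

(** An element that commutes with t runs along the axis of t. *)
Lemma commute_gen (T : choiceType) (t : T) (x : freeGroup T) :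
  commute (fg_gen t) x -> powers (fg_gen t) x.
Proof.
move=> cx; pose l := (t, false).
have cl : creduced [:: l] by rewrite /creduced /= /linv xpair_eqE andbF.
have E : wordg [:: l] * wordg (fg_word x) = wordg (fg_word x) * wordg [:: l].
  by rewrite wordgK wordg1 letterE.
have l0 : [:: l] <> [::] by [].
have [k H] := conj_prefix cl l0 cl (fg_wordP x) E.
have pw (m : T * bool) : prefix (fg_word x) (powerw k [:: m]) -> x = letter m ^+ size (fg_word x).
  move=> /prefixW/mem_infix Hm; rewrite -{1}(wordgK x).
  have /all_pred1P -> : all (pred1 m) (fg_word x).
    apply/allP => a /Hm /flattenP[w]; rewrite mem_nseq => /andP[_ /eqP ->].
    by rewrite inE.
  rewrite size_nseq; elim: (size _) => [|j IHj]; first by rewrite wordg_nil.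
  by rewrite wordg_cons IHj expgS.
exists (size (fg_word x)); case/orP: H => /pw H; [left|right].
  by rewrite {1}H letterE.
by rewrite {1}H letterE /= expVgn.
Qed.

(** The powers of the core of y have length a multiple of k. *)
Lemma gen_root (T : choiceType) (t : T) (y : freeGroup T) (k : nat) :
  fg_gen t = y ^+ k -> k = 1%N.
Proof.
move=> E; have k0 : (0 < k)%N by case: k E => //; rewrite expg0 => /eqP.
have y1 : y <> 1 by move=> y1; move: E; rewrite y1 expg1n => /eqP.
have [r [C [C0 _ _ /(_ k k0)]]] := cyclic_core y1.
rewrite -E => /(congr1 size); rewrite !size_cat size_powerw /=.
case: C C0 => // c C _ /=; case: k k0 {E} => [|[|k]] // _; lia.
Qed.

Lemma gen_conj (S : set F3) g : gen [set x ^ g | x in S] = [set x ^ g | x in gen S].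
Proof.
have sub (R : set F3) (h : F3) : gen [set x ^ h | x in R] `<=` [set x ^ h | x in gen R].
  apply: gen_sub; last by move=> _ [x Rx <-]; exists x => //; apply: sub_gen.
  exact: (@subgroup_image _ _ (fun x : F3 => x ^ h) (fun x y => conjMg x y h) _ (subgroup_gen R)).
apply/seteqP; split; first exact: sub.
move=> _ [x Sx <-]; have := sub [set x ^ g | x in S] g^-1 x.
rewrite conj_image mulgV (_ : [set x ^ 1 | x in S] = S); last first.
  by apply/seteqP; split=> [_ [z Sz <-]|z Sz]; rewrite ?conjg1 //; exists z; rewrite ?conjg1.
by case/(_ Sx) => z Hz <-; rewrite conjgKV.
Qed.

Lemma ff_class_conj (S : set F3) g : ff_class [set x ^ g | x in S] = ff_class S.
Proof.
rewrite /ff_class gen_conj; apply/esym/conj_class_eq/conj_classE; by exists g.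
Qed.

Lemma gen_pair_sgg e x y : gen [set sgg e x; y] = gen [set x; y].
Proof.
have sub d z : gen [set sgg d z; y] `<=` gen [set z; y].
  have [_ _ GV] := subgroup_gen [set z; y].
  apply: gen_sub; first exact: subgroup_gen.
  move=> _ [->|->]; last by apply: sub_gen; right.
  by case: d; [apply: GV|]; apply: sub_gen; left.
apply/seteqP; split; first exact: sub.
by have := sub e (sgg e x); rewrite sggK.
Qed.

Lemma ff_class_pair e x y g : ff_class [set sgg e (x ^ g); y ^ g] = ff_class [set x; y].
Proof.
rewrite [LHS](_ : _ = ff_class [set x ^ g; y ^ g]); last by rewrite /ff_class gen_pair_sgg.
rewrite -(ff_class_conj [set x; y] g); congr ff_class.
by apply/seteqP; split=> [_ [->|->]|_ [_ [->|->] <-]]; [exists x; [left|]|exists y; [right|]|left|right].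
Qed.

(** If <a', x> and <a', y> both contain a conjugate of a, for a basis {a', x, y}, then
    a is conjugate to a' or its inverse: killing x shows that a is conjugate to a power
    of a', and a has no proper roots. *)
Lemma link_edge_basis u v : ff_extra_edge u v ->
    (exists2 B, u B & exists g, B (ga ^ g)) -> (exists2 B, v B & exists g, B (ga ^ g)) ->
  exists x y, [/\ basis3 ga x y, u = ff_class [set ga; x] & v = ff_class [set ga; y]].
Proof.
have conj_in S : (exists2 B, ff_class S B & exists g, B (ga ^ g)) -> exists g, gen S (ga ^ g).
  case=> B /conj_classE[h ->] [g [z Sz E]]; exists (g * h^-1).
  by rewrite conjgM -E conjgK.
case=> a' [x [y [B -> ->]]] /conj_in[g1 H1] /conj_in[g2 H2].
have B' := basis3_swap23 B.
have [rho [rhoM _ rhoK] rhox] := retract2 B'.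
have [P aP E1] : exists2 P, powers a' P & rho (ga ^ g1) = P.
  exists (rho (ga ^ g1)) => //; move: (ga ^ g1) H1.
  suff : gen [set a'; x] `<=` [set z | powers a' (rho z)] by [].
  have [p1 pM pV] := subgroup_powers a'.
  apply: gen_sub.
    split=> /= [|s t|s]; rewrite ?(hom1 rhoM) ?rhoM ?(homV rhoM) //; [exact: pM|exact: pV].
  move=> _ [->|->] /=; last by rewrite rhox.
  by rewrite rhoK; [apply: powers_id|apply: sub_gen; left].
pose h := (rho g1)^-1 * rho g2 * g2^-1.
have aE : ga = P ^ h.
  have := rhoK _ H2; rewrite (homJ rhoM) => E2.
  rewrite /h !conjgM -E1 (homJ rhoM) conjgK E2 conjgK; by [].
have [e eE] : exists e, ga = sgg e (a' ^ h).
  case: aP aE => k [] ->; rewrite ?conjVg conjXg => E.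
    by exists false; rewrite E (gen_root E).
  rewrite -expVgn in E; exists true; rewrite E.
  by rewrite (gen_root E).
exists (x ^ h), (y ^ h); split.
- by rewrite eE; have := basis3_J h B; case: (e) => //; apply: basis3_V.
- by rewrite {1}eE ff_class_pair.
- by rewrite {1}eE ff_class_pair.
Qed.

(** ** Killing a *)

Definition q : F3 -> F2 :=
  fg_lift (fun i : 'I_3 => if i == ord0 then 1 else if i == ord_max then c2 else b2).
Definition iota2 : F2 -> F3 := fg_lift (fun t : bool => if t then gc else gb).

Lemma qM : {morph q : s t / s * t}. Proof. exact: fg_liftM. Qed.
Lemma iota2M : {morph iota2 : s t / s * t}. Proof. exact: fg_liftM. Qed.
Lemma qa : q ga = 1. Proof. exact: fg_lift_gen. Qed.
Lemma qb : q gb = b2.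
Proof. by rewrite /q [LHS]fg_lift_gen inord1_neq0 inord1_neqmax. Qed.
Lemma qc : q gc = c2. Proof. exact: fg_lift_gen. Qed.
Lemma iota2b : iota2 b2 = gb. Proof. exact: fg_lift_gen. Qed.
Lemma iota2c : iota2 c2 = gc. Proof. exact: fg_lift_gen. Qed.

Lemma iota2K : cancel iota2 q.
Proof.
apply: (hom2_ext (f := q \o iota2) (h := id)) => //= [s t||]; last 2 first.
- by rewrite iota2b qb.
- by rewrite iota2c qc.
by rewrite /= iota2M qM.
Qed.

Lemma q_fix_a (f : F3 -> F3) : {morph f : s t / s * t} -> f ga = ga ->
  forall s, q (f (iota2 (q s))) = q (f s).
Proof.
move=> fM fa.
apply: (hom3_ext (f := q \o f \o iota2 \o q) (h := q \o f)) => //= [s t|s t|||].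
- by rewrite /= qM iota2M fM qM.
- by rewrite /= fM qM.
- by rewrite qa (hom1 iota2M) (hom1 fM) (hom1 qM) fa qa.
- by rewrite qb iota2b.
- by rewrite qc iota2c.
Qed.

Lemma basis3_basis2 x y : basis3 ga x y -> basis2 (q x) (q y).
Proof.
move=> B; have [psi [psiM K Ki [psia _ _]]] := basis3_inv B.
set f := sub3 ga x y in K Ki; have fM : {morph f : s t / s * t} by apply: sub3M.
have fa : f ga = ga by apply: sub3a.
apply: (eq_bij (f := q \o f \o iota2)); last first.
  apply: hom2_ext; rewrite /= ?sub2b ?sub2c ?iota2b ?iota2c /f ?sub3b ?sub3c //.
    by move=> s t /=; rewrite iota2M sub3M qM.
  exact: sub2M.
exists (q \o psi \o iota2) => s /=.
  by rewrite (q_fix_a psiM psia) K iota2K.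
by rewrite (q_fix_a fM fa) Ki iota2K.
Qed.

(** Let g conjugate <a, x> to <a, x'>, and rho be a retraction to <a, x>.  Then
    g^-1 (rho g) commutes with a, hence is a power of a, so that g lies in <a, x> and the
    two factors are equal.  Modulo a, each of x and x' is then a power of the other. *)
Lemma link_vertex_uniq x y x' y' : basis3 ga x y -> basis3 ga x' y' ->
    ff_class [set ga; x] = ff_class [set ga; x'] ->
  exists e, q x' = sgg e (q x).
Proof.
move=> B B' E.
have genE : gen [set ga; x'] = gen [set ga; x].
  have : ff_class [set ga; x] (gen [set ga; x']) by rewrite E; apply: conj_class_refl.
  case/conj_classE=> g gE; have gG := subgroup_gen [set ga; x]; have [G1 GM GV] := gG.
  have [z Hz za] : [set s ^ g | s in gen [set ga; x]] ga by rewrite -gE; apply: sub_gen; left.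
  have Ha : gen [set ga; x] (ga ^ g^-1) by move: Hz; rewrite -{1}(conjgK g z) za.
  have [rho [rhoM rhoG rhoK] _] := retract2 B.
  have rhoa : rho ga = ga by apply: rhoK; apply: sub_gen; left.
  have ca : commute ga (g^-1 * (rho g^-1)^-1).
    apply/commgP; rewrite -conjg_fix conjgM; apply/eqP.
    by rewrite -(rhoK _ Ha) (homJ rhoM) rhoa conjgK.
  have Gg : gen [set ga; x] g.
    have sub : powers ga `<=` gen [set ga; x].
      by rewrite -gen1E; apply: gen_sub => // _ ->; apply: sub_gen; left.
    have := GV _ (GM _ _ (sub _ (commute_gen (t := ord0) ca)) (rhoG g^-1)).
    by rewrite mulgVK invgK.
  rewrite gE; apply/seteqP; split=> [_ [s Hs <-]|s Hs].
    exact: (GM _ _ (GV _ Gg) (GM _ _ Hs Gg)).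
  exists (s ^ g^-1); rewrite ?conjgKV // /conjg invgK.
  exact: (GM _ _ Gg (GM _ _ Hs (GV _ Gg))).
have qgen z s : gen [set ga; z] s -> powers (q z) (q s).
  move: s; suff : gen [set ga; z] `<=` [set s | powers (q z) (q s)] by [].
  have [p1 pM pV] := subgroup_powers (q z).
  apply: gen_sub.
    split=> /= [|s t|s]; rewrite ?(hom1 qM) ?qM ?(homV qM) //; [exact: pM|exact: pV].
  by move=> _ [->|->] /=; rewrite ?qa //; apply: powers_id.
have [m Hm] : powers (q x) (q x') by apply: qgen; rewrite -genE; apply: sub_gen; right.
have [n Hn] : powers (q x') (q x) by apply: qgen; rewrite genE; apply: sub_gen; right.
have {}Hm : exists e, q x' = sgg e (q x ^+ m) by case: Hm; [exists false|exists true].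
have {}Hn : exists e, q x = sgg e (q x' ^+ n) by case: Hn; [exists false|exists true].
have [e Em] := Hm; have [d En] := Hn; exists e.
suff -> : q x' = sgg e (q x) by [].
have qx1 : q x <> 1.
  move=> q1; have [psi K Ki] := basis3_basis2 B.
  have : b2 = 1 by apply: (can_inj K); rewrite sub2b (hom1 (sub2M _ _)).
  by move/eqP.
have sX f (z : F2) k : sgg f z ^+ k = sgg f (z ^+ k) by case: f; rewrite //= expVgn.
move: En; rewrite Em sX -expgnA -[sgg d (sgg e _)]/(sgg d (sgg e (q x ^+ (m * n)))).
case: (boolP (d == e)) => [/eqP ->|de].
  rewrite sggK => E1; have mn : (m * n)%N = 1%N.
    case: (m * n)%N E1 => [|[|j]] // E1; exfalso; apply: qx1.
    by apply: (@expg_eq1 _ _ j.+1) => //; apply: (@mulgI _ (q x)); rewrite -expgS -E1 mulg1.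
  by have -> : m = 1%N by move/eqP: mn; rewrite muln_eq1 => /andP[/eqP].
have -> : sgg d (sgg e (q x ^+ (m * n))) = (q x ^+ (m * n))^-1.
  by case: d e de {Em} => [] [].
move=> E1; exfalso; apply: qx1; apply: (@expg_eq1 _ _ (m * n).+1) => //.
by rewrite expgS {1}E1 mulVg.
Qed.

End Link.

(** * Distances in the link *)

Section Distances.
Local Open Scope group_scope.
Local Open Scope classical_set_scope.
Implicit Types (x y z g w : F3) (A B : set F3) (u v : set (set F3)).

(** The edges of the link of [<a>]. *)
Definition link_edge u v := exists x y,
  [/\ basis3 ga x y, u = ff_class [set ga; x] & v = ff_class [set ga; y]].

Lemma gen_bcE : gen [set gb; gc] = range iota2.
Proof.
apply/seteqP; split.
  apply: gen_sub; last by move=> _ [->|->]; [exists b2; rewrite ?iota2b|exists c2; rewrite ?iota2c].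
  split; first by exists 1; rewrite ?(hom1 iota2M).
    by move=> _ _ [s _ <-] [t _ <-]; exists (s * t); rewrite ?iota2M.
  by move=> _ [s _ <-]; exists s^-1; rewrite ?(homV iota2M).
move=> _ [s _ <-]; apply: (hom_in iota2M (subgroup_gen _)) => -[].
  by rewrite [iota2 _]iota2c; apply: sub_gen; right.
by rewrite [iota2 _]iota2b; apply: sub_gen; left.
Qed.

Lemma iota2_q w : gen [set gb; gc] w -> iota2 (q w) = w.
Proof. by rewrite gen_bcE => -[s _ <-]; rewrite iota2K. Qed.

Lemma basis2_sgg e d (x y : F2) : basis2 (sgg e x) (sgg d y) -> basis2 x y.
Proof.
move=> B; apply: (eq_bij (f := sub2 (sgg e x) (sgg d y) \o sub2 (sgg e b2) (sgg d c2))).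
  apply: bij_comp => //; apply: nielsen_basis; apply: nielsen_sgg; exact: Nielsen_std.
have sM := sub2M (sgg e x) (sgg d y).
move=> s; rewrite (sub2_comp _ _ sM) (hom_sgg sM) (hom_sgg sM) sub2b sub2c !sggK.
by [].
Qed.

(** Partial conjugation by g, which fixes g itself, is inverted by that by g^-1. *)
Lemma basis3_partial_conj g : gen [set gb; gc] g -> basis3 ga (gb ^ g) (gc ^ g).
Proof.
have H h : gen [set gb; gc] h ->
    forall s, sub3 ga (gb ^ h) (gc ^ h) (iota2 s) = iota2 s ^ h.
  move=> _; apply: (hom2_ext (f := sub3 ga (gb ^ h) (gc ^ h) \o iota2)
    (h := fun s => iota2 s ^ h)) => [s t|s t||] /=.
  - by rewrite iota2M sub3M.
  - by rewrite iota2M conjMg.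
  - by rewrite !iota2b sub3b.
  - by rewrite !iota2c sub3c.
have inv h : gen [set gb; gc] h ->
    cancel (sub3 ga (gb ^ h) (gc ^ h)) (sub3 ga (gb ^ h^-1) (gc ^ h^-1)).
  move=> Gh; have GVh : gen [set gb; gc] h^-1.
    by case: (subgroup_gen [set gb; gc]) => _ _; apply.
  have hM := sub3M ga (gb ^ h^-1) (gc ^ h^-1).
  have hh : sub3 ga (gb ^ h^-1) (gc ^ h^-1) h = h.
    by rewrite -(iota2_q Gh) H ?iota2_q // /conjg invgK mulgV mulg1.
  apply: (hom3_ext (f := sub3 ga (gb ^ h^-1) (gc ^ h^-1) \o sub3 ga (gb ^ h) (gc ^ h))
    (h := id)) => [s t|//|||] /=.
  - by rewrite !sub3M.
  - by rewrite !sub3a.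
  - by rewrite sub3b (homJ hM) sub3b hh conjgKV.
  - by rewrite sub3c (homJ hM) sub3c hh conjgKV.
move=> Gg; exists (sub3 ga (gb ^ g^-1) (gc ^ g^-1)); first exact: inv.
have GVg : gen [set gb; gc] g^-1.
  by case: (subgroup_gen [set gb; gc]) => _ _; apply.
by have := inv _ GVg; rewrite invgK.
Qed.

(** Killing a turns the edges of the path into bases of F2.  Each vertex of the path
    determines its image up to inversion only (link_vertex_uniq), so representatives z i
    are chosen once and for all; changing signs preserves bases. *)
Lemma link_distance w (N n : nat) (u : nat -> set (set F3)) :
    gen [set gb; gc] w -> root_free (q w) ->
    u 0%N = ff_class [set ga; gb] -> u n = ff_class [set ga; gb ^ (w ^- N)] ->
    (forall i, (i < n)%N -> link_edge (u i) (u i.+1)) ->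
  (N <= n)%N.
Proof.
move=> Gw rw u0 un uE.
have /choice[XY XYP] : forall i, exists xy : F3 * F3, (i < n)%N ->
    [/\ basis3 ga xy.1 xy.2, u i = ff_class [set ga; xy.1] & u i.+1 = ff_class [set ga; xy.2]].
  move=> i; have [/uE [x [y H]]|_] := boolP (i < n)%N; last by exists (1, 1).
  by exists (x, y).
pose z i := if i is j.+1 then q (XY j).2 else b2.
have zP i : (i <= n)%N -> exists x y, [/\ basis3 ga x y, u i = ff_class [set ga; x] & q x = z i].
  case: i => [_|i lin]; first by exists gb, gc; rewrite qb; split=> //; exact: basis3_std.
  have [B _ uS] := XYP i lin; exists (XY i).2, (XY i).1; split=> //.
  exact: basis3_swap23.
have zE i : (i < n)%N -> exists e, q (XY i).1 = sgg e (z i).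
  move=> lin; have [x [y [B ux <-]]] := zP i (ltnW lin).
  have [B' ui _] := XYP i lin.
  by apply: link_vertex_uniq B B' _; rewrite -ux.
have zB i : (i < n)%N -> basis2 (z i) (z i.+1).
  move=> lin; have [e eE] := zE i lin; have [B _ _] := XYP i lin.
  by apply: (@basis2_sgg e false); rewrite -eE; apply: basis3_basis2.
have [x [y [B ux qx]]] := zP n (leqnn n).
have Gwn : gen [set gb; gc] (w ^- N).
  case: (subgroup_gen [set gb; gc]) => _ _ GV.
  exact: (GV _ (subgroupX N (subgroup_gen _) Gw)).
have [e eE] : exists e, q x = sgg e (q (gb ^ (w ^- N))).
  apply: link_vertex_uniq (basis3_partial_conj Gwn) B _; by rewrite -ux -un.
apply: (F2_distance (e := e) rw _ zB) => //.
by rewrite -qx eE (homJ qM) qb (homV qM) (homX qM) sggJ.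
Qed.

(** A basis {p, r} of F2 makes <p> a proper free factor of <b, c>, containing the powers
    of p. *)
Lemma filling_root_free w : filling (gen [set gb; gc]) w -> root_free (q w).
Proof.
case=> Gw fill p r k B wp.
have fM : {morph (iota2 \o sub2 p r) : s t / s * t}.
  by move=> s t; rewrite /= sub2M iota2M.
have fI : injective (iota2 \o sub2 p r).
  by apply: inj_comp; [apply: can_inj iota2K|apply: bij_inj].
have := free_product_subset fM fI (pred1 false).
have -> : range (iota2 \o sub2 p r) = gen [set gb; gc].
  rewrite gen_bcE; apply/seteqP; split=> [_ [s _ <-]|_ [s _ <-]]; first by exists (sub2 p r s).
  by case: B => psi K Ki; exists (psi s); rewrite //= Ki.
set A := (X in is_free_product _ X _) => FP.
apply: (fill A).
  split; first by eexists; exact: FP.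
  move=> AE; have : A (iota2 (sub2 p r c2)).
    by rewrite AE gen_bcE; exists (sub2 p r c2).
  by case=> s Hs /fI sc; move: Hs; rewrite sc.
exists (b2 ^+ k); last by rewrite /= (homX (sub2M p r)) sub2b -wp iota2_q.
apply: (@subgroupX _ [set s : F2 | word_over (T := bool) (pred1 false) s]) => //.
exact: subgroup_word_over.
Qed.

(** ** The commutator of b and c is filling *)

(** The Heisenberg group over the rationals. *)
Definition heis := (rat * rat * rat)%type.
HB.instance Definition _ := Choice.on heis.

Definition heis_mul (x y : heis) : heis :=
  (x.1.1 + y.1.1, x.1.2 + y.1.2, x.2 + y.2 + x.1.1 * y.1.2)%R.
Definition heis_one : heis := (0, 0, 0)%R.
Definition heis_inv (x : heis) : heis :=
  (- x.1.1, - x.1.2, - x.2 + x.1.1 * x.1.2)%R.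

Fact heis_mulA : associative heis_mul.
Proof.
by move=> [[a b] c] [[a' b'] c'] [[a'' b''] c'']; rewrite /heis_mul /=; congr (_, _, _); ring.
Qed.
Fact heis_mul1g : left_id heis_one heis_mul.
Proof. by move=> [[a b] c]; rewrite /heis_mul /=; congr (_, _, _); ring. Qed.
Fact heis_mulg1 : right_id heis_one heis_mul.
Proof. by move=> [[a b] c]; rewrite /heis_mul /=; congr (_, _, _); ring. Qed.
Fact heis_mulVg : left_inverse heis_one heis_inv heis_mul.
Proof. by move=> [[a b] c]; rewrite /heis_mul /=; congr (_, _, _); ring. Qed.
Fact heis_mulgV : right_inverse heis_one heis_inv heis_mul.
Proof. by move=> [[a b] c]; rewrite /heis_mul /=; congr (_, _, _); ring. Qed.
HB.instance Definition _ :=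
  isGroup.Build heis heis_mulA heis_mul1g heis_mulg1 heis_mulVg heis_mulgV.

Lemma heisM (x y : heis) : x * y = heis_mul x y. Proof. by []. Qed.
Lemma heisV (x : heis) : x^-1 = heis_inv x. Proof. by []. Qed.

Definition to_heis : F3 -> heis :=
  fg_lift (fun i : 'I_3 => if i == ord0 then heis_one : heis
     else if i == ord_max then (0, 1, 0)%R : heis else (1, 0, 0)%R : heis).

Lemma to_heis_ab x :
  (to_heis x).1.1 = ab x ord0 (inord 1) /\ (to_heis x).1.2 = ab x ord0 ord_max.
Proof.
have hM : {morph to_heis : s t / s * t} by apply: fg_liftM.
have nz : (ord_max == ord0 :> 'I_3) = false by [].
have ab_comp (j : 'I_3) : (fun s : F3 => ab s ord0 j) =1 add_lift (fun i : 'I_3 => (i == j)%:R%R : rat).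
  apply: add_hom_ext => [s t|i]; first by rewrite abM mxE.
  by rewrite /ab add_lift_gen mxE eqxx eq_sym.
split; rewrite ab_comp; move: x; apply: add_hom_ext => [s t|i]; rewrite ?hM //;
  rewrite /to_heis fg_lift_gen; case: (I3P i) => -> /=;
  by rewrite ?inord1_neq0 ?inord1_neqmax ?nz ?eqxx // [_ == inord 1]eq_sym ?inord1_neq0 ?inord1_neqmax.
Qed.

(** The commutator of two elements is central in the Heisenberg group, with a 2 x 2 minor
    of exponent sums as coordinate. *)
Lemma to_heis_comm x y : (to_heis [~ x, y]).2 =
  (ab x ord0 (inord 1) * ab y ord0 ord_max - ab x ord0 ord_max * ab y ord0 (inord 1))%R.
Proof.
have hM : {morph to_heis : s t / s * t} by apply: fg_liftM.
have [<- <-] := to_heis_ab x; have [<- <-] := to_heis_ab y.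
rewrite /commg /conjg !hM !(homV hM); case: (to_heis x) (to_heis y) => [[a b] c] [[a' b'] c'].
by rewrite !heisM !heisV /heis_mul /heis_inv /=; ring.
Qed.

(** If a proper free factor A of <b, c> contains [b, c] then a retraction f to A maps
    [b, c] = [f b, f c] to itself, so that the minor of f b and f c is that of b and c,
    which is 1; but A has rank at most one, and the minor vanishes. *)
Lemma filling_commutator : filling (gen [set gb; gc]) [~ gb, gc].
Proof.
have gG := subgroup_gen [set gb; gc]; have [G1 GM GV] := gG.
have Gb : gen [set gb; gc] gb by apply: sub_gen; left.
have Gc : gen [set gb; gc] gc by apply: sub_gen; right.
split; first exact: (GM _ _ (GV _ Gb) (GM _ _ (GV _ Gc) (GM _ _ Gb Gc))).
move=> A [[C FP] AG] Aw.
have Bbca : basis3 gb gc ga by apply/basis3_swap23/basis3_swap/basis3_std.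
have [_ [phi rG rkG]] := rank_of_member (rank2 Bbca) (conj_class_refl _).
have [phiM phiG phiK] := rG.
have [r [rM rA rK _]] := free_product_retraction FP.
have AGs := free_product_sub FP.
pose f := r \o phi.
have fM : {morph f : s t / s * t} by move=> s t; rewrite /f /= phiM rM.
have rf : retract f A.
  split=> // [s|s As]; first exact: (rA _ (phiG s)).
  by rewrite /f /= phiK ?rK //; apply: AGs.
have rkf : (\rank (abmx f) <= 1)%N.
  rewrite leqNgt; apply/negP => rk; apply: AG; apply: (retract_eq rf rG) => //.
  by rewrite rkG.
have fw : f [~ gb, gc] = [~ gb, gc] by case: rf => _ _; apply.
have absub s : (ab (f s) <= abmx f)%MS by rewrite ab_hom // submxMl.
have := to_heis_comm gb gc; rewrite -{1}fw.
have -> : f [~ gb, gc] = [~ f gb, f gc] by rewrite /commg fM (homV fM) (homJ fM).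
rewrite to_heis_comm.
have -> : (ab gb ord0 (inord 1) * ab gc ord0 ord_max
    - ab gb ord0 ord_max * ab gc ord0 (inord 1) = 1 :> rat)%R.
  by rewrite /ab !add_lift_gen !mxE !eqxx [_ == inord 1]eq_sym inord1_neqmax /= mulr0 subr0 mulr1.
have [ab0|ab0] := eqVneq (ab (f gb)) 0%R.
  by rewrite ab0 !mxE !mul0r subrr => /eqP; rewrite eq_sym oner_eq0.
have : (ab (f gc) <= ab (f gb))%MS.
  apply: submx_trans (absub gc) _.
  rewrite -(mxrank_leqif_sup (absub gb)) eqn_leq mxrankS //=.
  by rewrite rank_rV ab0.
case/sub_rVP=> k ->; rewrite !mxE => /eqP; rewrite (_ : _ - _ = 0)%R; last by ring.
by rewrite eq_sym oner_eq0.
Qed.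

End Distances.

(** * Triangulations of the disc *)

Section LinearForm.
Local Open Scope classical_set_scope.
Local Open Scope ring_scope.

Lemma linear_form_continuous (R : realType) n (c : 'I_n -> R) :
  continuous (fun x : 'rV[R]_n => \sum_i x 0 i * c i).
Proof.
elim: (index_enum _) => [|i r IHr].
  have -> : (fun x : 'rV[R]_n => \sum_(i <- [::]) x 0 i * c i) = fun=> 0.
    by apply: funext => x; rewrite big_nil.
  exact: cst_continuous.
have -> : (fun x : 'rV[R]_n => \sum_(i <- i :: r) x 0 i * c i) =
    (fun x => x 0 i * c i + \sum_(i <- r) x 0 i * c i).
  by apply: funext => x; rewrite big_cons.
move=> x; have cx : (fun y : 'rV[R]_n => y 0 i * c i) y @[y --> nbhs x] --> x 0 i * c i.
  exact: (@cvgM _ _ (nbhs x) _ (fun y : 'rV[R]_n => y 0 i) (fun=> c i) _ _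
    (@coord_continuous R 1 n 0 i x) (cvg_cst _)).
exact: (@cvgD R R _ (nbhs x) _ (fun y : 'rV[R]_n => y 0 i * c i) _ _ _ cx (IHr x)).
Qed.

End LinearForm.

Section Barycentric.
Local Open Scope classical_set_scope.
Local Open Scope ring_scope.
Variables (R : realType) (E : topologicalType) (X : set E) (P : triangulation R X).

Lemma std_vertex n (i : 'I_n.+1) : @std_simplex R n (delta_mx 0 i).
Proof.
split=> [j|]; first by rewrite mxE; case: eqP => // _; case: eqP.
rewrite (bigD1 i) //= mxE !eqxx big1 ?addr0 // => j ji; rewrite mxE eqxx.
by rewrite (negbTE ji).
Qed.

Lemma affine_vertex m n (f : 'I_m.+1 -> 'I_n.+1) k :
  affine_face f (delta_mx 0 k) = delta_mx 0 (f k) :> 'rV[R]_n.+1.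
Proof.
apply/rowP => j; rewrite !mxE eqxx /= [j == f k]eq_sym; case: eqP => [fk|fk].
  rewrite (bigD1 k) ?fk //= mxE !eqxx big1 ?addr0 // => i /andP[_ ik].
  by rewrite mxE eqxx (negbTE ik).
rewrite big1 // => i /eqP fi; rewrite mxE eqxx /=; case: eqP => // ik.
by case: fk; rewrite -fi ik.
Qed.

Lemma const1_delta : const_mx 1 = delta_mx 0 ord0 :> 'rV[R]_1.
Proof. by apply/rowP => i; rewrite !mxE ord1. Qed.

Lemma vertex_exists n (s : cell P n) i :
  exists v : cell P 0, vertex_point v = char_map s (delta_mx 0 i).
Proof.
have inj : injective (fun _ : 'I_1 => i) by move=> a b _; rewrite !ord1.
have [t [g H]] := char_face s inj; exists t.
have := H (delta_mx 0 ord0) (std_vertex _); rewrite !affine_vertex => ->.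
by rewrite /vertex_point const1_delta [g ord0]ord1.
Qed.

Definition vert n (s : cell P n) (i : 'I_n.+1) : cell P 0 := projT1 (cid (vertex_exists s i)).

Lemma vertP n (s : cell P n) i : vertex_point (vert s i) = char_map s (delta_mx 0 i).
Proof. exact: (projT2 (cid (vertex_exists s i))). Qed.

Variable phi : cell P 0 -> R.

Definition bary (u : {n : nat & (cell P n * 'rV[R]_n.+1)%type}) : R :=
  \sum_i (tagged u).2 0 i * phi (vert (tagged u).1 i).

(** The extension of phi that is affine on the simplices: p lies in one open simplex, with
    unique barycentric coordinates u, and xget selects the single resulting value. *)
Definition ext (p : E) : R :=
  xget 0 [set r | exists u, (open_simplex (tagged u).2 /\
    char_map (tagged u).1 (tagged u).2 = p) /\ r = bary u].

Lemma open_std n (x : 'rV[R]_n.+1) : open_simplex x -> std_simplex x.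
Proof. by case=> x0 x1; split=> // i; apply: ltW. Qed.

Lemma ext_open n (s : cell P n) x : open_simplex x ->
  ext (char_map s x) = \sum_i x 0 i * phi (vert s i).
Proof.
move=> ox; have [u0 [Hu0 uniq]] := char_partition P (char_in s (open_std ox)).
pose u := Tagged (fun n => (cell P n * 'rV[R]_n.+1)%type) (s, x).
have u0E : u0 = u by apply: uniq.
rewrite /ext; apply: xget_unique; first by exists u.
by move=> r [u' [Hu' ->]]; rewrite -(uniq _ Hu') u0E.
Qed.

Lemma open_point : @open_simplex R 0 (const_mx 1).
Proof. by split=> [i|]; rewrite ?big_ord1 mxE. Qed.

Lemma ext_vertex v : ext (vertex_point v) = phi v.
Proof.
have -> : phi v = phi (vert v ord0).
  have e1 : vertex_point (vert v ord0) = vertex_point v.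
    by rewrite vertP /vertex_point const1_delta.
  have [u0 [_ uniq]] := char_partition P (char_in v (open_std open_point)).
  pose t w := Tagged (fun n => (cell P n * 'rV[R]_n.+1)%type) (w : cell P 0, const_mx 1 : 'rV[R]_1).
  have t1 := uniq (t v) (conj open_point erefl).
  have t2 := uniq (t (vert v ord0)) (conj open_point e1).
  rewrite t1 in t2.
  pose F (u : {n : nat & (cell P n * 'rV[R]_n.+1)%type}) : R :=
    match u with existT 0%N c => phi c.1 | _ => 0 end.
  by have := congr1 F t2.
by rewrite /vertex_point ext_open ?big_ord1 ?mxE ?mul1r //; exact: open_point.
Qed.

Lemma phi_vert n (s : cell P n) i : phi (vert s i) = ext (char_map s (delta_mx 0 i)).
Proof. by rewrite -vertP ext_vertex. Qed.

(** On each closed simplex the extension is affine: a point of the boundary lies in an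
    open face, whose vertices are vertices of the simplex. *)
Lemma ext_char n (s : cell P n) x : std_simplex x ->
  ext (char_map s x) = \sum_i x 0 i * phi (vert s i).
Proof.
move=> [x0 x1]; pose S := [pred i | 0 < x 0 i].
have SE : \sum_(i in S) x 0 i = 1.
  rewrite -x1 [RHS](bigID (mem S)) /= [X in _ = _ + X]big1 ?addr0 // => i.
  by rewrite inE -leNgt => xi; apply: le_anti; rewrite xi x0.
case cS : #|S| => [|m].
  by move: SE; rewrite big_pred0 => [/esym/eqP|i]; [rewrite oner_eq0|apply: card0_eq cS i].
pose f (k : 'I_m.+1) : 'I_n.+1 := enum_val (cast_ord (esym cS) k).
have finj : injective f by move=> a b /enum_val_inj/cast_ord_inj.
have sumS (F : 'I_n.+1 -> R) : \sum_(i in S) F i = \sum_k F (f k).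
  rewrite (big_enum_val (A := S)) (reindex (cast_ord (esym cS))) //=.
  exists (cast_ord cS) => k _; [exact: cast_ordKV|exact: cast_ordK].
pose y : 'rV[R]_m.+1 := \row_k x 0 (f k).
have oy : open_simplex y.
  split=> [k|]; first by rewrite mxE; have := enum_valP (cast_ord (esym cS) k); rewrite inE.
  by rewrite -SE sumS; apply: eq_bigr => k _; rewrite mxE.
have xE : x = affine_face f y.
  apply/rowP => j; rewrite mxE; under eq_bigr do rewrite mxE.
  have [jS|jS] := boolP (j \in S).
    have [k jE] : exists k, f k = j.
      exists (cast_ord cS (enum_rank_in jS j)); rewrite /f cast_ordK.
      exact: enum_rankK_in.
    rewrite (bigD1 k) ?jE //= big1 ?addr0 // => k' /andP[/eqP fk' kk'].
    by case/eqP: kk'; apply: finj; rewrite fk' jE.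
  rewrite big1 => [|k /eqP fk].
    by move: jS; rewrite inE -leNgt => xj; apply: le_anti; rewrite xj x0.
  by case/negP: jS; rewrite -fk; apply: enum_valP.
have [t [g H]] := char_face s finj.
have og : open_simplex (affine_face g y).
  case: oy => y0 y1; have E1 j : affine_face g y 0 j = y 0 ((g^-1)%g j).
    rewrite mxE (bigD1 ((g^-1)%g j)) ?permKV //= big1 ?addr0 // => k /andP[/eqP gk kj].
    by case/eqP: kj; rewrite -gk permK.
  split=> [j|]; first by rewrite E1.
  by rewrite -y1 [RHS](reindex_perm (g^-1)%g) /=; apply: eq_bigr => j _; rewrite E1.
have vE k : phi (vert t (g k)) = phi (vert s (f k)).
  rewrite !phi_vert -(affine_vertex g) -(affine_vertex f) H //; exact: std_vertex.
have -> : char_map s x = char_map t (affine_face g y) by rewrite {1}xE H //; exact: open_std.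
rewrite ext_open //.
transitivity (\sum_k y 0 k * phi (vert s (f k))).
  rewrite (reindex_perm g) /=; apply: eq_bigr => k _; rewrite vE; congr (_ * _).
  rewrite mxE (bigD1 k) //= big1 ?addr0 // => j /andP[/eqP/perm_inj -> ]; by rewrite eqxx.
rewrite [RHS](bigID (mem S)) /= [X in _ = _ + X]big1 ?addr0 => [|i].
  by rewrite (sumS (fun i => x 0 i * phi (vert s i))); apply: eq_bigr => k _; rewrite mxE.
rewrite inE -leNgt => xi; have -> : x 0 i = 0 by apply: le_anti; rewrite xi x0.
by rewrite mul0r.
Qed.

Lemma X_char p : X p -> exists n (s : cell P n) x, open_simplex x /\ p = char_map s x.
Proof.
move=> /(char_partition P)[[n [s x]] [[ox pE] _]]; by exists n, s, x.
Qed.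

Lemma cell_le2 n (s : cell P n) : (n <= 2)%N.
Proof.
rewrite leqNgt; apply/negP => /(cell_dim P) c0.
by have := card0_eq c0 s; rewrite inE.
Qed.

Hypothesis hausE : hausdorff_space E.

(** The extension is continuous: the set of points of X where it differs from a given
    value by at least e is a finite union of images of compact sets. *)
Lemma ext_continuous p e : X p -> 0 < e ->
  \forall q \near p, X q -> `|ext q - ext p| < e.
Proof.
move=> Xp e0.
pose L n (s : cell P n) (x : 'rV[R]_n.+1) := \sum_i x 0 i * phi (vert s i).
have Lc n (s : cell P n) : continuous (L n s).
  exact: (@linear_form_continuous R n.+1 (fun i => phi (vert s i))).
pose Z n (s : cell P n) := [set x : 'rV[R]_n.+1 | forall i, `[0, 1]%classic (x ord0 i)] `&`
  ([set x : 'rV[R]_n.+1 | \sum_i x 0 i * 1 = 1] `&` [set x : 'rV[R]_n.+1 | e <= `|L n s x - ext p|]).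
have Zstd n (s : cell P n) : Z n s `<=` @std_simplex R n.
  move=> x [x01 [/= x1 _]]; split=> [i|]; first by have := x01 i; rewrite /= in_itv => /andP[].
  by rewrite -[RHS]x1; apply: eq_bigr => i _; rewrite mulr1.
have Zc n (s : cell P n) : compact (Z n s).
  apply: compact_closedI; first exact: (@rV_compact R n.+1 (fun=> `[0, 1]%classic) (fun=> @segment_compact R 0 1)).
  apply: closedI.
    have /continuous_closedP H : continuous (fun x : 'rV[R]_n.+1 => \sum_i x 0 i * (1 : R)).
      exact: (@linear_form_continuous R n.+1 (fun=> 1)).
    exact: (H [set y | y = 1] (@closed_eq R 1)).
  have /continuous_closedP H : continuous (fun x : 'rV[R]_n.+1 => `|L n s x - ext p|).
    move=> x; have cx : (fun y => L n s y - ext p) y @[y --> nbhs x] --> L n s x - ext p.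
      exact: (@cvgB R R _ (nbhs x) _ (L n s) (fun=> ext p) _ _
        (Lc n s x) (cvg_cst _)).
    exact: (@cvg_norm R R _ (nbhs x) _ (fun y => L n s y - ext p) _ cx).
  exact: (H [set y | e <= y] (@closed_ge R e)).
pose K n := \big[setU/set0]_(s : cell P n) (char_map s @` Z n s).
have Kc n : compact (K n).
  apply: bigsetU_compact => s _; apply: continuous_compact (Zc n s).
  move: (@char_continuous R E X P n s); apply: continuous_subspaceW; exact: Zstd.
have KU : compact (K 0%N `|` K 1%N `|` K 2%N).
  exact: (compactU (compactU (Kc 0%N) (Kc 1%N)) (Kc 2%N)).
have npK : ~ (K 0%N `|` K 1%N `|` K 2%N) p.
  have H n : ~ K n p.
    rewrite /K -bigcup_seq => -[s _ [x Zx xp]].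
    have [_ [_ /=]] := Zx; rewrite -xp ext_char; last exact: (Zstd _ _ _ Zx).
    by rewrite /L subrr normr0 leNgt e0.
  by move=> [[|]|]; apply: H.
have : nbhs p (~` (K 0%N `|` K 1%N `|` K 2%N)).
  apply: open_nbhs_nbhs; split=> //; rewrite openC; exact: compact_closed.
apply: filterS => q nK Xq; rewrite ltNge; apply/negP => eq.
have [n [s [x [ox qE]]]] := X_char Xq; have [x0 x1] := open_std ox.
have KX : K n q.
  rewrite /K -bigcup_seq; exists s; first by rewrite /= mem_index_enum.
  exists x => //; split=> [i /=|]; last split=> /=.
  - rewrite in_itv /= x0 -x1 (bigD1 i) //= lerDl; apply: sumr_ge0 => j _; exact: x0.
  - by rewrite -[RHS]x1; apply: eq_bigr => i _; rewrite mulr1.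
  - by move: eq; rewrite qE ext_char.
have := cell_le2 s; case: n s x ox qE x0 x1 KX => [|[|[|n]]] s x ox qE x0 x1 KX // _; apply: nK.
- by left; left.
- by left; right.
- by right.
Qed.

End Barycentric.

(** * Crossings of a half-line by a grid *)

Section Signs.
Local Open Scope ring_scope.
Variable R : realFieldType.

Lemma sign_near (d x y : R) : 0 < d -> 4 * d <= `|x| -> `|x - y| < 2 * d ->
  (0 < x) = (0 < y).
Proof.
move=> d0 + /ltr_normlP[].
case: (ler0P x) => x0 far ? ?; last by apply/esym; lra.
by apply/esym/negbTE; rewrite -leNgt; lra.
Qed.

Lemma lt_double (x d : R) : 0 < d -> x < d -> x < 2 * d.
Proof. by move=> ? ?; lra. Qed.

Lemma dist_double (d x y z : R) : `|x - y| < d -> `|y - z| < d -> `|x - z| < 2 * d.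
Proof.
by move=> xy yz; apply: le_lt_trans (ler_distD y _ _) _; lra.
Qed.

End Signs.

Section Parity.
Local Open Scope ring_scope.
Variables (R : realFieldType) (d : R) (f1 f2 : nat -> nat -> R) (m n : nat).

Definition near_pt i j i' j' k := `|f1 i j - f1 i' j'| < k /\ `|f2 i j - f2 i' j'| < k.

Hypotheses (d0 : 0 < d)
  (away : forall i j, (i <= m)%N -> (j <= n)%N -> 4 * d <= `|f1 i j| \/ 4 * d <= `|f2 i j|)
  (hor : forall i j, (i <= m)%N -> (j < n)%N -> near_pt i j i j.+1 d)
  (ver : forall i j, (i < m)%N -> (j <= n)%N -> near_pt i j i.+1 j d)
  (per1 : forall i, (i <= m)%N -> f1 i n = f1 i 0%N)
  (per2 : forall i, (i <= m)%N -> f2 i n = f2 i 0%N)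
  (base : forall j, (j <= n)%N -> f2 0%N j = f2 0%N 0%N).

(** The step from (i, j) to (i', j') crosses the positive first axis; the sign of f1 may be
    tested at the start, as f1 keeps its sign along a step across that axis. *)
Definition crosses i j i' j' := ((0 < f2 i j) (+) (0 < f2 i' j')) && (0 < f1 i j).

(** One of f1 and f2 is large at the corner (i, j) and keeps its sign on the square.  If it
    is f2 there is no crossing; if it is f1, the crossings are the sign changes of f2
    around the square, or none. *)
Lemma square_crossing i j : (i < m)%N -> (j < n)%N ->
  crosses i j i j.+1 (+) crosses i j.+1 i.+1 j.+1 =
  crosses i j i.+1 j (+) crosses i.+1 j i.+1 j.+1.
Proof.
move=> im jn.
have [h1 h2] := hor (ltnW im) jn; have [v1 v2] := ver im (ltnW jn).
have [_ w2] := ver im jn.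
rewrite /crosses.
have same : (0 < f1 i j) = (0 < f1 i j.+1) /\ (0 < f1 i j) = (0 < f1 i.+1 j) \/
    (0 < f2 i j) = (0 < f2 i j.+1) /\ (0 < f2 i j) = (0 < f2 i.+1 j)
      /\ (0 < f2 i j) = (0 < f2 i.+1 j.+1).
  case: (away (ltnW im) (ltnW jn)) => far; [left|right].
    by split; apply: (sign_near d0) => //; apply: (lt_double d0).
  by do !split; apply: (sign_near d0) => //; [apply: (lt_double d0)|apply: (lt_double d0)|apply: dist_double h2 w2].
case: same => [[<- <-]|[<- [<- <-]]]; last by rewrite addbb.
by case: (0 < f1 i j); rewrite ?andbF // !andbT; do 4 case: (_ < _).
Qed.

Lemma row_crossing i : (i < m)%N ->
  \big[addb/false]_(j < n) crosses i j i j.+1 = \big[addb/false]_(j < n) crosses i.+1 j i.+1 j.+1.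
Proof.
move=> im.
have xor_step (S S' e0 ek ek1 x y : bool) : S (+) ek = e0 (+) S' ->
    x (+) ek1 = ek (+) y -> (S (+) x) (+) ek1 = e0 (+) (S' (+) y).
  by case: S; case: S'; case: e0; case: ek; case: ek1; case: x; case: y.
have H k : (k <= n)%N -> \big[addb/false]_(j < k) crosses i j i j.+1 (+) crosses i k i.+1 k =
    crosses i 0%N i.+1 0%N (+) \big[addb/false]_(j < k) crosses i.+1 j i.+1 j.+1.
  elim: k => [|k IHk] kn; first by rewrite !big_ord0 addbF.
  have := square_crossing im kn; have := IHk (ltnW kn); rewrite 2!big_ord_recr /=.
  exact: xor_step.
have := H n (leqnn n); rewrite {2}/crosses !per1 ?per2 // ?(ltnW im) // -/(crosses i 0 i.+1 0).
by rewrite addbC; apply: addbI.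
Qed.

(** The parity of crossings is the same for all rows, since the two sides of the grid are
    identified, and row 0 is a single point as far as f2 is concerned. *)
Lemma even_crossings : \big[addb/false]_(j < n) crosses m j m j.+1 = false.
Proof.
have H k : (k <= m)%N -> \big[addb/false]_(j < n) crosses k j k j.+1 = false.
  elim: k => [|k IHk] km; last by rewrite -row_crossing // IHk // ltnW.
  rewrite big1 // => j _; rewrite /crosses (base (ltnW (ltn_ord j))) (base (ltn_ord j)).
  by rewrite addbb.
exact: H.
Qed.

End Parity.

Section Uniform.
Local Open Scope classical_set_scope.
Local Open Scope ring_scope.
Variable R : realType.

Definition square : set (R * R) := `[0, 1] `*` `[0, 1].

Lemma compact_square : compact square.
Proof. by apply: compact_setX; apply: segment_compact. Qed.

(** Heine-Cantor, for a function that is continuous relative to the square. *)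
Lemma uniform_on_square (g : R * R -> R) (e : R) :
    (forall x e, square x -> 0 < e -> \forall z \near x, square z -> `|g z - g x| < e) ->
    0 < e ->
  exists2 d, 0 < d & forall z z', square z -> square z' ->
    `|z.1 - z'.1| < d -> `|z.2 - z'.2| < d -> `|g z - g z'| < e.
Proof.
move=> gc e0.
pose good (z : R * R) (d : R) := square z -> forall z', square z' ->
  `|z.1 - z'.1| < d -> `|z.2 - z'.2| < d -> `|g z - g z'| < e.
have H : \forall d \near 0^'+, square `<=` good^~ d.
  apply: ((compact_near_coveringP _).1 compact_square R (0^'+) (fun d z => good z d)) => x Sx.
  have e2 : 0 < e / 2 by rewrite divr_gt0.
  have /nbhs_ballP[r /= r0 Hr] := gc x (e / 2) Sx e2.
  have r2 : 0 < r / 2 by rewrite divr_gt0.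
  exists (ball x (r / 2), [set d | d < r / 2]); first split => /=.
  - by apply/nbhs_ballP; exists (r / 2).
  - exact: nbhs_right_lt.
  move=> [z d] /= [zx dr] Sz z' Sz' z1 z2.
  have Bz : ball x r z by apply: le_ball zx; lra.
  have Bz' : ball x r z'.
    rewrite (splitr r); apply: (ball_triangle zx).
    by split; rewrite /ball /=; [apply: lt_trans z1 dr|apply: lt_trans z2 dr].
  have := Hr _ Bz Sz; have := Hr _ Bz' Sz'; rewrite !ltr_norml => /andP[? ?] /andP[? ?].
  by apply/andP; split; lra.
have [d [d0 Hd]] := filter_ex (filterI (nbhs_right_gt 0) H).
by exists d => // z z' Sz Sz'; apply: Hd.
Qed.

End Uniform.

(** * Polar coordinates *)

Section Crossing.
Local Open Scope classical_set_scope.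
Local Open Scope ring_scope.
Variable R : realType.

Definition polar (z : R * R) : R * R := (z.1 * cos (2 * pi * z.2), z.1 * sin (2 * pi * z.2)).

Lemma polar_continuous : continuous polar.
Proof.
have c2 (z : R * R) : (2 * pi * y.2) @[y --> z] --> 2 * pi * z.2.
  apply: (@cvgM _ _ (nbhs z) _ (fun=> 2 * pi) (fun y => y.2)); [exact: cvg_cst|exact: cvg_snd].
move=> z.
have cc : y.1 * cos (2 * pi * y.2) @[y --> z] --> z.1 * cos (2 * pi * z.2).
  apply: (@cvgM _ _ (nbhs z) _ (fun y => y.1) (fun y => cos (2 * pi * y.2))); first exact: cvg_fst.
  apply: (@cvg_comp _ _ _ (fun y : R * R => 2 * pi * y.2) cos _ _ _ (c2 z)).
  exact: continuous_cos.
have cs : y.1 * sin (2 * pi * y.2) @[y --> z] --> z.1 * sin (2 * pi * z.2).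
  apply: (@cvgM _ _ (nbhs z) _ (fun y => y.1) (fun y => sin (2 * pi * y.2))); first exact: cvg_fst.
  apply: (@cvg_comp _ _ _ (fun y : R * R => 2 * pi * y.2) sin _ _ _ (c2 z)).
  exact: continuous_sin.
exact: (cvg_pair cc cs).
Qed.

Lemma polar_disc z : square z -> @disc R (polar z).
Proof.
case=> /=; rewrite in_itv /= => /andP[z0 z1] _; rewrite /disc /polar /=.
by rewrite !exprMn -mulrDr cos2Dsin2 mulr1 expr_le1.
Qed.

Lemma polar1 t : polar (1, t) = circle_pt t.
Proof. by rewrite /polar /= !mul1r. Qed.

Lemma circle_ptD1 t : circle_pt (t + 1) = circle_pt t :> R * R.
Proof.
by rewrite /circle_pt mulrDr mulr1 [2 * pi]mulrC mulr_natr cosD2pi sinD2pi.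
Qed.

Variables (V : Type) (K : complex V) (c : 4.-tuple V) (P : triangulation R (@disc R))
  (h : cell P 0 -> V).
Hypothesis caps : @caps_off R V K 4 c P h.

Local Notation ext phi := (@ext R (R * R)%type (@disc R) P phi).

Lemma ext_polar_uniform (phi : cell P 0 -> R) e : 0 < e ->
  exists2 d, 0 < d & forall z z', square z -> square z' ->
    `|z.1 - z'.1| < d -> `|z.2 - z'.2| < d -> `|ext phi (polar z) - ext phi (polar z')| < e.
Proof.
move=> e0; apply: (@uniform_on_square R (fun z => ext phi (polar z))) => // x r Sx r0.
have hs : hausdorff_space (R * R)%type by exact: norm_hausdorff.
have Hn := polar_continuous (ext_continuous phi hs (polar_disc Sx) r0).
refine (@filterS _ (nbhs x) _ _ _ _ Hn) => z H Sz; exact: (H (polar_disc Sz)).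
Qed.

(** The arcs of the boundary are edges on which the extension is affine. *)
Lemma ext_arc (phi : V -> R) (i : 'I_4) t : 0 <= t <= 1 ->
  ext (phi \o h) (circle_pt ((i%:R + t) / 4%:R)) =
    (1 - t) * phi (tnth c i) + t * phi (tnth c (ordS i)).
Proof.
move=> /andP[t0 t1]; have [_ arcs] := caps.
have [[v [vE hv]] [e He]] := arcs i; have [[w [wE hw]] _] := arcs (ordS i).
have e0 : phi (h (vert e ord0)) = phi (tnth c i).
  rewrite -[phi _]/((phi \o h) _) phi_vert He; last exact: std_vertex.
  by rewrite mxE /= addr0 -vE ext_vertex /= hv.
have e1 : phi (h (vert e ord_max)) = phi (tnth c (ordS i)).
  rewrite -[phi _]/((phi \o h) _) phi_vert He; last exact: std_vertex.
  rewrite mxE !eqxx /= -hw -[phi (h w)]/((phi \o h) w) -ext_vertex wE.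
  rewrite natr1; congr (ext _ _); have [i3|i3] := ltnP i.+1 4; first by rewrite /= modn_small.
  have i4 : i.+1 = 4 by apply/eqP; rewrite eqn_leq ltn_ord.
  rewrite (_ : ordS i = 0%N :> nat); last by rewrite /= i4.
  by rewrite mul0r i4 -(circle_ptD1 0) add0r divff // pnatr_eq0.
pose x : 'rV[R]_2 := \row_j (if j == ord0 then 1 - t else t).
have xs : std_simplex x.
  split=> [j|]; first by rewrite mxE; case: ifP => _; lra.
  by rewrite big_ord_recl big_ord1 !mxE /= subrK.
have -> : t = x 0 ord_max by rewrite mxE.
rewrite -He // ext_char // big_ord_recl big_ord1 /=.
rewrite (_ : lift ord0 ord0 = ord_max); last exact: val_inj.
by rewrite e0 e1 !mxE.
Qed.

End Crossing.

(** * Four labels on a disc *)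

Section Estimates.
Local Open Scope ring_scope.
Variable R : realFieldType.

(** If a = 0 then o + bc and b - c are both small only if o is small and b and c are close
    to 1/2, when bc is close to 1/4.  If a is nonzero then o = 0 and bc = 0, so that a and
    the other one of b and c are both small, although their sum is 1. *)
Lemma away_origin (a b c o : R) : 0 <= a -> 0 <= b -> 0 <= c -> 0 <= o ->
  b + a + c + o = 1 -> a * o = 0 -> b * a * c = 0 ->
  4 * (1 / 64) <= `|o + b * c - a| \/ 4 * (1 / 64) <= `|b - c|.
Proof.
move=> a0 b0 c0 o0 sum ao bac.
have [|f1] := leP (4 * (1 / 64)) `|o + b * c - a|; first by left.
have [|f2] := leP (4 * (1 / 64)) `|b - c|; [by right|exfalso].
move: f1 f2; rewrite !ltr_norml => /andP[f1 f1'] /andP[f2 f2'].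
have bc0 := mulr_ge0 b0 c0.
have [a1|a1] := eqVneq a 0.
  have b1 : 7 / 16 <= b by lra.
  have c1 : 7 / 16 <= c by lra.
  have := ler_pM _ _ b1 c1; lra.
have o1 : o = 0 by move/eqP: ao; rewrite mulf_eq0 (negbTE a1) => /eqP.
have bc : b * c = 0.
  by move/eqP: bac; rewrite mulrAC mulf_eq0 (negbTE a1) orbF => /eqP.
move/eqP: (bc); rewrite mulf_eq0 => /orP[] /eqP; lra.
Qed.

Lemma mul_near (b c b' c' e : R) : 0 <= b -> b <= 1 -> 0 <= c' -> c' <= 1 ->
  `|b - b'| < e -> `|c - c'| < e -> `|b * c - b' * c'| < 2 * e.
Proof.
move=> b0 b1 c0 c1 be ce.
have -> : b * c - b' * c' = b * (c - c') + (b - b') * c' by ring.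
apply: le_lt_trans (ler_normD _ _) _; rewrite !normrM (ger0_norm b0) (ger0_norm c0).
have := ler_wpM2r (normr_ge0 (c - c')) b1; have := ler_wpM2l (normr_ge0 (b - b')) c1.
lra.
Qed.

Lemma f1_near (a b c o a' b' c' o' e : R) : 0 <= b -> b <= 1 -> 0 <= c' -> c' <= 1 ->
  `|a - a'| < e -> `|b - b'| < e -> `|c - c'| < e -> `|o - o'| < e ->
  `|(o + b * c - a) - (o' + b' * c' - a')| < 4 * e.
Proof.
move=> b0 b1 c0 c1 ae be ce; have := mul_near b0 b1 c0 c1 be ce; move: ae.
by rewrite !ltr_norml => /andP[? ?] /andP[? ?] /andP[? ?]; apply/andP; split; lra.
Qed.

Lemma f2_near (b c b' c' e : R) : `|b - b'| < e -> `|c - c'| < e ->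
  `|(b - c) - (b' - c')| < 4 * e.
Proof.
by rewrite !ltr_norml => /andP[? ?] /andP[? ?]; apply/andP; split; lra.
Qed.

End Estimates.

Section Labels.
Local Open Scope classical_set_scope.
Local Open Scope ring_scope.
Variables (R : realType) (l : nat -> R * R -> R).

Hypotheses
  (unif : forall i e, (i < 4)%N -> 0 < e -> exists2 d, 0 < d &
    forall z z', square z -> square z' ->
    `|z.1 - z'.1| < d -> `|z.2 - z'.2| < d -> `|l i z - l i z'| < e)
  (pos : forall i z, (i < 4)%N -> square z -> 0 <= l i z)
  (sum1 : forall z, square z -> l 0 z + l 1 z + l 2 z + l 3 z = 1)
  (edge13 : forall z, square z -> l 1 z * l 3 z = 0)
  (triangle012 : forall z, square z -> l 0 z * l 1 z * l 2 z = 0)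
  (centre : forall i t, l i (0, t) = l i (0, 0))
  (closing : forall i r, l i (r, 1) = l i (r, 0))
  (boundary : forall i j t, (i < 4)%N -> (j < 4)%N -> 0 <= t <= 1 ->
    l j (1, (i%:R + t) / 4%:R) =
      (1 - t) * (j == i)%:R + t * (j == i.+1 %% 4)%N%:R).

(** Weights concentrated on the labels 0, 1, 2, 3 are sent to the points (0, 1), (-1, 0),
    (0, -1), (1, 0), and the product in f1 keeps the edge of 0 and 2 off the origin. *)
Let f1 z := l 3 z + l 0 z * l 2 z - l 1 z.
Let f2 z := l 0 z - l 2 z.

Lemma uniform_labels e : 0 < e -> exists2 d, 0 < d &
  forall i z z', (i < 4)%N -> square z -> square z' ->
    `|z.1 - z'.1| < d -> `|z.2 - z'.2| < d -> `|l i z - l i z'| < e.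
Proof.
move=> e0; have [d0 d00 H0] := @unif 0 e isT e0; have [d1 d10 H1] := @unif 1 e isT e0.
have [d2 d20 H2] := @unif 2 e isT e0; have [d3 d30 H3] := @unif 3 e isT e0.
exists (Num.min (Num.min d0 d1) (Num.min d2 d3)); first by rewrite !lt_min d00 d10 d20.
move=> i z z' i4 Sz Sz'; rewrite !lt_min => /andP[/andP[? ?] /andP[? ?]].
move=> /andP[/andP[? ?] /andP[? ?]]; case: i i4 => [|[|[|[|i]]]] // _.
- exact: H0.
- exact: H1.
- exact: H2.
- exact: H3.
Qed.

Lemma label_le1 i z : (i < 4)%N -> square z -> l i z <= 1.
Proof.
move=> i4 Sz; have := sum1 Sz.
have := @pos 0 _ isT Sz; have := @pos 1 _ isT Sz; have := @pos 2 _ isT Sz.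
have := @pos 3 _ isT Sz; case: i i4 => [|[|[|[|i]]]] // _ *; lra.
Qed.

Section Grid.
Variable k : nat.
Hypothesis k0 : (0 < k)%N.

Let n := (4 * k)%N.
Let pt i j : R * R := (i%:R / n%:R, j%:R / n%:R).

Lemma grid_square i j : (i <= n)%N -> (j <= n)%N -> square (pt i j).
Proof.
have n0 : (0 : R) < n%:R by rewrite ltr0n muln_gt0.
have H u : (u <= n)%N -> 0 <= (u%:R / n%:R : R) <= 1.
  by move=> un; rewrite divr_ge0 ?ler0n //= ler_pdivrMr // mul1r ler_nat.
by move=> im jn; split; rewrite /= in_itv /= H.
Qed.

Lemma boundary_label i j q : (i < 4)%N -> (j < 4)%N -> (q <= k)%N ->
  l j (pt n (i * k + q)) =
    (1 - q%:R / k%:R) * (j == i)%:R + (q%:R / k%:R) * (j == i.+1 %% 4)%N%:R.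
Proof.
move=> i4 j4 qk; have k00 : k%:R != 0 :> R by rewrite pnatr_eq0 -lt0n.
rewrite -boundary //; last first.
  by rewrite divr_ge0 ?ler0n //= ler_pdivrMr ?ltr0n // mul1r ler_nat.
congr (l j (_, _)); first by rewrite divff // pnatr_eq0 -lt0n muln_gt0.
by rewrite natrD !natrM; field; rewrite k00.
Qed.

(** On the four arcs f2 is positive, negative, negative, positive in turn. *)
Lemma boundary_sign j : (j <= n)%N -> (0 < f2 (pt n j)) = (j < k)%N || (3 * k < j)%N.
Proof.
move=> jn; have k00 : (0 : R) < k%:R by rewrite ltr0n.
have pt0 q : 0 <= q%:R / k%:R :> R by rewrite divr_ge0 ?ler0n.
have [jk|jk] := leqP j k.
  have := @boundary_label 0 0 j isT isT jk; have := @boundary_label 0 2 j isT isT jk.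
  rewrite /f2 => /= -> ->; rewrite /= !mulr0 mulr1 !addr0 subr0 subr_gt0.
  rewrite ltr_pdivrMr // mul1r ltr_nat; case: (j < k)%N => //=; lia.
have [jk2|jk2] := leqP j (2 * k).
  have jE : (j = 1 * k + (j - k))%N by lia.
  have qk : (j - k <= k)%N by lia.
  have := @boundary_label 1 0 _ isT isT qk; have := @boundary_label 1 2 _ isT isT qk.
  rewrite -jE /f2 => /= -> ->; rewrite /= !mulr0 mulr1 !add0r.
  rewrite oppr_gt0 ltNge pt0; lia.
have [jk3|jk3] := leqP j (3 * k).
  have jE : (j = 2 * k + (j - 2 * k))%N by lia.
  have qk : (j - 2 * k <= k)%N by lia.
  have := @boundary_label 2 0 _ isT isT qk; have := @boundary_label 2 2 _ isT isT qk.
  rewrite -jE /f2 => /= -> ->; rewrite /= !mulr0 mulr1 !addr0 add0r.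
  rewrite oppr_gt0 subr_lt0 ltr_pdivlMr // mul1r ltr_nat; lia.
have jE : (j = 3 * k + (j - 3 * k))%N by lia.
have qk : (j - 3 * k <= k)%N by lia.
have := @boundary_label 3 0 _ isT isT qk; have := @boundary_label 3 2 _ isT isT qk.
rewrite -jE /f2 => /= -> ->; rewrite /= !mulr0 mulr1 !add0r subr0.
rewrite divr_gt0 ?ltr0n ?subn_gt0 //; lia.
Qed.

(** The only crossing is at the beginning of the last arc, at (1, 0). *)
Lemma boundary_crossing j : (j < n)%N ->
  crosses (fun i j => f1 (pt i j)) (fun i j => f2 (pt i j)) n j n j.+1 = (j == 3 * k)%N.
Proof.
move=> jn; rewrite /crosses !boundary_sign // ?(ltnW jn) //.
have [jE|j3] := eqVneq j (3 * k)%N.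
  have f1E : f1 (pt n j) = 1.
    have lE i : (i < 4)%N -> l i (pt n j) = (i == 3)%:R.
      move=> i4; rewrite jE -[(3 * k)%N]addn0 boundary_label // !mul0r subr0 mul1r.
      by rewrite addr0.
    by rewrite /f1 !lE //= mul0r addr0 subr0.
  by rewrite f1E ltr01 andbT; lia.
have [jk|jk] := leqP k j; first by case: (0 < f1 _); lia.
suff -> : 0 < f1 (pt n j) = false by rewrite andbF.
have := @boundary_label 0 0 j isT isT (ltnW jk); have := @boundary_label 0 2 j isT isT (ltnW jk).
have := @boundary_label 0 1 j isT isT (ltnW jk); have := @boundary_label 0 3 j isT isT (ltnW jk).
rewrite /f1 => /= -> -> -> _; rewrite /= !mulr0 mulr1 !add0r mulr0 sub0r oppr_gt0.
by apply/negbTE; rewrite -leNgt divr_ge0 ?ler0n.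
Qed.

End Grid.

(** The map (f1, f2) avoids the origin (away_origin) and its last row, the boundary,
    crosses the positive axis once, contradicting even_crossings. *)
Lemma no_labels : False.
Proof.
have [d d0 Hd] := @uniform_labels (1 / 256) ltac:(by rewrite divr_gt0).
pose k := (Num.truncn (1 / d)).+1.
have kd : 1 / d < k%:R by apply: truncnS_gt.
pose n := (4 * k)%N.
have n0 : (0 : R) < n%:R by rewrite ltr0n muln_gt0.
have step j : `|j%:R / n%:R - j.+1%:R / n%:R| < d :> R.
  rewrite -mulrBl -natr1 opprD addNKr mulN1r normrN gtr0_norm ?invr_gt0 //.
  rewrite -[X in X < _]mul1r ltr_pdivrMr // mulrC -ltr_pdivrMr //.
  by apply: lt_le_trans kd _; rewrite ler_nat /n; lia.
pose pt i j : R * R := (i%:R / n%:R, j%:R / n%:R).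
have sq i j : (i <= n)%N -> (j <= n)%N -> square (pt i j) by exact: grid_square.
have d2 : 4 * (1 / 256) = 1 / 64 :> R by field.
have near2 z z' : square z -> square z' -> `|z.1 - z'.1| < d -> `|z.2 - z'.2| < d ->
    `|f1 z - f1 z'| < 1 / 64 /\ `|f2 z - f2 z'| < 1 / 64.
  move=> Sz Sz' z1 z2; have H i (i4 : (i < 4)%N) := Hd i _ _ i4 Sz Sz' z1 z2.
  rewrite -d2; split; last by apply: f2_near; apply: H.
  by apply: f1_near; rewrite ?H //; [apply: pos|apply: label_le1|apply: pos|apply: label_le1].
have : \big[addb/false]_(j < n) crosses (fun i j => f1 (pt i j)) (fun i j => f2 (pt i j))
    n j n j.+1 = false.
  apply: (@even_crossings R (1 / 64)).
  - by rewrite divr_gt0.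
  - move=> i j im jn; have Sz := sq _ _ im jn; apply: away_origin; try exact: pos.
    + exact: sum1.
    + exact: edge13.
    + exact: triangle012.
  - move=> i j im jn; apply: near2; [exact: sq im (ltnW jn)|exact: sq| |exact: step].
    by rewrite subrr normr0.
  - move=> i j im jn; apply: near2; [exact: sq (ltnW im) jn|exact: sq|exact: step|].
    by rewrite subrr normr0.
  - by move=> i im; rewrite /f1 /pt divff ?gt_eqF // mul0r !closing.
  - by move=> i im; rewrite /f2 /pt divff ?gt_eqF // mul0r !closing.
  - by move=> j jn; rewrite /f2 /pt !mul0r !(centre _ (j%:R / n%:R)).
have k3 : (3 * k < n)%N by rewrite /n /k; lia.
rewrite (bigD1 (Ordinal k3)) //= boundary_crossing // eqxx big1 // => j jk.
by rewrite boundary_crossing //; apply/negbTE.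
Qed.

End Labels.

(** * Triangles of a disc that caps off a loop of length four *)

Section CrossingTriangle.
Local Open Scope classical_set_scope.
Local Open Scope ring_scope.
Variables (R : realType) (V : Type) (K : complex V) (v0 v1 v2 v3 : V).
Variables (P : triangulation R (@disc R)) (h : cell P 0 -> V) (low : V -> Prop).
Let c := [tuple v0; v1; v2; v3].
Hypothesis caps : @caps_off R V K 4 c P h.

Let joined v := exists s, [/\ simplices K s, s v1 & s v].

Let color v : nat :=
  if `[< v = v1 >] then 1%N else if ~~ `[< joined v >] then 3%N
  else if `[< low v >] then 0%N else 2%N.

Let weight (i : nat) : cell P 0 -> R := fun v => (color (h v) == i)%:R.

Let l i z := @ext R (R * R)%type (@disc R) P (weight i) (polar z).

Lemma cell_simplex n (s : cell P n) : simplices K (h @` cell_vertices s).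
Proof. by case: caps => H _; apply: H. Qed.

Lemma label_formula z : square z -> exists n (s : cell P n) (x : 'rV[R]_n.+1),
  std_simplex x /\ forall i, l i z = \sum_j x 0 j * weight i (vert s j).
Proof.
move=> Sz; have [n [s [x [ox zE]]]] := X_char P (polar_disc Sz).
exists n, s, x; split=> [|i]; first exact: open_std.
by rewrite /l zE ext_char //; apply: open_std.
Qed.

Lemma label_neq0 n (s : cell P n) (x : 'rV[R]_n.+1) i :
  \sum_j x 0 j * weight i (vert s j) != 0 -> exists j, color (h (vert s j)) = i.
Proof.
apply: contra_neqP => H; rewrite big1 // => j _; rewrite /weight.
by case: eqP => [E|]; [case: H; exists j|rewrite mulr0].
Qed.

Lemma vert_in n (s : cell P n) j : (h @` cell_vertices s) (h (vert s j)).
Proof. by exists (vert s j) => //; exists j; apply: vertP. Qed.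

Lemma color1 v : color v = 1%N -> v = v1.
Proof. by rewrite /color; case: asboolP => // _; case: asboolP => //= _; case: asboolP. Qed.

Lemma color0 v : color v = 0%N -> v <> v1 /\ low v.
Proof. by rewrite /color; case: asboolP => // ?; case: asboolP => //= _; case: asboolP. Qed.

Lemma color2 v : color v = 2%N -> v <> v1 /\ ~ low v.
Proof. by rewrite /color; case: asboolP => // ?; case: asboolP => //= _; case: asboolP. Qed.

Lemma color3 v : color v = 3%N -> ~ joined v.
Proof. by rewrite /color; case: asboolP => // ?; case: asboolP => //= _; case: asboolP. Qed.

Lemma color_lt4 v : (color v < 4)%N.
Proof. by rewrite /color; case: asboolP => // ?; case: asboolP => //= _; case: asboolP. Qed.

Hypotheses (n01 : v0 <> v1) (n21 : v2 <> v1) (low0 : low v0) (high2 : ~ low v2)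
  (far3 : ~ joined v3).

Lemma arc_joined (i : 'I_4) :
  exists s, [/\ simplices K s, s (tnth c i) & s (tnth c (ordS i))].
Proof.
have [_ arcs] := caps.
have [_ [e He]] := arcs i.
have E (phi : V -> R) : phi (tnth c i) = phi (h (vert e ord0)) /\
    phi (tnth c (ordS i)) = phi (h (vert e ord_max)).
  have e0 t := @ext_arc R V K c P h caps phi i t.
  have := e0 0; have := e0 1; rewrite !lexx ler01 => /(_ isT) E1 /(_ isT) E0.
  split.
    rewrite -[RHS]/((phi \o h) _) phi_vert He; last exact: std_vertex.
    by rewrite mxE /= E0 subr0 mul1r mul0r addr0.
  rewrite -[RHS]/((phi \o h) _) phi_vert He; last exact: std_vertex.
  by rewrite mxE !eqxx /= E1 subrr mul1r mul0r add0r.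
have same u v : (forall phi : V -> R, phi u = phi v) -> u = v.
  move=> H; have := H (fun x => (`[< x = v >])%:R); rewrite [in RHS]asboolT //.
  by case: asboolP => // _ /eqP; rewrite eq_sym oner_eq0.
exists (h @` cell_vertices e); split; first exact: cell_simplex.
  by rewrite (same _ _ (fun phi => (E phi).1)); apply: vert_in.
by rewrite (same _ _ (fun phi => (E phi).2)); apply: vert_in.
Qed.

Lemma color_boundary j : (j < 4)%N -> color (nth v0 c j) = (nth 0%N [:: 0; 1; 2; 3] j)%N.
Proof.
have j0 : joined v0.
  have [s] := arc_joined ord0; rewrite (_ : ordS ord0 = inord 1); last first.
    by apply: val_inj; rewrite /= inordK //.
  by rewrite !(tnth_nth v0) /= inordK //= => -[Ks s0 s1]; exists s.
have j2 : joined v2.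
  have [s] := arc_joined (inord 1); rewrite (_ : ordS (inord 1) = inord 2); last first.
    by apply: val_inj; rewrite /= !inordK //.
  by rewrite !(tnth_nth v0) /= !inordK //= => -[Ks s0 s1]; exists s.
case: j => [|[|[|[|j]]]] //= _; rewrite /color.
- by rewrite asboolF // asboolT //= asboolT.
- by rewrite asboolT.
- by rewrite asboolF // asboolT //= asboolF.
- rewrite asboolF; first by rewrite asboolF.
  by move=> e; case: far3; rewrite e; have [s [? ? ?]] := j0; exists s.
Qed.

(** The loop has the colors 0, 1, 2, 3.  No simplex has both colors 1 and 3; were there no
    triangle with the colors 0, 1, 2, the total barycentric weights of the colors would
    satisfy the hypotheses of no_labels. *)
Lemma crossing_triangle : exists (s : cell P 2) v v',
  [/\ (h @` cell_vertices s) v1, (h @` cell_vertices s) v, (h @` cell_vertices s) v' &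
      [/\ v <> v1, v' <> v1, low v & ~ low v']].
Proof.
apply: contrapT => none; apply: (@no_labels R l).
- move=> i e _ e0; exact: ext_polar_uniform.
- move=> i z _ /label_formula[n [s [x [[x0 _] ->]]]]; apply: sumr_ge0 => j _.
  by rewrite mulr_ge0 ?ler0n.
- move=> z /label_formula[n [s [x [[_ x1] H]]]]; rewrite !H -!big_split -[RHS]x1 /=.
  apply: eq_bigr => j _; rewrite -!mulrDr -[RHS]mulr1; congr (_ * _).
  rewrite /weight; have := color_lt4 (h (vert s j)).
  by case: (color _) => [|[|[|[|i]]]] //= _; rewrite ?addr0 ?add0r.
- move=> z /label_formula[n [s [x [_ H]]]]; rewrite !H; apply/eqP.
  rewrite -[_ == _]negbK mulf_eq0 negb_or; apply/negP => /andP[].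
  move=> /label_neq0[j /color1 hj] /label_neq0[j' /color3]; case.
  by exists (h @` cell_vertices s); split;
    [exact: cell_simplex|rewrite -hj; exact: vert_in|exact: vert_in].
- move=> z /label_formula[n [s [x [_ H]]]]; rewrite !H; apply/eqP.
  rewrite -[_ == _]negbK !mulf_eq0 !negb_or; apply/negP => /andP[/andP[]].
  move=> /label_neq0[j0 c0] /label_neq0[j1 c1] /label_neq0[j2 c2].
  have n2 : n = 2%N.
    have u : uniq [:: j0; j1; j2].
      by rewrite /= !inE !andbT; apply/andP; split; [apply/norP; split|];
        apply/eqP => e; [move: c0|move: c0|move: c1]; rewrite e ?c1 ?c2.
    have := max_card (mem [:: j0; j1; j2]).
    rewrite (card_uniqP u) card_ord /= => n3; have := cell_le2 s; lia.
  subst n; apply: none; exists s, (h (vert s j0)), (h (vert s j2)).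
  have [? ?] := color0 c0; have [? ?] := color2 c2.
  by split=> //; try exact: vert_in; rewrite -(color1 c1); exact: vert_in.
- by move=> i t; rewrite /l /polar /= !mul0r.
- move=> i r; rewrite /l /polar /=; congr (ext _ (_, _)); rewrite mulr1 mulr0.
    by rewrite -[2 * pi]add0r [2 * pi]mulrC mulr_natr cosD2pi.
  by rewrite -[2 * pi]add0r [2 * pi]mulrC mulr_natr sinD2pi.
- move=> i j t i4 j4 t01; rewrite /l polar1.
  have := @ext_arc R V K c P h caps (fun v => (color v == j)%:R) (Ordinal i4) t t01.
  rewrite /= => ->; rewrite !(tnth_nth v0) !color_boundary ?ltn_mod //.
  have nthE u : (u < 4)%N -> nth 0%N [:: 0; 1; 2; 3]%N u = u by case: u => [|[|[|[|u]]]].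
  by rewrite !nthE ?ltn_mod // [i == j]eq_sym [(i.+1 %% 4)%N == j]eq_sym.
Qed.

End CrossingTriangle.

(** * Simplices around the class of <a> *)

Section Complex.
Local Open Scope group_scope.
Local Open Scope classical_set_scope.
Local Open Scope card_scope.
Implicit Types (x y z g w : F3) (A B S T : set F3) (u v : set (set F3)).

Definition va := ff_class [set ga].
Definition vb := ff_class [set gb].

Lemma rank_va : rank_of va 1. Proof. exact: rank1 basis3_std. Qed.

Lemma rank_vb : rank_of vb 1.
Proof. exact: rank1 (basis3_swap basis3_std). Qed.

Lemma extra_edge_rank u v : ff_extra_edge u v -> rank_of u 2 /\ rank_of v 2.
Proof.
case=> a' [x [y [B -> ->]]]; split; first exact: rank2 B.
exact: rank2 (basis3_swap23 B).
Qed.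

Lemma simplex_edge s u v : simplices F3' s -> s u -> s v -> u <> v ->
  ff_edge u v \/ ff_extra_edge u v.
Proof. by case=> _ _ _ H su sv; apply: H. Qed.

Lemma rank_neq u v r r' : rank_of u r -> rank_of v r' -> r <> r' -> u <> v.
Proof. by move=> ur vr rr uv; apply: rr; rewrite uv in ur; apply: rank_of_uniq ur vr. Qed.

(** The added edges join classes of rank 2, and [<a>] has rank 1, so the edge from [<a>] to u
    is a containment; equal ranks being excluded by u <> [<a>], u has rank 2 and is the
    larger side. *)
Lemma neighbour_va s u : simplices F3' s -> s va -> s u -> u <> va ->
  rank_of u 2 /\ exists2 B, u B & exists g, B (ga ^ g).
Proof.
move=> Ks sa su ua.
case: (simplex_edge Ks sa su (nesym ua)) => [E|/extra_edge_rank[r _]]; last first.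
  by have := rank_of_uniq rank_va r.
have [r ur /andP[r0 r3]] : exists2 r, rank_of u r & (0 < r < 3)%N.
  by apply: vertex_rank; case: Ks => _ + _ _; apply.
have r2 : r = 2%N.
  case: r r0 r3 ur => [|[|[|r]]] // _ _ ur.
  by case: ua; apply/esym/(ff_edge_rank E rank_va).
rewrite {}r2 in ur; split=> //.
have [A [B [aA uB AB]]] := E.
have [_ [phi rA rkA]] := rank_of_member rank_va aA.
have [_ [phi' rB rkB]] := rank_of_member ur uB.
case: AB => [AB|/(retract_rank_le rB rA)]; last by rewrite rkA rkB.
exists B => //; have /conj_classE[g AE] := aA; exists g; apply: AB.
by rewrite AE; exists ga => //; apply: sub_gen.
Qed.

Lemma link_of_va s u v : simplices F3' s -> s va -> s u -> s v ->
  u <> va -> v <> va -> u <> v -> link_edge u v.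
Proof.
move=> Ks sa su sv ua vna uv.
have [ur ub] := neighbour_va Ks sa su ua; have [vr vb] := neighbour_va Ks sa sv vna.
case: (simplex_edge Ks su sv uv) => [/ff_edge_rank/(_ ur vr)//|E].
exact: link_edge_basis E ub vb.
Qed.

(** Killing a kills the conjugates of <a>, but not b. *)
Lemma va_vb : va <> vb.
Proof.
move=> E; have : va (gen [set gb]) by rewrite E; apply: conj_class_refl.
case/conj_classE=> g gE.
have [x xa xb] : [set x ^ g | x in gen [set ga]] gb by rewrite -gE; apply: sub_gen.
have ker : gen [set ga] `<=` [set x | q x = 1].
  apply: gen_sub => [|_ ->]; last exact: qa.
  split=> [|y z /= qy qz|y /= qy]; first exact: hom1 qM.
    by rewrite qM qy qz mulg1.
  by rewrite (homV qM) qy invg1.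
have := congr1 q xb; rewrite (homJ qM) (ker _ xa) conj1g qb => /(congr1 (@fg_word _)).
by [].
Qed.

Lemma vb_not_joined s : simplices F3' s -> s va -> ~ s vb.
Proof.
move=> Ks sa sb; case: (simplex_edge Ks sa sb va_vb) => [E|/extra_edge_rank[r _]].
  exact: va_vb (ff_edge_rank E rank_va rank_vb).
by have := rank_of_uniq rank_va r.
Qed.

Lemma simplex_card s (x : nat -> set (set F3)) : simplices F3' s ->
  (forall i, (i < 4)%N -> s (x i)) ->
  (forall i j, (i < j)%N -> (j < 4)%N -> x i <> x j) -> False.
Proof.
case=> _ _ s3 _ sx inj.
have xs : x @` `I_4 `<=` s by move=> _ [i i4 <-]; apply: sx.
have xI : {in `I_4 &, injective x}.
  move=> i j; rewrite !inE /= => i4 j4 xij.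
  by case: (ltngtP i j) => // H; [case: (inj i j)|case: (inj j i)].
have := inj_card_eq xI; rewrite card_eq_le => /andP[_ H].
have := card_le_trans (card_le_trans H (subset_card_le xs)) s3.
by rewrite card_le_II.
Qed.

(** ** The loop *)

Lemma pair_card (U : Type) (a b : U) : [set a; b] #<= `I_3.
Proof.
have -> : [set a; b] = (fun i => if i == 0%N then a else b) @` `I_2.
  apply/seteqP; split=> [_ [->|->]|_ [i _ <-]]; [by exists 0%N|by exists 1%N|].
  by case: (i == 0%N); [left|right].
by apply: card_le_trans (card_image_le _ _) _; rewrite card_le_II.
Qed.

Lemma pair_simplex u v : ff_vertex u -> ff_vertex v -> ff_edge u v ->
  simplices F3' [set u; v].
Proof.
move=> Vu Vv E; have E' : ff_edge v u.
  by case: E => A [B [uA vB AB]]; exists B, A; split=> //; case: AB; [right|left].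
split; first by exists u; left.
- by move=> _ [->|->].
- exact: pair_card.
- by move=> _ _ [->|->] [->|->] // _; left.
Qed.

Lemma edge_refl u : ff_vertex u -> ff_edge u u.
Proof. by case=> A [-> _ _]; exists A, A; split; [exact: conj_class_refl..|left]. Qed.

Lemma edge_sub S T : S `<=` T -> ff_edge (ff_class S) (ff_class T).
Proof.
move=> ST; exists (gen S), (gen T); split; [exact: conj_class_refl..|left].
by apply: gen_sub; [exact: subgroup_gen|apply: subset_trans ST _; exact: sub_gen].
Qed.

Definition loop w N := [tuple ff_class [set ga; gb]; va;
  ff_class [set ga; (w ^+ N * gb * w ^- N)%g]; vb].

Lemma loop_conj w N : w ^+ N * gb * w ^- N = gb ^ (w ^- N).
Proof. by rewrite /conjg invgK mulgA. Qed.

Lemma gen_powerV w N : gen [set gb; gc] w -> gen [set gb; gc] (w ^- N).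
Proof.
have [_ _ GV] := subgroup_gen [set gb; gc] => Gw.
exact: (GV _ (subgroupX _ (subgroup_gen _) Gw)).
Qed.

Lemma loop_basis w N : gen [set gb; gc] w ->
  basis3 ga (gb ^ (w ^- N)) (gc ^ (w ^- N)).
Proof. by move=> Gw; exact: (basis3_partial_conj (gen_powerV N Gw)). Qed.

Lemma loop_comb w N : gen [set gb; gc] w -> comb_loop F3' (loop w N).
Proof.
move=> Gw; have B := loop_basis N Gw.
have V0 : ff_vertex (ff_class [set ga; gb]) by apply: (@rank_vertex _ _ _ _ 2 basis3_std isT (segment2 _ _ _)).
have V1 : ff_vertex va by apply: (@rank_vertex _ _ _ _ 1 basis3_std isT (segment1 _ _ _)).
have V2 : ff_vertex (ff_class [set ga; gb ^ (w ^- N)]).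
  exact: (@rank_vertex _ _ _ _ 2 B isT (segment2 _ _ _)).
have V3 : ff_vertex vb by apply: (@rank_vertex _ _ _ _ 1 (basis3_swap basis3_std) isT (segment1 _ _ _)).
have vbE : vb = ff_class [set gb ^ (w ^- N)].
  by rewrite /vb -(ff_class_conj [set gb] (w ^- N)) image_set1.
have edge u v : ff_vertex u -> ff_vertex v -> ff_edge u v \/ ff_edge v u ->
    adjacent F3' u v \/ u = v.
  move=> Vu Vv E; have [|uv] := pselect (u = v); [by right|left; split=> //].
  by case: E => E; [|rewrite setUC]; apply: pair_simplex.
have sub1 x y : [set x] `<=` [set x; y] by move=> _ ->; left.
have sub2 x y : [set y] `<=` [set x; y] by move=> _ ->; right.
rewrite /loop loop_conj; split=> //.
  move=> i; rewrite -[[set _]]setUid.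
  suff : ff_vertex (tnth (loop w N) i).
    by rewrite /loop loop_conj => V; apply: pair_simplex (edge_refl V).
  rewrite /loop loop_conj (tnth_nth va); by case: i => -[|[|[|[|i]]]].
move=> i; rewrite !(tnth_nth va); case: i => -[|[|[|[|i]]]] //= _; apply: edge => //.
- by right; apply: edge_sub.
- by left; apply: edge_sub.
- by right; rewrite vbE; apply: edge_sub.
- by left; apply: edge_sub.
Qed.

(** ** Counting triangles *)

Variable R : realType.

(** In the link of [<a>], let low t be the vertices at distance less than t from [<a, b>].
    For t < N the triangle T t has a vertex in low (t + 1) and one outside, besides
    [<a>]; the latter is in low (t + 2).  If T t = T t' with t < t' then the vertex of T t'
    outside low (t' + 1) is a fourth vertex of the simplex. *)
Lemma triangle_count w N (P : triangulation R (@disc R)) h :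
  filling (gen [set gb; gc]) w -> @caps_off R _ F3' 4 (loop w N) P h ->
  (N <= #|cell P 2|)%N.
Proof.
move=> fw caps; have [Gw _] := fw; have B := loop_basis N Gw.
pose v0 := ff_class [set ga; gb]; pose v2 := ff_class [set ga; gb ^ (w ^- N)].
pose low t v := exists n (x : nat -> set (set F3)),
  [/\ (n < t)%N, x 0%N = v0, x n = v & forall i, (i < n)%N -> link_edge (x i) (x i.+1)].
have low_le t t' v : (t <= t')%N -> low t v -> low t' v.
  by move=> tt' [n [x [nt ? ? ?]]]; exists n, x; split=> //; apply: leq_trans tt'.
have lowS t v v' : low t v -> link_edge v v' -> low t.+1 v'.
  move=> [n [x [nt x0 xn xe]]] e.
  exists n.+1, (fun i => if (i <= n)%N then x i else v').
  split=> //=; first by rewrite ltnn.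
  move=> i; rewrite ltnS => iN; rewrite iN; have [//|ni] := leqP i.+1 n; first exact: xe.
  by have -> : i = n; [lia|rewrite xn].
have r0 : rank_of v0 2 := rank2 basis3_std.
have cross (t : 'I_N) : exists (s : cell P 2) v v',
  [/\ (h @` cell_vertices s) va, (h @` cell_vertices s) v, (h @` cell_vertices s) v' &
      [/\ v <> va, v' <> va, low t.+1 v & ~ low t.+1 v']].
  move: caps; rewrite /loop loop_conj => caps'.
  apply: (crossing_triangle caps').
  - exact: rank_neq r0 rank_va _.
  - exact: rank_neq (rank2 B) rank_va _.
  - by exists 0%N, (fun=> v0).
  - move=> [n [x [nt x0 xn xe]]].
    have := link_distance Gw (filling_root_free fw) x0 xn xe; have := ltn_ord t; lia.
  - by case=> s [Ks sa]; apply: vb_not_joined.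
pose T t := projT1 (cid (cross t)).
have Tinj : injective T.
  have lt_neq (t t' : 'I_N) : (t < t')%N -> T t <> T t'.
    rewrite /T; case: (cid _) => s /= [v [v' [sa sv sv' [va_ va' lv lv']]]].
    case: (cid _) => s' /= [u [u' [_ _ su' [_ ua' _ lu']]]] tt' E; rewrite -E in su'.
    have Ks : simplices F3' (h @` cell_vertices s) by case: caps => H _; apply: H.
    have vv' : v <> v' by move=> e; apply: lv'; rewrite -e.
    have lv1 := lowS _ _ _ lv (link_of_va Ks sa sv sv' va_ va' vv').
    apply: (simplex_card (x := nth va [:: va; v; v'; u'])) Ks _ _.
      by case=> [|[|[|[|]]]].
    have d1 : v <> u' by move=> e; apply: lu'; rewrite -e; apply: low_le lv; lia.
    have d2 : v' <> u' by move=> e; apply: lu'; rewrite -e; apply: low_le lv1.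
    by case=> [|[|[|[|i]]]] [|[|[|[|j]]]] //= _ _; apply: nesym.
  move=> t t' E; apply: val_inj => /=; case: (ltngtP t t') => // H; exfalso.
    exact: lt_neq H E.
  exact: lt_neq H (esym E).
by have := leq_card T Tinj; rewrite card_ord.
Qed.

End Complex.

Lemma triangles_bound (R : realType) w N : filling (gen [set gb; gc]) w ->
  triangles_needed F3' (loop w N) (N%:R / 6%:R : R)%R.
Proof.
move=> fw P h caps; have NP := triangle_count fw caps.
rewrite ler_pdivrMr ?ltr0n // -natrM ler_nat; apply: leq_trans NP _.
by rewrite leq_pmulr.
Qed.

Local Open Scope classical_set_scope.

Theorem mainTheorem3 (R : realType) :
  (forall w : F3,
     gen [set gb; gc] w ->
     cyclically_reduced w ->
     filling (gen [set gb; gc]) w ->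
     ~ (exists (u : F3) (n : nat), (1 < n)%N /\ w = (u ^+ n)%g) ->
     forall N : nat, (0 < N)%N ->
       let c_N := [tuple ff_class [set ga; gb];
                         ff_class [set ga];
                         ff_class [set ga; (w ^+ N * gb * w ^- N)%g];
                         ff_class [set gb]] in
       comb_loop F3' c_N /\
       triangles_needed F3' c_N (N%:R / 6%:R : R)%R) /\
  ~ isoperimetric R F3'.
Proof.
split=> [w Gw _ fw _ N _ /=|[f fP]].
  by split; [apply: loop_comb|apply: triangles_bound].
have fw := filling_commutator; have [Gw _] := fw.
have [P [h [caps Pf]]] := fP _ _ (loop_comb (f 4).+1 Gw).
by have := triangle_count fw caps; rewrite leqNgt ltnS Pf.
Qed.
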